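(* The Lie algebra $\mathfrak g$ of Lie point symmetries of the system of geodesic equations of the charged squashed Kaluza–Klein black hole metric $$ds^2=-f(r)\,dt^2+\frac{k^2(r)}{f(r)}\,dr^2+\frac{r^2}{4}\left[k(r)(\sigma_1^2+\sigma_2^2)+\sigma_3^2\right]$$ has the basis $$\mathbf X_1=\frac{\partial}{\partial s},\quad \mathbf X_2=s\frac{\partial}{\partial s},\quad \mathbf X_3=\frac{\partial}{\partial t},\quad \mathbf X_4=\frac{\partial}{\partial\varphi},\quad \mathbf X_5=\frac{\partial}{\partial\psi},$$ $$\mathbf X_6=\sin\varphi\,\frac{\partial}{\partial\theta}+\cos\varphi\cot\theta\,\frac{\partial}{\partial\varphi}-\cos\varphi\csc\theta\,\frac{\partial}{\partial\psi},$$ $$\mathbf X_7=\cos\varphi\,\frac{\partial}{\partial\theta}-\sin\varphi\cot\theta\,\frac{\partial}{\partial\varphi}+\sin\varphi\csc\theta\,\frac{\partial}{\partial\psi},$$ whose nonzero commutators (up to antisymmetry) are $$[\mathbf X_1,\mathbf X_2]=\mathbf X_1,\quad [\mathbf X_4,\mathbf X_6]=\mathbf X_7,\quad [\mathbf X_4,\mathbf X_7]=-\mathbf X_6,\quad [\mathbf X_6,\mathbf X_7]=\mathbf X_4.$$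
   Context: The coordinates are $(t,r,\theta,\varphi,\psi)$ with $0\le\theta<\pi$, $0\le\varphi<2\pi$, $0\le\psi<2\pi$, $0<r<r_\infty$ (restricted to the open region where the metric is defined and nondegenerate), and $$\sigma_1=\cos\psi\,d\theta+\sin\psi\sin\theta\,d\varphi,\quad \sigma_2=-\sin\psi\,d\theta+\cos\psi\sin\theta\,d\varphi,\quad \sigma_3=d\psi+\cos\theta\,d\varphi,$$ $$f(r)=1-\frac{2M}{r^2}+\frac{q^2}{r^4},\qquad k(r)=\frac{f(r_\infty)\,r_\infty^4}{(r^2-r_\infty^2)^2},$$ where $M$ and $q$ are real constants (the mass and the charge of the black hole), $q\neq0$, and $r_\infty>0$ is a constant. Writing $(x^1,\dots,x^5)=(t,r,\theta,\varphi,\psi)$ as functions of the parameter $s$, the geodesic equations are $\ddot x^i+\Gamma^i_{jk}\dot x^j\dot x^k=0$, $i=1,\dots,5$, where $\Gamma^i_{jk}$ are the Christoffel symbols of the metric and the dot is $d/ds$. Denote the left-hand sides by $R_i(s,x,\dot x,\ddot x)$. For a vector field $\mathbf X=\xi(s,x)\frac{\partial}{\partial s}+\eta^\alpha(s,x)\frac{\partial}{\partial x^\alpha}$ its second prolongation is $\mathbf X^{[2]}=\mathbf X+\eta^\alpha_{(1)}\frac{\partial}{\partial\dot x^\alpha}+\eta^\alpha_{(2)}\frac{\partial}{\partial\ddot x^\alpha}$ with $\eta^\alpha_{(1)}=D\eta^\alpha-\dot x^\alpha D\xi$, $\eta^\alpha_{(2)}=D\eta^\alpha_{(1)}-\ddot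 x^\alpha D\xi$, where $D$ is the total derivative with respect to $s$. $\mathbf X$ is a Lie point symmetry of the system if $\mathbf X^{[2]}R_i=0$ for all $i$ whenever $R_1=\dots=R_5=0$. The Lie point symmetries form a real Lie algebra under the commutator of vector fields.
   Formalization: Symmetries are smooth vector fields on any nonempty connected open domain of (s,x) over the region where the metric is nondegenerate; if f vanishes in (0,r∞) the whole region is disconnected and the claim fails there (take ∂/∂t on one component, 0 on the others). *)

(* Defs.v *)
From HB Require Import structures.
From mathcomp Require Import all_boot all_order all_algebra.
From mathcomp Require Import all_classical all_reals all_analysis.
Set Implicit Arguments.
Unset Strict Implicit.
Unset Printing Implicit Defensive.
Import Order.TTheory GRing.Theory Num.Theory.
Import numFieldNormedType.Exports.
Local Open Scope classical_set_scope.
Local Open Scope ring_scope.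

Section Geodesics.
Context {R : realType} {n : nat}.

(* (s, x), (s, x, x') and (s, x, x', x''), nested to the left: for p : jet2,
   p.1.1.1 = s, p.1.1.2 = x, p.1.2 = x' and p.2 = x''. *)
Definition base : Type := (R * 'rV[R]_n)%type.
Definition jet1 : Type := (R * 'rV[R]_n * 'rV[R]_n)%type.
Definition jet2 : Type := (R * 'rV[R]_n * 'rV[R]_n * 'rV[R]_n)%type.

Definition evec (i : 'I_n) : 'rV[R]_n := delta_mx 0 i.

(* X z = (xi z, eta z) stands for xi d/ds + eta^i d/dx^i. *)
Definition vfield : Type := R * 'rV[R]_n -> R * 'rV[R]_n.
Definition xi (X : vfield) (z : base) : R := (X z).1.
Definition eta (X : vfield) (i : 'I_n) (z : base) : R := (X z).2 0 i.

(* X(F), for a possibly vector-valued F *)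
Definition vf_act {W : normedModType R} (X : vfield)
    (F : R * 'rV[R]_n -> W) (z : base) : W :=
  xi X z *: 'D_((1, 0) : R * 'rV[R]_n) F z
  + \sum_i eta X i z *: 'D_((0, evec i) : R * 'rV[R]_n) F z.

Definition bracket (X Y : vfield) : vfield :=
  fun z => vf_act X Y z - vf_act Y X z.

(* The total derivative D raises the order by one: D0 sends functions of (s, x)
   to functions of (s, x, x'), and D1 sends functions of (s, x, x') to functions
   of (s, x, x', x''). *)
Definition D0 (h : R * 'rV[R]_n -> R) (p : jet1) : R :=
  'D_((1, 0) : R * 'rV[R]_n) h p.1
  + \sum_i p.2 0 i * 'D_((0, evec i) : R * 'rV[R]_n) h p.1.

Definition D1 (h : R * 'rV[R]_n * 'rV[R]_n -> R) (p : jet2) : R :=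
  'D_((1, 0, 0) : R * 'rV[R]_n * 'rV[R]_n) h p.1
  + \sum_i p.1.2 0 i * 'D_((0, evec i, 0) : R * 'rV[R]_n * 'rV[R]_n) h p.1
  + \sum_i p.2 0 i * 'D_((0, 0, evec i) : R * 'rV[R]_n * 'rV[R]_n) h p.1.

Definition eta1 (X : vfield) (i : 'I_n) (p : jet1) : R :=
  D0 (eta X i) p - p.2 0 i * D0 (xi X) p.

Definition eta2 (X : vfield) (i : 'I_n) (p : jet2) : R :=
  D1 (eta1 X i) p - p.2 0 i * D0 (xi X) p.1.

Definition prolong2 (X : vfield)
    (F : R * 'rV[R]_n * 'rV[R]_n * 'rV[R]_n -> R) (p : jet2) : R :=
  let J2 : normedModType R := (R * 'rV[R]_n * 'rV[R]_n * 'rV[R]_n)%type in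
  xi X p.1.1 * 'D_((1, 0, 0, 0) : J2) F p
  + \sum_i eta X i p.1.1 * 'D_((0, evec i, 0, 0) : J2) F p
  + \sum_i eta1 X i p.1 * 'D_((0, 0, evec i, 0) : J2) F p
  + \sum_i eta2 X i p * 'D_((0, 0, 0, evec i) : J2) F p.

Definition christoffel (g : 'rV[R]_n -> 'M[R]_n) (i j k : 'I_n)
    (x : 'rV[R]_n) : R :=
  2^-1 * \sum_l invmx (g x) i l *
    ('D_(evec j) (fun y => g y l k) x + 'D_(evec k) (fun y => g y l j) x
     - 'D_(evec l) (fun y => g y j k) x).

Definition geodesic (g : 'rV[R]_n -> 'M[R]_n) (i : 'I_n) (p : jet2) : R :=
  p.2 0 i
  + \sum_j \sum_k christoffel g i j k p.1.1.2 * p.1.2 0 j * p.1.2 0 k.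

(* Iterated directional derivatives along arbitrary constant directions; in
   finite dimension this is the usual class C^m (resp. C^oo) on an open U. *)
Fixpoint Cm {V W : normedModType R} (m : nat) (U : set V) (F : V -> W) : Prop :=
  (forall z, U z -> {for z, continuous F}) /\
  match m with
  | 0 => True
  | m'.+1 => forall v, (forall z, U z -> derivable F z v) /\ Cm m' U ('D_v F)
  end.

Definition smooth {V W : normedModType R} (U : set V) (F : V -> W) : Prop :=
  forall m, Cm m U F.

(* Vector fields are total functions of which only the values on the open set U
   matter. *)
Definition lie_symmetry (g : 'rV[R]_n -> 'M[R]_n) (U : set (R * 'rV[R]_n)) :
    set vfield :=
  [set X | smooth U X /\
    forall p : jet2, U p.1.1 -> (forall i, geodesic g i p = 0) ->
      forall i, prolong2 X (geodesic g i) p = 0].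

Definition lie_algebra (L : set vfield) : Prop :=
  [/\ L (fun=> 0),
      forall (a : R) X Y, L X -> L Y -> L (fun z => a *: X z + Y z) &
      forall X Y, L X -> L Y -> L (bracket X Y)].

(* Vector fields are identified when they agree on U. *)
Definition basis_on (U : set (R * 'rV[R]_n)) (L : set vfield) (m : nat)
    (B : 'I_m -> vfield) : Prop :=
  [/\ forall i, L (B i),
      forall c : 'I_m -> R,
        (forall z, U z -> \sum_i c i *: B i z = 0) -> forall i, c i = 0 &
      forall X, L X ->
        exists c : 'I_m -> R, forall z, U z -> X z = \sum_i c i *: B i z].

End Geodesics.

Arguments base : clear implicits.
Arguments jet1 : clear implicits.
Arguments jet2 : clear implicits.
Arguments vfield : clear implicits.

Section SquashedKaluzaKlein.
Context {R : realType}.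

Definition it : 'I_5 := @Ordinal 5 0 isT.
Definition ir : 'I_5 := @Ordinal 5 1 isT.
Definition ith : 'I_5 := @Ordinal 5 2 isT.
Definition iphi : 'I_5 := @Ordinal 5 3 isT.
Definition ipsi : 'I_5 := @Ordinal 5 4 isT.

Variables M q rinf : R.

Definition bh_f (r : R) : R := 1 - 2 * M / r ^+ 2 + q ^+ 2 / r ^+ 4.

Definition bh_k (r : R) : R :=
  bh_f rinf * rinf ^+ 4 / (r ^+ 2 - rinf ^+ 2) ^+ 2.

(* Covectors are rows of components in the basis dt, dr, dtheta, dphi, dpsi,
   whose members are the evec i. *)
Definition sigma1 (x : 'rV[R]_5) : 'rV[R]_5 :=
  cos (x 0 ipsi) *: evec ith + (sin (x 0 ipsi) * sin (x 0 ith)) *: evec iphi.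
Definition sigma2 (x : 'rV[R]_5) : 'rV[R]_5 :=
  - sin (x 0 ipsi) *: evec ith + (cos (x 0 ipsi) * sin (x 0 ith)) *: evec iphi.
Definition sigma3 (x : 'rV[R]_5) : 'rV[R]_5 :=
  evec ipsi + cos (x 0 ith) *: evec iphi.

Definition sq (w : 'rV[R]_5) : 'M[R]_5 := w^T *m w.

Definition bh_metric (x : 'rV[R]_5) : 'M[R]_5 :=
  let r := x 0 ir in
  - bh_f r *: sq (evec it)
  + (bh_k r ^+ 2 / bh_f r) *: sq (evec ir)
  + (r ^+ 2 / 4) *: (bh_k r *: (sq (sigma1 x) + sq (sigma2 x)) + sq (sigma3 x)).

(* bh_f r != 0 makes the coefficient of dr^2 meaningful, and nondegeneracy
   excludes theta = 0 and f(rinf) = 0.  phi and psi are kept as real (unwrapped)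
   coordinates, so that every chart of the angles is covered. *)
Definition bh_region : set 'rV[R]_5 :=
  [set x : 'rV[R]_5 | [/\ 0 < x 0 ir < rinf, 0 <= x 0 ith < pi,
               bh_f (x 0 ir) != 0 & bh_metric x \in unitmx]].

End SquashedKaluzaKlein.

Section Generators.
Context {R : realType}.

Definition cot (a : R) : R := cos a / sin a.
Definition csc (a : R) : R := (sin a)^-1.

Definition X1 : vfield R 5 := fun z => (1, 0).
Definition X2 : vfield R 5 := fun z => (z.1, 0).
Definition X3 : vfield R 5 := fun z => (0, evec it).
Definition X4 : vfield R 5 := fun z => (0, evec iphi).
Definition X5 : vfield R 5 := fun z => (0, evec ipsi).
Definition X6 : vfield R 5 := fun z =>
  let th := z.2 0 ith in let phi := z.2 0 iphi in
  (0, sin phi *: evec ith + (cos phi * cot th) *: evec iphi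
      - (cos phi * csc th) *: evec ipsi).
Definition X7 : vfield R 5 := fun z =>
  let th := z.2 0 ith in let phi := z.2 0 iphi in
  (0, cos phi *: evec ith - (sin phi * cot th) *: evec iphi
      + (sin phi * csc th) *: evec ipsi).

(* bh_basis i is X_(i+1). *)
Definition bh_basis : 'I_7 -> vfield R 5 :=
  tnth [tuple X1; X2; X3; X4; X5; X6; X7].

End Generators.

(* Main.v *)
From HB Require Import structures.
From mathcomp Require Import all_boot all_order all_algebra.
From mathcomp Require Import all_classical all_reals all_analysis.
From mathcomp Require Import ring lra.
Require Import Defs.
Set Implicit Arguments.
Unset Strict Implicit.
Unset Printing Implicit Defensive.
Import Order.TTheory GRing.Theory Num.Theory.
Import numFieldNormedType.Exports.
Local Open Scope classical_set_scope.
Local Open Scope ring_scope.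

(** On the geodesics the prolonged equations are cubic polynomials in the free
    velocities [x'], with coefficients depending on [(s, x)]. So [X] is a
    symmetry exactly when these coefficients vanish ([determiningP]): with
    [Gam] the Levi-Civita connection, [xi] has vanishing Hessian in [x], the
    Lie derivative of [Gam] along [eta] is the symmetrized product of the
    identity with [d xi_s], [2 nabla eta_s = xi_ss id], and [eta_ss = 0].

    Over the r line the metric consists of a warped line of t and of the orbits
    of the sphere rotations and fibre translations, which carry Berger sphere
    metrics of varying shape. Where [f' <> 0], a dense subset because [q <> 0],
    the metric is so rigid that the equations can be solved by differentiation
    and linear algebra; the curvature enters only through a few commuted third
    derivatives. A function with vanishing Hessian is constant ([pd_xi_eq0]),
    so [xi] depends on [s] only, and a field whose covariant derivative is a
    multiple of the identity is zero ([pds_eq0_all]), so [eta_s = 0] and [xi_ss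
    = 0]. Now [eta] is affine, so it preserves the curvature operator [R(.,
    d_t) d_t]. On the orbits this operator has two eigenvalues, whose quotient
    [nu1 / nu2] has no critical point as a function of r: hence [eta^r = 0]
    ([eta_r_eq0]). The radial equations make [eta] independent of r, and as the
    shape [kap] of the orbits varies with r, the orbit components are
    independent of t as well ([kap_separates], [pd_t_eta]); then [eta^t] is
    constant. What remains is a field on the orbits that preserves the round
    metric of the sphere and the connection form of the fibration
    ([orbit_eqs]): a rotation plus a translation of psi.

    The seven coefficients of such a field are explicit expressions in its
    components and their first derivatives. Their gradients vanish on a dense
    open subset, hence on [U] by continuity, and [U] is connected; so every
    symmetry is a combination of the seven generators ([classification]).
    Conversely, a combination with undetermined coefficients satisfies the
    determining equations ([determining_gen]), and one computation of the
    commutator of two such combinations ([bracket_gen]) gives both the closure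
    under brackets and the commutator table. *)

(** * Rules for directional derivatives *)

Section DirectionalCalculus.
Context {R : realType} {V : normedModType R}.
Implicit Types (f g : V -> R) (z v : V).

(** A directional derivative is an ordinary derivative along a line: through
    this equivalence the chain rule and the mean value theorem in one variable
    apply to functions on a normed space. *)
Lemma is_derive_line {W : normedModType R} (F : V -> W) z v t dF :
  is_derive (t *: v + z) v F dF <-> is_derive t 1 (fun h => F (h *: v + z)) dF.
Proof.
have E : (fun h : R => h^-1 *: ((F \o shift (t *: v + z)) (h *: v)
                              - F (t *: v + z)))
   = (fun h => h^-1 *: (((fun h => F (h *: v + z)) \o shift t) (h *: (1 : R))
                         - F (t *: v + z))).
  by apply/funext => h /=; rewrite [_ *: 1]mulr1 scalerDl addrA.
split=> -[].
  rewrite /derivable /derive E => c d; exact: DeriveDef.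
rewrite /derivable /derive -E => c d; exact: DeriveDef.
Qed.

Lemma is_derive_line0 {W : normedModType R} (F : V -> W) z v dF :
  is_derive z v F dF <-> is_derive (0 : R) 1 (fun h => F (h *: v + z)) dF.
Proof. by rewrite -is_derive_line scale0r add0r. Qed.

Lemma is_derive_comp (g : R -> R) f z v dg df :
  is_derive (f z) 1 g dg -> is_derive z v f df ->
  is_derive z v (fun y => g (f y)) (dg * df).
Proof.
move=> hg /is_derive_line0 hf; apply/is_derive_line0.
apply: (@is_derive1_comp R g (fun h => f (h *: v + z))) => //=.
by rewrite scale0r add0r.
Qed.

Lemma is_derive_add {W : normedModType R} (f g : V -> W) z v df dg :
  is_derive z v f df -> is_derive z v g dg ->
  is_derive z v (fun y => f y + g y) (df + dg).
Proof. exact: is_deriveD. Qed.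

Lemma is_derive_opp {W : normedModType R} (f : V -> W) z v df :
  is_derive z v f df -> is_derive z v (fun y => - f y) (- df).
Proof. exact: is_deriveN. Qed.

Lemma is_derive_mul f g z v df dg :
  is_derive z v f df -> is_derive z v g dg ->
  is_derive z v (fun y => f y * g y) (df * g z + f z * dg).
Proof.
by move=> hf hg; apply: is_derive_eq (is_deriveM hf hg) _; rewrite addrC mulrC.
Qed.

Lemma is_derive_inv f z v df : f z != 0 -> is_derive z v f df ->
  is_derive z v (fun y => (f y)^-1) (- df / f z ^+ 2).
Proof.
move=> f0 [h <-]; apply: DeriveDef; first exact: derivableV.
by rewrite deriveV // /GRing.scale /= mulrC mulrN mulNr.
Qed.

Lemma is_derive_cstf {W : normedModType R} (c : W) z v :
  is_derive z v (fun=> c) 0.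
Proof. exact: is_derive_cst. Qed.

Lemma is_derive_sumf {W : normedModType R} n (h : 'I_n -> V -> W) z v
    (dh : 'I_n -> W) : (forall i, is_derive z v (h i) (dh i)) ->
  is_derive z v (fun y => \sum_i h i y) (\sum_i dh i).
Proof.
move=> H; have := is_derive_sum H; set F := (X in is_derive _ _ X _).
suff -> : F = (fun y => \sum_i h i y) by [].
by apply/funext => y; rewrite /F fct_sumE.
Qed.

Lemma is_derive_scal {W : normedModType R} f (w : W) z v df :
  is_derive z v f df -> is_derive z v (fun y => f y *: w) (df *: w).
Proof.
move=> [cf ef].
have key : (fun h => h^-1 *: (((fun y => f y *: w) \o shift z) (h *: v)
   - f z *: w)) @ 0^' --> df *: w.
  have -> : (fun h => h^-1 *: (((fun y => f y *: w) \o shift z) (h *: v)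
     - f z *: w)) = (fun h => (h^-1 *: ((f \o shift z) (h *: v) - f z)) *: w).
    by apply/funext => h /=; rewrite -scalerBl scalerA.
  apply: cvgZr_tmp; rewrite -ef; exact: cf.
by apply: DeriveDef; [apply/cvg_ex; exists (df *: w) | exact: cvg_lim key].
Qed.

Lemma is_derive_linear {W W' : normedModType R} (L : {linear W -> W'})
    (F : V -> W) z v dF : continuous L -> is_derive z v F dF ->
  is_derive z v (fun y => L (F y)) (L dF).
Proof.
move=> cL [cF eF].
have key : (fun h => h^-1 *: (((fun y => L (F y)) \o shift z) (h *: v)
   - L (F z))) @ 0^' --> L dF.
  have -> : (fun h => h^-1 *: (((fun y => L (F y)) \o shift z) (h *: v)
     - L (F z))) = L \o (fun h => h^-1 *: ((F \o shift z) (h *: v) - F z)).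
    by apply/funext => h /=; rewrite -linearB -linearZ.
  by apply: continuous_cvg; [exact: cL | rewrite -eF; exact: cF].
by apply: DeriveDef; [apply/cvg_ex; exists (L dF) | exact: cvg_lim key].
Qed.

Lemma derive_eq_on {W : normedModType R} (U : set V) (F G : V -> W) z v :
  open U -> U z -> (forall y, U y -> F y = G y) -> 'D_v F z = 'D_v G z.
Proof.
move=> oU Uz FG; apply: near_eq_derive.
by apply: filterS (open_nbhs_nbhs (conj oU Uz)) => y /FG.
Qed.

Lemma derivable_eq_on {W : normedModType R} (U : set V) (F G : V -> W) z v :
  open U -> U z -> (forall y, U y -> F y = G y) ->
  derivable F z v -> derivable G z v.
Proof.
move=> oU Uz FG; apply: near_eq_derivable.
by apply: filterS (open_nbhs_nbhs (conj oU Uz)) => y /FG.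
Qed.

Lemma is_derive_val {W : normedModType R} (F : V -> W) z v dF :
  is_derive z v F dF -> 'D_v F z = dF.
Proof. by case. Qed.

End DirectionalCalculus.

(* Conversion is kept from unfolding derivatives into limits. *)
#[local] Opaque derive derivable.

(** * The classes of m times differentiable functions *)

Section Regularity.
Context {R : realType} {V : normedModType R}.
Implicit Types (U : set V) (z v : V).

Lemma eq_Cm {W : normedModType R} m U (F G : V -> W) : open U ->
  (forall z, U z -> F z = G z) -> Cm m U F -> Cm m U G.
Proof.
move=> oU; elim: m F G => [|m IH] F G FG /= [cF H]; split.
- move=> z Uz; have := cF z Uz; rewrite /prop_for /continuous_at (FG z Uz).
  apply: cvg_trans; apply: near_eq_cvg.
  by apply: filterS (open_nbhs_nbhs (conj oU Uz)) => y /FG.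
- by [].
- move=> z Uz; have := cF z Uz; rewrite /prop_for /continuous_at (FG z Uz).
  apply: cvg_trans; apply: near_eq_cvg.
  by apply: filterS (open_nbhs_nbhs (conj oU Uz)) => y /FG.
- move=> v; have [dF CF] := H v; split.
    by move=> z Uz; exact: derivable_eq_on oU Uz FG (dF z Uz).
  by apply: (IH _ _ _ CF) => z Uz; exact: derive_eq_on oU Uz FG.
Qed.

Lemma Cm_subset {W : normedModType R} m U U' (F : V -> W) :
  U' `<=` U -> Cm m U F -> Cm m U' F.
Proof.
move=> sU; elim: m F => [|m IH] F /= [cF H]; split=> //.
- by move=> z /sU; exact: cF.
- by move=> z /sU; exact: cF.
- move=> v; have [dF CF] := H v; split; last exact: IH.
  by move=> z /sU; exact: dF.
Qed.

Lemma CmW {W : normedModType R} m U (F : V -> W) : Cm m.+1 U F -> Cm m U F.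
Proof.
elim: m F => [|m IH] F; first by case.
case=> cF H; split=> // v; have [dF CF] := H v; split=> //; exact: IH.
Qed.

Lemma Cm_cst {W : normedModType R} m U (c : W) : open U -> Cm m U (fun=> c).
Proof.
move=> oU; elim: m c => [|m IH] c /=; split=> //.
- by move=> z _; exact: cst_continuous.
- by move=> z _; exact: cst_continuous.
- move=> v; split; first by move=> z _; exact: derivable_cst.
  apply: (@eq_Cm _ _ _ (fun=> 0)) => // z _.
  by rewrite (is_derive_val (is_derive_cstf c z v)).
Qed.

Lemma Cm_add {W : normedModType R} m U (F G : V -> W) : open U ->
  Cm m U F -> Cm m U G -> Cm m U (fun z => F z + G z).
Proof.
move=> oU; elim: m F G => [|m IH] F G /= [cF HF] [cG HG]; split=> //.
- by move=> z Uz; apply: continuousD; [exact: cF|exact: cG].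
- by move=> z Uz; apply: continuousD; [exact: cF|exact: cG].
- move=> v; have [dF CF] := HF v; have [dG CG] := HG v; split.
    by move=> z Uz; exact: derivableD (dF z Uz) (dG z Uz).
  apply: (eq_Cm oU _ (IH _ _ CF CG)) => z Uz; apply/esym.
  exact: deriveD (dF z Uz) (dG z Uz).
Qed.

Lemma Cm_linear {W W' : normedModType R} m U (L : {linear W -> W'})
    (F : V -> W) : open U -> continuous L ->
  Cm m U F -> Cm m U (fun z => L (F z)).
Proof.
move=> oU cL; elim: m F => [|m IH] F /= [cF HF]; split=> //.
- by move=> z Uz; apply: continuous_comp; [exact: cF|exact: cL].
- by move=> z Uz; apply: continuous_comp; [exact: cF|exact: cL].
- move=> v; have [dF CF] := HF v; split.
    move=> z Uz.
    by have [] := is_derive_linear cL (derivableP (dF z Uz)).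
  apply: (eq_Cm oU _ (IH _ CF)) => z Uz; apply/esym.
  exact: is_derive_val (is_derive_linear cL (derivableP (dF z Uz))).
Qed.

Lemma Cm_mul m U (f g : V -> R) : open U ->
  Cm m U f -> Cm m U g -> Cm m U (fun z => f z * g z).
Proof.
move=> oU; elim: m f g => [|m IH] f g.
  by move=> [cf _] [cg _]; split=> // z Uz; apply: continuousM;
    [exact: cf|exact: cg].
move=> Cf Cg; have Cf' := CmW Cf; have Cg' := CmW Cg.
case: Cf Cg => cf Hf [cg Hg]; split.
  by move=> z Uz; apply: continuousM; [exact: cf|exact: cg].
move=> v; have [df Df] := Hf v; have [dg Dg] := Hg v.
have H z : U z -> is_derive z v (fun z => f z * g z)
    ('D_v f z * g z + f z * 'D_v g z).
  by move=> Uz; apply: is_derive_mul; apply: derivableP; [exact: df|exact: dg].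
split; first by move=> z Uz; case: (H z Uz).
apply: (eq_Cm oU _ (Cm_add oU (IH _ _ Df Cg') (IH _ _ Cf' Dg))) => z Uz.
by rewrite (is_derive_val (H z Uz)).
Qed.

Lemma Cm_scal {W : normedModType R} m U (f : V -> R) (w : W) : open U ->
  Cm m U f -> Cm m U (fun z => f z *: w).
Proof.
move=> oU; elim: m f => [|m IH] f /= [cf Hf]; split=> //.
- by move=> z Uz; apply: cvgZr_tmp; exact: cf.
- by move=> z Uz; apply: cvgZr_tmp; exact: cf.
- move=> v; have [df Df] := Hf v.
  have H z : U z -> is_derive z v (fun z => f z *: w) ('D_v f z *: w).
    by move=> Uz; apply: is_derive_scal; apply: derivableP; exact: df.
  split; first by move=> z Uz; case: (H z Uz).
  by apply: (eq_Cm oU _ (IH _ Df)) => z Uz; rewrite (is_derive_val (H z Uz)).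
Qed.

Lemma Cm_opp m U (f : V -> R) : open U -> Cm m U f -> Cm m U (fun z => - f z).
Proof.
move=> oU Cf; have C1 : Cm m U (fun=> -1 : R) by exact: Cm_cst.
by apply: (eq_Cm oU _ (Cm_mul oU C1 Cf)) => z _; rewrite mulN1r.
Qed.

Lemma Cm_sum {W : normedModType R} m n U (F : 'I_n -> V -> W) : open U ->
  (forall i, Cm m U (F i)) -> Cm m U (fun z => \sum_i F i z).
Proof.
move=> oU CF.
suff H s : Cm m U (fun z => \sum_(i <- s) F i z) by exact: H.
elim: s => [|i s IH].
  by apply: (eq_Cm oU _ (Cm_cst m 0 oU)) => z _; rewrite big_nil.
by apply: (eq_Cm oU _ (Cm_add oU (CF i) IH)) => z _; rewrite big_cons.
Qed.

Lemma Cm_sin_cos m U (f : V -> R) : open U -> Cm m U f ->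
  Cm m U (fun z => sin (f z)) /\ Cm m U (fun z => cos (f z)).
Proof.
move=> oU; have csc z : U z -> {for z, continuous f} ->
    {for z, continuous (fun z => sin (f z))} /\
    {for z, continuous (fun z => cos (f z))}.
  move=> Uz cf; split.
  - by apply: (continuous_comp cf); exact: continuous_sin.
  - by apply: (continuous_comp cf); exact: continuous_cos.
elim: m f csc => [|m IH] f csc.
  by move=> [cf _]; split; split=> // z Uz; have [] := csc z Uz (cf z Uz).
move=> Cf; have [Cs Cc] := IH f csc (CmW Cf).
case: Cf => cf Hf.
have Hs z v : U z -> is_derive z v (fun z => sin (f z)) (cos (f z) * 'D_v f z).
  move=> Uz; apply: is_derive_comp; apply: derivableP.
  by have [+ _] := Hf v; exact.
have Hc z v : U z ->
    is_derive z v (fun z => cos (f z)) (- sin (f z) * 'D_v f z).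
  move=> Uz; apply: is_derive_comp; apply: derivableP.
  by have [+ _] := Hf v; exact.
split; (split=> [z Uz|v]; first by have [] := csc z Uz (cf z Uz)).
- split; first by move=> z Uz; case: (Hs z v Uz).
  apply: (eq_Cm oU _ (Cm_mul oU Cc (Hf v).2)) => z Uz.
  by rewrite (is_derive_val (Hs z v Uz)).
- split; first by move=> z Uz; case: (Hc z v Uz).
  apply: (eq_Cm oU _ (Cm_mul oU (Cm_opp oU Cs) (Hf v).2)) => z Uz.
  by rewrite (is_derive_val (Hc z v Uz)).
Qed.

Lemma Cm_inv m U (f : V -> R) : open U -> (forall z, U z -> f z != 0) ->
  Cm m U f -> Cm m U (fun z => (f z)^-1).
Proof.
move=> oU f0; elim: m => [|m IH].
  move=> [cf _]; split=> // z Uz.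
  by apply: (@continuousV _ _ f); [exact: f0|exact: cf].
move=> Cf; have CV := IH (CmW Cf).
case: Cf => cf Hf; split.
  by move=> z Uz; apply: (@continuousV _ _ f); [exact: f0|exact: cf].
move=> v; have [df Df] := Hf v.
have H z : U z -> is_derive z v (fun z => (f z)^-1) (- 'D_v f z / f z ^+ 2).
  by move=> Uz; apply: is_derive_inv; [exact: f0|apply: derivableP; exact: df].
split; first by move=> z Uz; case: (H z Uz).
apply: (eq_Cm oU _ (Cm_mul oU (Cm_opp oU Df) (Cm_mul oU CV CV))) => z Uz.
by rewrite (is_derive_val (H z Uz)) expr2 invfM.
Qed.

Lemma smooth_derive {W : normedModType R} U (F : V -> W) v :
  smooth U F -> smooth U ('D_v F).
Proof. by move=> sF m; have [_ /(_ v)[]] := sF m.+1. Qed.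

Lemma smooth_is_derive {W : normedModType R} U (F : V -> W) z v :
  smooth U F -> U z -> is_derive z v F ('D_v F z).
Proof.
by move=> sF Uz; apply: derivableP; have [_ /(_ v)[+ _]] := sF 1%N; exact.
Qed.

Lemma smooth_continuous {W : normedModType R} U (F : V -> W) z :
  smooth U F -> U z -> {for z, continuous F}.
Proof. by move=> sF Uz; have [+ _] := sF 0%N; exact. Qed.

End Regularity.

(** * Mean values and the Schwarz theorem *)

Section MeanValue.
Context {R : realType} {V : normedModType R}.
Implicit Types (U : set V) (h F : V -> R) (z v w : V).

Lemma mean_value F z v (d : R) : 0 < d ->
  (forall t, 0 <= t <= d -> derivable F (t *: v + z) v) ->
  exists2 c, 0 <= c <= d & F (d *: v + z) - F z = 'D_v F (c *: v + z) * d.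
Proof.
move=> d0 dF; set phi := fun t : R => F (t *: v + z).
have dphi t : 0 <= t <= d -> is_derive t 1 phi ('D_v F (t *: v + z)).
  move=> td; apply: (proj1 (@is_derive_line R V R F z v t _)).
  by apply: derivableP; exact: dF.
have [||c cd E] := @MVT R phi (fun t => 'D_v F (t *: v + z)) 0 d d0.
- move=> t; rewrite in_itv /= => /andP[t0 td].
  by apply: dphi; rewrite !ltW.
- apply: derivable_within_continuous => t; rewrite in_itv /= => td.
  by have [] := dphi t td.
- move: cd; rewrite in_itv /= => /andP[c0 cd]; exists c; first by rewrite !ltW.
  by rewrite -[d in RHS]subr0 -E /phi scale0r add0r.
Qed.

(** Leaves room for mean values along two directions at once. *)
Lemma small_parallelogram (A : set V) z v w : nbhs z A ->
  exists2 d : R, 0 < d & forall a b, 0 <= a <= d -> 0 <= b <= d ->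
    A (a *: v + (b *: w + z)).
Proof.
move=> /nbhs_ballP[e /= e0 He]; set N := `|v| + `|w| + 1.
have N0 : 0 < N by rewrite ltr_wpDl // addr_ge0.
exists (e / N / 2); first by rewrite !divr_gt0.
move=> a b /andP[a0 ad] /andP[b0 bd]; apply: He.
rewrite -ball_normE /ball_ /= addrA opprD addrCA subrr addr0 normrN.
apply: (le_lt_trans (ler_normD _ _)); rewrite !normrZ !ger0_norm //.
apply: (@le_lt_trans _ _ (e / N / 2 * N)); last first.
  by rewrite mulrAC divfK ?gt_eqF // ltr_pdivrMr // ltr_pMr // ltr1n.
rewrite /N !mulrDr -addrA lerD ?ler_wpM2r // -[leLHS]addr0 lerD ?ler_wpM2r //.
by rewrite mulr1 !divr_ge0 // ltW // addr_gt0.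
Qed.

(** The mean value theorem expresses the increment of [F] along the two sides
    and along the diagonal of a small parallelogram by values of the three
    derivatives at nearby points, and these are continuous at [z]. *)
Lemma derive_addv U F z v w : open U -> Cm 1 U F -> U z ->
  'D_(v + w) F z = 'D_v F z + 'D_w F z.
Proof.
move=> oU CF Uz; have dF u y : U y -> derivable F y u.
  by case: CF => _ /(_ u)[+ _]; exact.
have cF u : {for z, continuous ('D_u F)}.
  by case: CF => _ /(_ u)[_ [+ _]]; exact.
apply/eqP; rewrite -subr_eq0 -normr_le0; apply/ler_addgt0Pr => e e0.
rewrite add0r; have e3 : 0 < e / 3 by rewrite divr_gt0.
have near_u u : nbhs z [set y | `|'D_u F z - 'D_u F y| < e / 3].
  by have /cvgrPdist_lt/(_ _ e3) := cF u.
have NA : nbhs z (U `&` [set y | `|'D_v F z - 'D_v F y| < e / 3] `&`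
    [set y | `|'D_w F z - 'D_w F y| < e / 3] `&`
    [set y | `|'D_(v + w) F z - 'D_(v + w) F y| < e / 3]).
  by do !apply: filterI => //; apply: open_nbhs_nbhs.
have [d d0 Hd] := small_parallelogram v w NA.
have Hdiag a : 0 <= a <= d -> (U `&`
    [set y | `|'D_(v + w) F z - 'D_(v + w) F y| < e / 3]) (a *: (v + w) + z).
  move=> ad; have [[[Ua _] _] Ha] := Hd a a ad ad.
  by rewrite scalerDr -addrA.
have dd : 0 <= d <= d by rewrite ltW //=.
have d00 : 0 <= (0 : R) <= d by rewrite lexx ltW.
have [c1 c1d E1] : exists2 c, 0 <= c <= d &
    F (d *: v + (d *: w + z)) - F (d *: w + z)
    = 'D_v F (c *: v + (d *: w + z)) * d.
  by apply: mean_value => // t td; apply: dF; have [[[]]] := Hd t d td dd.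
have [c2 c2d E2] : exists2 c, 0 <= c <= d &
    F (d *: w + z) - F z = 'D_w F (c *: w + z) * d.
  apply: mean_value => // t td; apply: dF.
  by have [[[+ _] _] _] := Hd 0 t d00 td; rewrite scale0r add0r.
have [c3 c3d E3] : exists2 c, 0 <= c <= d &
    F (d *: (v + w) + z) - F z = 'D_(v + w) F (c *: (v + w) + z) * d.
  by apply: mean_value => // t td; apply: dF; have [] := Hdiag t td.
have E : 'D_(v + w) F (c3 *: (v + w) + z)
    = 'D_v F (c1 *: v + (d *: w + z)) + 'D_w F (c2 *: w + z).
  apply: (mulIf (lt0r_neq0 d0)); rewrite mulrDl -E1 -E2 -E3 scalerDr addrA.
  by rewrite addrA subrK.
have [[[_ H1] _] _] := Hd c1 d c1d dd.
have [[_ +] _] := Hd 0 c2 d00 c2d; rewrite scale0r add0r /= => H2.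
have [_ /= H3] := Hdiag c3 c3d.
move: H1 H2 H3 => /=; rewrite E !ltr_norml ler_norml.
move: ('D_v F z) ('D_w F z) ('D_(v + w) F z) ('D_v F (_ + _)) ('D_w F (_ + _)).
move=> x y xy x' y'; lra.
Qed.

Lemma close_limits (P Q P2 Q1 e : R) : `|Q - Q1| < e / 2 ->
  `|P - P2| < e / 2 -> Q1 = P2 -> `|P - Q| <= e.
Proof. by rewrite !ltr_norml ler_norml; lra. Qed.

(** Schwarz: both iterated derivatives are limits of the same second difference
    of [F] over a small parallelogram, by two mean values taken in either
    order. *)
Lemma deriveC U F z v w : open U -> Cm 2 U F -> U z ->
  'D_v ('D_w F) z = 'D_w ('D_v F) z.
Proof.
move=> oU CF Uz.
have dF u y : U y -> derivable F y u.
  by case: CF => _ /(_ u)[+ _]; exact.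
have ddF u u' y : U y -> derivable ('D_u F) y u'.
  by case: CF => _ /(_ u)[_ [_ /(_ u')[+ _]]]; exact.
have cF u u' : {for z, continuous ('D_u' ('D_u F))}.
  by case: CF => _ /(_ u)[_ [_ /(_ u')[_ [+ _]]]]; exact.
have second_difference u u' (d : R) : 0 < d ->
    (forall a b, 0 <= a <= d -> 0 <= b <= d -> U (a *: u + (b *: u' + z))) ->
    exists a b, [/\ 0 <= a <= d, 0 <= b <= d &
      F (d *: u + (d *: u' + z)) - F (d *: u + z) - F (d *: u' + z) + F z
      = 'D_u' ('D_u F) (a *: u + (b *: u' + z)) * d * d].
  move=> d0 Hd; have dd : 0 <= d <= d by rewrite ltW //=.
  have d00 : 0 <= (0 : R) <= d by rewrite lexx ltW.
  set G := fun y => F (y + d *: u') - F y.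
  have EG y : F (y + d *: u') = F (d *: u' + y) by rewrite addrC.
  have dG t : 0 <= t <= d -> is_derive (t *: u + z) u G
      ('D_u F (t *: u + (d *: u' + z)) - 'D_u F (t *: u + z)).
    move=> td; apply: is_derive_add; last first.
      apply: is_derive_opp; apply: derivableP; apply: dF.
      by have := Hd t 0 td d00; rewrite scale0r add0r.
    have HF : is_derive (t *: u + (d *: u' + z)) u F
        ('D_u F (t *: u + (d *: u' + z))).
      by apply: derivableP; apply: dF; exact: Hd.
    apply: (proj2 (@is_derive_line R V R (fun y => F (y + d *: u')) z u t _)).
    have := proj1 (@is_derive_line R V R F _ u t _) HF.
    set f1 := (X in is_derive _ _ X _ -> _).
    set f2 := (X in _ -> is_derive _ _ X _).
    suff -> : f1 = f2 by [].
    by apply/funext => s; rewrite /f1 /f2 -addrA [z + _]addrC.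
  have [a ad Ea] : exists2 a, 0 <= a <= d &
      G (d *: u + z) - G z = 'D_u G (a *: u + z) * d.
    by apply: (mean_value d0) => t td; have [] := dG t td.
  have [b bd Eb] : exists2 b, 0 <= b <= d &
      'D_u F (d *: u' + (a *: u + z)) - 'D_u F (a *: u + z)
      = 'D_u' ('D_u F) (b *: u' + (a *: u + z)) * d.
    apply: (@mean_value ('D_u F) _ _ _ d0) => t td; apply: ddF.
    by have := Hd a t ad td; rewrite addrCA.
  exists a, b; split=> //; rewrite [a *: u + _]addrCA -Eb.
  rewrite (addrCA (d *: u') (a *: u) z) -(is_derive_val (dG a ad)) -Ea /G !EG.
  rewrite (addrCA (d *: u') (d *: u) z).
  move: (F (d *: u + (d *: u' + z))) (F (d *: u + z)) => x1 x2.
  move: (F (d *: u' + z)) (F z) => x3 x4; ring.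
apply/eqP; rewrite -subr_eq0 -normr_le0; apply/ler_addgt0Pr => e e0.
rewrite add0r; have e2 : 0 < e / 2 by rewrite divr_gt0.
have near_u u u' :
    nbhs z [set y | `|'D_u' ('D_u F) z - 'D_u' ('D_u F) y| < e / 2].
  by have /cvgrPdist_lt/(_ _ e2) := cF u u'.
have NA : nbhs z (U `&`
    [set y | `|'D_v ('D_w F) z - 'D_v ('D_w F) y| < e / 2] `&`
    [set y | `|'D_w ('D_v F) z - 'D_w ('D_v F) y| < e / 2]).
  by do !apply: filterI => //; apply: open_nbhs_nbhs.
have [d d0 Hd] := small_parallelogram v w NA.
have [|a [b [ad bd E1]]] := second_difference v w d d0.
  by move=> a b ad bd; have [[]] := Hd a b ad bd.
have [|a' [b' [ad' bd' E2]]] := second_difference w v d d0.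
  by move=> s t sd td; have [[+ _] _] := Hd t s td sd; rewrite addrCA.
have [_ /= H1] := Hd a b ad bd; have [[_ /= +] _] := Hd b' a' bd' ad'.
rewrite addrCA => H2.
have E : 'D_w ('D_v F) (a *: v + (b *: w + z))
    = 'D_v ('D_w F) (a' *: w + (b' *: v + z)).
  apply: (mulIf (lt0r_neq0 d0)); apply: (mulIf (lt0r_neq0 d0)).
  apply: (etrans (esym E1)); apply: (etrans _ E2).
  rewrite (addrCA (d *: w) (d *: v) z); congr (_ + _); exact: addrAC.
exact: close_limits H1 H2 E.
Qed.

(** Mean values on the segments of a ball make [h] locally constant, so that
    its level sets are both open and closed in [U]. *)
Lemma derive0_constant U h : open U -> connected U ->
  (forall z v, U z -> is_derive z v h 0) ->
  forall x y, U x -> U y -> h x = h y.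
Proof.
move=> oU cU dh x y Ux Uy.
have loc z : U z -> nbhs z [set y | U y /\ h y = h z].
  move=> Uz; have /nbhs_ballP[e /= e0 He] : nbhs z U by apply: open_nbhs_nbhs.
  apply/nbhs_ballP; exists e => //= u Bu; split; first exact: He.
  have seg t : 0 <= t <= 1 -> U (t *: (u - z) + z).
    move=> /andP[t0 t1]; apply: He; move: Bu; rewrite -!ball_normE /ball_ /=.
    rewrite opprD addrCA subrr addr0 normrN normrZ ger0_norm // distrC.
    by apply: le_lt_trans; rewrite ler_piMl.
  have [|c cd] := @mean_value h z (u - z) 1 ltr01.
    by move=> t /seg Ut; have [] := dh _ (u - z) Ut.
  rewrite scale1r subrK (is_derive_val (dh _ _ (seg c cd))) mul0r => /eqP.
  by rewrite subr_eq0 => /eqP.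
have -> // : U y -> h x = h y.
have <- : [set y | U y /\ h y = h x] = U; last by case.
apply: cU; first by exists x.
- exists [set y | U y /\ h y = h x]; last by apply/seteqP; split=> u; [|] => -[].
  rewrite openE => z [Uz <-]; exact: loc.
- exists (~` [set y | U y /\ h y <> h x]).
    apply: open_closedC; rewrite openE => z [Uz hz].
    by apply: filterS (loc z Uz) => u [Uu hu]; split=> //; rewrite hu.
  apply/seteqP; split=> u /=.
    by move=> [Uu hu]; split=> // -[].
  by move=> [Uu H]; split=> //; apply: contrapT => hu; apply: H.
Qed.

End MeanValue.

(** * Linear and quadratic forms *)

Section Coordinates.
Context {R : realType} {n : nat}.

Lemma is_derive_fst {V V' W : normedModType R} (F : V -> W) (z w : V * V') dF :
  is_derive z.1 w.1 F dF -> is_derive z w (fun y => F y.1) dF.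
Proof. by move=> /is_derive_line0 H; apply/is_derive_line0. Qed.

Lemma is_derive_snd {V V' W : normedModType R} (F : V' -> W) (z w : V * V') dF :
  is_derive z.2 w.2 F dF -> is_derive z w (fun y => F y.2) dF.
Proof. by move=> /is_derive_line0 H; apply/is_derive_line0. Qed.

Lemma is_derive_coord (i : 'I_n) (x w : 'rV[R]_n) :
  is_derive x w (fun y : 'rV[R]_n => y 0 i) (w 0 i).
Proof.
apply/is_derive_line0.
have -> : (fun h : R => (h *: w + x) 0 i) = (fun h => h * w 0 i + x 0 i).
  by apply/funext => h; rewrite !mxE.
have := is_derive_add (is_derive_mul (is_derive_id (0 : R) 1)
  (is_derive_cstf (w 0 i) (0 : R) 1)) (is_derive_cstf (x 0 i) (0 : R) 1).
by rewrite mul1r mulr0 !addr0.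
Qed.

Lemma evecE (i j : 'I_n) : evec i 0 j = (j == i)%:R :> R.
Proof. by rewrite /evec mxE eqxx. Qed.

End Coordinates.

Section QuadraticForms.
Context {R : realType} {n : nat}.
Implicit Types (v : 'rV[R]_n).

Definition lin v (L : 'I_n -> R) : R := \sum_j v 0 j * L j.
Definition quad v (E : 'I_n -> 'I_n -> R) : R :=
  \sum_j \sum_k v 0 j * v 0 k * E j k.

Lemma eq_lin v L L' : L =1 L' -> lin v L = lin v L'.
Proof. by move=> E; apply: eq_bigr => j _; rewrite E. Qed.

Lemma eq_quad v E E' : E =2 E' -> quad v E = quad v E'.
Proof. by move=> H; apply: eq_bigr => j _; apply: eq_bigr => k _; rewrite H. Qed.

Lemma linD v L L' : lin v (fun j => L j + L' j) = lin v L + lin v L'.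
Proof. by rewrite /lin -big_split; apply: eq_bigr => j _; rewrite mulrDr. Qed.

Lemma linZ v a L : lin v (fun j => a * L j) = a * lin v L.
Proof. by rewrite /lin mulr_sumr; apply: eq_bigr => j _; rewrite mulrCA. Qed.

Lemma lin_delta v i c : lin v (fun j => (i == j)%:R * c) = v 0 i * c.
Proof.
rewrite /lin (bigD1 i) //= eqxx mul1r big1 ?addr0 // => j ji.
by rewrite eq_sym (negbTE ji) mul0r mulr0.
Qed.

Lemma lin_sum v (c : 'I_n -> R) (L : 'I_n -> 'I_n -> R) :
  lin v (fun j => \sum_l c l * L l j) = \sum_l c l * lin v (L l).
Proof.
rewrite /lin; under eq_bigr do rewrite mulr_sumr.
rewrite exchange_big; apply: eq_bigr => l _; rewrite mulr_sumr.
by apply: eq_bigr => j _; rewrite mulrCA.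
Qed.

Lemma quad_lin v E : quad v E = lin v (fun j => lin v (E j)).
Proof.
apply: eq_bigr => j _; rewrite /lin mulr_sumr.
by apply: eq_bigr => k _; rewrite mulrA.
Qed.

Lemma quadD v E E' :
  quad v (fun j k => E j k + E' j k) = quad v E + quad v E'.
Proof. by rewrite !quad_lin -linD; apply: eq_lin => j; exact: linD. Qed.

Lemma quadZ v a E : quad v (fun j k => a * E j k) = a * quad v E.
Proof. by rewrite !quad_lin -linZ; apply: eq_lin => j; exact: linZ. Qed.

Lemma quad_sum v (c : 'I_n -> R) (E : 'I_n -> 'I_n -> 'I_n -> R) :
  quad v (fun j k => \sum_l c l * E l j k) = \sum_l c l * quad v (E l).
Proof.
under [in RHS]eq_bigr do rewrite quad_lin.
by rewrite quad_lin -lin_sum; apply: eq_lin => j; exact: lin_sum.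
Qed.

Lemma quad_delta v i L :
  quad v (fun j k => (i == j)%:R * L k) = v 0 i * lin v L.
Proof.
by rewrite quad_lin -lin_delta; apply: eq_lin => j; rewrite linZ.
Qed.

Lemma lin_evec L i : lin (evec i) L = L i.
Proof.
rewrite /lin (bigD1 i) //= evecE eqxx mul1r big1 ?addr0 // => j ji.
by rewrite evecE (negbTE ji) mul0r.
Qed.

Lemma quad_evec E i : quad (evec i) E = E i i.
Proof. by rewrite quad_lin !lin_evec. Qed.

Lemma lin_addv v w L : lin (v + w) L = lin v L + lin w L.
Proof. by rewrite /lin -big_split; apply: eq_bigr => j _; rewrite mxE mulrDl. Qed.

Lemma quad_evec2 E i j :
  quad (evec i + evec j) E = E i i + E i j + (E j i + E j j).
Proof. by rewrite quad_lin !lin_addv !lin_evec !lin_addv !lin_evec. Qed.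

Lemma linZv a v L : lin (a *: v) L = a * lin v L.
Proof. by rewrite /lin mulr_sumr; apply: eq_bigr => j _; rewrite mxE mulrA. Qed.

Lemma quadZv a v E : quad (a *: v) E = a ^+ 2 * quad v E.
Proof.
rewrite !quad_lin linZv; under eq_lin do rewrite linZv.
by rewrite linZ mulrA expr2.
Qed.

(** Scaling [v] by [-1], [0], [1] and [2] separates the four degrees, and the
    vectors [e_j] and [e_j + e_k] then read off the coefficients. *)
Lemma cubic_eq0 (c : R) (i : 'I_n) L E H :
  (forall v, c + lin v L + quad v E - v 0 i * quad v H = 0) ->
  [/\ c = 0, forall j, L j = 0, forall j k, E j k + E k j = 0
    & forall v, v 0 i * quad v H = 0].
Proof.
move=> P.
have P' a v : c + a * lin v L + a ^+ 2 * quad v E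
    - a ^+ 3 * (v 0 i * quad v H) = 0.
  by rewrite -(P (a *: v)) linZv !quadZv mxE; ring.
have S v : [/\ c = 0, lin v L = 0, quad v E = 0 & v 0 i * quad v H = 0].
  move: (P' 0 v) (P' 1 v) (P' (-1) v) (P' 2 v).
  move: (lin v L) (quad v E) (_ * quad v H) => x y t; clear.
  by move=> *; split; lra.
split; first by have [] := S 0.
- by move=> j; have [_ + _ _] := S (evec j); rewrite lin_evec.
- move=> j k; have [_ _ + _] := S (evec j + evec k).
  have [_ _ + _] := S (evec j); have [_ _ + _] := S (evec k).
  rewrite quad_evec2 !quad_evec => -> ->.
  by rewrite add0r addr0.
- by move=> v; have [] := S v.
Qed.

(** A coordinate that does not vanish at [v] may be cancelled, which is why the
    cubic part of a prolonged equation yields a condition on the quadratic form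
    alone. *)
Lemma quad_polar H : (forall v i, v 0 i * quad v H = 0) ->
  forall j k, H j k + H k j = 0.
Proof.
move=> P; have diag j : H j j = 0.
  by have := P (evec j) j; rewrite quad_evec evecE eqxx mul1r.
move=> j k; have [->|jk] := eqVneq j k; first by rewrite diag addr0.
have := P (evec j + evec k) j; rewrite quad_evec2 !diag mxE !evecE eqxx.
by rewrite (negbTE jk) addr0 mul1r add0r addr0.
Qed.

End QuadraticForms.

(** * Prolongation and the determining equations *)

Section ProlongationAlgebra.
Context {R : realType} {n : nat}.
Implicit Types (v : 'rV[R]_n).

Lemma quad_tr v E : quad v E = quad v (fun j k => E k j).
Proof.
rewrite /quad exchange_big; apply: eq_bigr => j _; apply: eq_bigr => k _.
by rewrite [v 0 j * _]mulrC.
Qed.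

Lemma linN v L : lin v (fun j => - L j) = - lin v L.
Proof.
by rewrite -mulN1r -linZ; apply: eq_lin => j; rewrite mulN1r.
Qed.

Lemma quadN v E : quad v (fun j k => - E j k) = - quad v E.
Proof.
by rewrite -mulN1r -quadZ; apply: eq_quad => j k; rewrite mulN1r.
Qed.

Lemma quad_prod v A B : quad v (fun j k => A j * B k) = lin v A * lin v B.
Proof.
rewrite quad_lin mulrC -linZ; apply: eq_lin => j.
by rewrite linZ mulrC.
Qed.

Lemma quad_big v (F : 'I_n -> 'I_n -> 'I_n -> R) :
  quad v (fun j k => \sum_l F l j k) = \sum_l quad v (F l).
Proof.
have := quad_sum v (fun=> 1) F.
under [in RHS]eq_bigr do rewrite mul1r.
by move=> <-; apply: eq_quad => j k; apply: eq_bigr => l _; rewrite mul1r.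
Qed.

(** With [x'' = - Gam(x', x')], the terms in [D xi] cancel in pairs: this is
    why only the four defects survive in the prolonged equation. *)
Lemma prolongation_algebra v i (a : 'I_n -> R) (Gam : 'I_n -> 'I_n -> 'I_n -> R)
    (dGam : 'I_n -> 'I_n -> 'I_n -> R) (e es exs xx xxs : 'I_n -> R)
    (E exx xxx : 'I_n -> 'I_n -> R) (ess xs xss : R) :
  (forall l, a l = - quad v (Gam l)) ->
  (forall j k, Gam i j k = Gam i k j) ->
  \sum_l e l * quad v (dGam l)
  + \sum_l (es l + lin v (E l) - v 0 l * (xs + lin v xx))
      * (2 * lin v (Gam i l))
  + (ess + lin v exs - v 0 i * (xss + lin v xxs)
     + lin v (fun k => exs k + lin v (exx k)
         - v 0 i * (xxs k + lin v (xxx k)))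
     + \sum_k a k * (E i k - (k == i)%:R * (xs + lin v xx) - v 0 i * xx k)
     - a i * (xs + lin v xx))
  = ess + lin v (fun j => 2 * (exs j + \sum_l es l * Gam i j l)
          - (i == j)%:R * xss)
    + quad v (fun j k => exx j k + \sum_l e l * dGam l j k
        - \sum_l E i l * Gam l j k + \sum_l Gam i l k * E l j
        + \sum_l Gam i j l * E l k - (i == j)%:R * xxs k - (i == k)%:R * xxs j)
    - v 0 i * quad v (fun j k => xxx j k - \sum_l xx l * Gam l j k).
Proof.
move=> aE sG; set Xi := xs + lin v xx.
have Gl l : lin v (fun j => Gam i j l) = lin v (Gam i l).
  by apply: eq_lin => j; exact: sG.
have T1 : \sum_l (es l + lin v (E l) - v 0 l * Xi) * (2 * lin v (Gam i l))
    = 2 * \sum_l es l * lin v (Gam i l) + 2 * \sum_l lin v (E l) * lin v (Gam i l)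
      - 2 * Xi * quad v (Gam i).
  have -> : quad v (Gam i) = \sum_l v 0 l * lin v (Gam i l) by exact: quad_lin.
  rewrite !mulr_sumr -big_split /=.
  by rewrite -sumrB; apply: eq_bigr => l _; ring.
have T2 : \sum_k a k * (E i k - (k == i)%:R * Xi - v 0 i * xx k)
    = - \sum_l E i l * quad v (Gam l) + Xi * quad v (Gam i)
      + v 0 i * \sum_l xx l * quad v (Gam l).
  transitivity (- \sum_l E i l * quad v (Gam l)
      - \sum_l (l == i)%:R * (Xi * a i)
      + v 0 i * \sum_l xx l * quad v (Gam l)).
    rewrite mulr_sumr -sumrN -sumrB -big_split; apply: eq_bigr => l _ /=.
    case: eqP => [->|_]; rewrite ?aE /= ?mul1r ?mul0r ?subr0; ring.
  have -> : \sum_l (l == i)%:R * (Xi * a i) = Xi * a i.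
    rewrite (bigD1 i) //= big1 ?eqxx => [|l /negbTE ->]; last by rewrite mul0r.
    by rewrite mul1r addr0.
  by rewrite aE; ring.
rewrite T1 T2 aE !(linD, linN, linZ) lin_delta -!quad_lin.
rewrite !(quadD, quadN) !quad_big quad_delta.
rewrite (quad_tr v (fun j k => (i == k)%:R * xxs j)) quad_delta.
have -> : lin v (fun j => \sum_l es l * Gam i j l)
    = \sum_l es l * lin v (Gam i l).
  by rewrite lin_sum; apply: eq_bigr => l _; rewrite Gl.
have -> : \sum_l quad v (fun j k => e l * dGam l j k)
    = \sum_l e l * quad v (dGam l).
  by apply: eq_bigr => l _; rewrite quadZ.
have -> : \sum_l quad v (fun j k => E i l * Gam l j k)
    = \sum_l E i l * quad v (Gam l).
  by apply: eq_bigr => l _; rewrite quadZ.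
have -> : \sum_l quad v (fun j k => xx l * Gam l j k)
    = \sum_l xx l * quad v (Gam l).
  by apply: eq_bigr => l _; rewrite quadZ.
have -> : \sum_l quad v (fun j k => Gam i l k * E l j)
    = \sum_l lin v (E l) * lin v (Gam i l).
  by apply: eq_bigr => l _; rewrite quad_tr quad_prod mulrC.
have -> : \sum_l quad v (fun j k => Gam i j l * E l k)
    = \sum_l lin v (E l) * lin v (Gam i l).
  by apply: eq_bigr => l _; rewrite quad_prod Gl mulrC.
rewrite /Xi; ring.
Qed.

End ProlongationAlgebra.

(* Conversion is kept from unfolding Christoffel symbols into the metric. *)
#[local] Opaque christoffel.

Section Prolongation.
Context {R : realType} {n : nat}.
Variable g : 'rV[R]_n -> 'M[R]_n.
Local Notation Gam := (christoffel g).
Local Notation ds := ((1, 0) : R * 'rV[R]_n).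
Local Notation dx i := ((0, evec i) : R * 'rV[R]_n).

Lemma is_derive_geodesic (i : 'I_n) (p w : jet2 R n) :
  (forall j k, derivable (Gam i j k) p.1.1.2 w.1.1.2) ->
  is_derive p w (geodesic g i)
    (w.2 0 i + \sum_j \sum_k
      (('D_(w.1.1.2) (Gam i j k) p.1.1.2 * p.1.2 0 j
        + Gam i j k p.1.1.2 * w.1.2 0 j) * p.1.2 0 k
       + Gam i j k p.1.1.2 * p.1.2 0 j * w.1.2 0 k)).
Proof.
move=> dG; apply: is_derive_add.
  apply: (@is_derive_snd _ _ _ _ (fun y : 'rV_n => y 0 i)).
  exact: is_derive_coord.
apply: is_derive_sumf => j; apply: is_derive_sumf => k.
have dv l : is_derive p w (fun y : jet2 R n => y.1.2 0 l) (w.1.2 0 l).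
  apply: (@is_derive_fst _ _ _ _ (fun y : jet1 R n => y.2 0 l)).
  apply: (@is_derive_snd _ _ _ _ (fun y : 'rV_n => y 0 l)).
  exact: is_derive_coord.
have dGp : is_derive p w (fun y : jet2 R n => Gam i j k y.1.1.2)
    ('D_(w.1.1.2) (Gam i j k) p.1.1.2).
  apply: (@is_derive_fst _ _ _ _ (fun y : jet1 R n => Gam i j k y.1.2)).
  apply: (@is_derive_fst _ _ _ _ (fun y : base R n => Gam i j k y.2)).
  apply: is_derive_snd; apply: derivableP; exact: dG.
exact: is_derive_mul (is_derive_mul dGp (dv j)) (dv k).
Qed.

Variable X : vfield R n.

Lemma is_derive_D0 (h : R * 'rV[R]_n -> R) (p w : jet1 R n) :
  derivable ('D_ds h) p.1 w.1 -> (forall j, derivable ('D_(dx j) h) p.1 w.1) ->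
  is_derive p w (D0 h)
    ('D_(w.1) ('D_ds h) p.1 + \sum_j (w.2 0 j * 'D_(dx j) h p.1
       + p.2 0 j * 'D_(w.1) ('D_(dx j) h) p.1)).
Proof.
move=> d0 d1.
have H0 : is_derive p w (fun y : jet1 R n => 'D_ds h y.1)
    ('D_(w.1) ('D_ds h) p.1).
  exact: (@is_derive_fst _ _ _ _ ('D_ds h) p w _ (derivableP d0)).
have H1 j : is_derive p w (fun y : jet1 R n => 'D_(dx j) h y.1)
    ('D_(w.1) ('D_(dx j) h) p.1).
  exact: (@is_derive_fst _ _ _ _ ('D_(dx j) h) p w _ (derivableP (d1 j))).
have H2 j : is_derive p w (fun y : jet1 R n => y.2 0 j) (w.2 0 j).
  apply: (@is_derive_snd _ _ _ _ (fun y : 'rV_n => y 0 j)).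
  exact: is_derive_coord.
exact: (is_derive_add H0 (is_derive_sumf (fun j => is_derive_mul (H2 j) (H1 j)))).
Qed.

(** With [Gam] the connection, these are the coordinate expressions of the Lie
    derivative of [Gam] along [eta] minus the symmetrized product of the
    identity with the differential of [xi_s], of twice the covariant derivative
    of [eta_s] minus [xi_ss] times the identity, and of the Hessian of [xi]. *)
Definition quad_defect i z j k : R :=
  'D_(dx j) ('D_(dx k) (eta X i)) z
  + \sum_l eta X l z * 'D_(evec l) (Gam i j k) z.2
  - \sum_l 'D_(dx l) (eta X i) z * Gam l j k z.2
  + \sum_l Gam i l k z.2 * 'D_(dx j) (eta X l) z
  + \sum_l Gam i j l z.2 * 'D_(dx k) (eta X l) z
  - (i == j)%:R * 'D_(dx k) ('D_ds (xi X)) z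
  - (i == k)%:R * 'D_(dx j) ('D_ds (xi X)) z.

Definition lin_defect i z j : R :=
  2 * ('D_(dx j) ('D_ds (eta X i)) z
       + \sum_l 'D_ds (eta X l) z * Gam i j l z.2)
  - (i == j)%:R * 'D_ds ('D_ds (xi X)) z.

Definition cubic_defect z j k : R :=
  'D_(dx j) ('D_(dx k) (xi X)) z - \sum_l 'D_(dx l) (xi X) z * Gam l j k z.2.

Definition determining (z : base R n) : Prop :=
  [/\ forall i, 'D_ds ('D_ds (eta X i)) z = 0,
      forall i j, lin_defect i z j = 0,
      forall i j k, quad_defect i z j k = 0
    & forall j k, cubic_defect z j k = 0].

Hypothesis Gsym : forall i j k x, Gam i j k x = Gam i k j x.

Variable U : set (R * 'rV[R]_n).
Hypothesis oU : open U.
Hypothesis sxi : smooth U (xi X).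
Hypothesis seta : forall i, smooth U (eta X i).

Lemma is_derive_eta1 i (p w : jet1 R n) : U p.1 ->
  is_derive p w (eta1 X i)
    ('D_(w.1) ('D_ds (eta X i)) p.1
     + lin w.2 (fun j => 'D_(dx j) (eta X i) p.1)
     + lin p.2 (fun j => 'D_(w.1) ('D_(dx j) (eta X i)) p.1)
     - (w.2 0 i * D0 (xi X) p
        + p.2 0 i * ('D_(w.1) ('D_ds (xi X)) p.1
            + lin w.2 (fun j => 'D_(dx j) (xi X) p.1)
            + lin p.2 (fun j => 'D_(w.1) ('D_(dx j) (xi X)) p.1)))).
Proof.
move=> Up.
have HD (h : R * 'rV[R]_n -> R) : smooth U h -> is_derive p w (D0 h)
    ('D_(w.1) ('D_ds h) p.1 + lin w.2 (fun j => 'D_(dx j) h p.1)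
     + lin p.2 (fun j => 'D_(w.1) ('D_(dx j) h) p.1)).
  move=> sh; have dh v v' : derivable ('D_v h) p.1 v'.
    by have [] := smooth_is_derive v' (smooth_derive v sh) Up.
  apply: is_derive_eq (is_derive_D0 (dh _ _) (fun j => dh _ _)) _.
  by rewrite -addrA; congr (_ + _); rewrite /lin -big_split.
have H2 : is_derive p w (fun y : jet1 R n => y.2 0 i) (w.2 0 i).
  apply: (@is_derive_snd _ _ _ _ (fun y : 'rV_n => y 0 i)).
  exact: is_derive_coord.
exact: is_derive_add (HD _ (seta i)) (is_derive_opp (is_derive_mul H2 (HD _ sxi))).
Qed.

Lemma lin0v (L : 'I_n -> R) : lin 0 L = 0.
Proof. by rewrite /lin big1 // => j _; rewrite mxE mul0r. Qed.

Lemma cancel0 (a b b' c d e f f' : R) : b = b' -> f = f' ->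
  a + 0 + b - (0 * d + c * (e + 0 + f)) = a + b' - c * (e + f').
Proof. by move=> -> ->; rewrite mul0r add0r !addr0. Qed.

Lemma cancel00 (a b c d m v x y f : R) : a = 0 -> c = 0 -> d = 0 -> f = 0 ->
  a + b + c - (m * y + v * (d + x + f)) = b - m * y - v * x.
Proof. by move=> -> -> -> ->; rewrite !add0r !addr0 opprD addrA. Qed.

Lemma lin_derive0 v (h : 'I_n -> R * 'rV[R]_n -> R) z :
  lin v (fun j => 'D_((0, 0) : R * 'rV[R]_n) (h j) z) = 0.
Proof.
rewrite /lin big1 // => j _.
by rewrite (derive0 (h j) z : 'D_((0, 0) : R * 'rV[R]_n) (h j) z = 0) mulr0.
Qed.

(** Schwarz brings the derivative along [s] innermost, which is the normal form
    of mixed derivatives in the defects. *)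
Lemma eta2E i (p : jet2 R n) : U p.1.1 ->
  eta2 X i p = 'D_ds ('D_ds (eta X i)) p.1.1
    + lin p.1.2 (fun j => 'D_(dx j) ('D_ds (eta X i)) p.1.1)
    - p.1.2 0 i * ('D_ds ('D_ds (xi X)) p.1.1
        + lin p.1.2 (fun j => 'D_(dx j) ('D_ds (xi X)) p.1.1))
    + lin p.1.2 (fun k => 'D_(dx k) ('D_ds (eta X i)) p.1.1
        + lin p.1.2 (fun j => 'D_(dx k) ('D_(dx j) (eta X i)) p.1.1)
        - p.1.2 0 i * ('D_(dx k) ('D_ds (xi X)) p.1.1
            + lin p.1.2 (fun j => 'D_(dx k) ('D_(dx j) (xi X)) p.1.1)))
    + \sum_k p.2 0 k * ('D_(dx k) (eta X i) p.1.1
        - (k == i)%:R * ('D_ds (xi X) p.1.1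
             + lin p.1.2 (fun j => 'D_(dx j) (xi X) p.1.1))
        - p.1.2 0 i * 'D_(dx k) (xi X) p.1.1)
    - p.2 0 i * ('D_ds (xi X) p.1.1
                 + lin p.1.2 (fun j => 'D_(dx j) (xi X) p.1.1)).
Proof.
move=> Up; rewrite /eta2; congr (_ - _).
have sw (h : R * 'rV[R]_n -> R) v w : smooth U h ->
      'D_v ('D_w h) p.1.1 = 'D_w ('D_v h) p.1.1.
  by move=> sh; exact: deriveC oU (sh _) Up.
rewrite /D1; congr (_ + _ + _).
- rewrite (is_derive_val (is_derive_eta1 i (1, 0, 0) Up)) /=.
  rewrite !lin0v mxE; apply: cancel0.
  + by apply: eq_lin => j; exact: sw.
  + by apply: eq_lin => j; exact: sw.
- apply: eq_bigr => k _; congr (_ * _).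
  rewrite (is_derive_val (is_derive_eta1 i (0, evec k, 0) Up)) /= !lin0v mxE.
  exact: cancel0.
- apply: eq_bigr => k _; congr (_ * _).
  rewrite (is_derive_val (is_derive_eta1 i (0, 0, evec k) Up)) /= !lin_evec.
  rewrite evecE eq_sym.
  by apply: cancel00; rewrite ?lin_derive0 //; exact: derive0.
Qed.

Lemma prod_rearrange (a v w v' w' : R) :
  a * w * v' + a * v * w' = w * (v' * a) + v * (w' * a).
Proof. ring. Qed.

(** On the geodesics [x''] is eliminated and what is left of the prolonged
    equation is a cubic polynomial in [x']. *)
Lemma prolong2_geodesic i (p : jet2 R n) : U p.1.1 ->
  (forall j k l, derivable (Gam i j k) p.1.1.2 (evec l)) ->
  (forall l, p.2 0 l = - quad p.1.2 (fun j k => Gam l j k p.1.1.2)) ->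
  prolong2 X (geodesic g i) p =
    'D_ds ('D_ds (eta X i)) p.1.1 + lin p.1.2 (lin_defect i p.1.1)
    + quad p.1.2 (quad_defect i p.1.1)
    - p.1.2 0 i * quad p.1.2 (cubic_defect p.1.1).
Proof.
move=> Up dG ap.
rewrite -(@prolongation_algebra _ _ p.1.2 i (fun k => p.2 0 k)
  (fun i j k => Gam i j k p.1.1.2)
  (fun l j k => 'D_(evec l) (Gam i j k) p.1.1.2) (fun l => eta X l p.1.1)
  (fun l => 'D_ds (eta X l) p.1.1)
  (fun j => 'D_(dx j) ('D_ds (eta X i)) p.1.1)
  (fun j => 'D_(dx j) (xi X) p.1.1)
  (fun j => 'D_(dx j) ('D_ds (xi X)) p.1.1)
  (fun l j => 'D_(dx j) (eta X l) p.1.1)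
  (fun j k => 'D_(dx j) ('D_(dx k) (eta X i)) p.1.1)
  (fun j k => 'D_(dx j) ('D_(dx k) (xi X)) p.1.1)
  ('D_ds ('D_ds (eta X i)) p.1.1)
  ('D_ds (xi X) p.1.1) ('D_ds ('D_ds (xi X)) p.1.1)) //.
rewrite -(eta2E i Up) -[in RHS](add0r (\sum_l _ * quad _ _)).
rewrite /prolong2; congr (_ + _ + _ + _).
- rewrite (is_derive_val (is_derive_geodesic _)) /=; last first.
    by move=> j k; exact: derivable0.
  rewrite mxE add0r big1 ?mulr0 // => j _; rewrite big1 // => k _.
  by rewrite derive0 !mxE !(mul0r, mulr0, addr0).
- apply: eq_bigr => l _; congr (_ * _).
  rewrite (is_derive_val (is_derive_geodesic _)) /=; last first.
    by move=> j k; exact: dG.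
  rewrite mxE add0r; apply: eq_bigr => j _; apply: eq_bigr => k _.
  by rewrite !mxE !(mulr0, addr0) -mulrA mulrC.
- apply: eq_bigr => l _; congr (_ * _).
  rewrite (is_derive_val (is_derive_geodesic _)) /=; last first.
    by move=> j k; exact: derivable0.
  rewrite mxE add0r.
  transitivity (lin (evec l) (fun j => lin p.1.2 (fun k => Gam i j k p.1.1.2))
      + lin p.1.2 (fun j => lin (evec l) (fun k => Gam i j k p.1.1.2))).
    rewrite /lin -big_split; apply: eq_bigr => j _; rewrite !mulr_sumr -big_split.
    by apply: eq_bigr => k _; rewrite derive0 mul0r add0r; exact: prod_rearrange.
  rewrite lin_evec mulr2n mulrDl mul1r; congr (_ + _).
  by apply: eq_lin => j; rewrite lin_evec Gsym.
- rewrite (bigD1 i) //= big1 => [|l li].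
    rewrite (is_derive_val (is_derive_geodesic _)) /=; last first.
      by move=> j k; exact: derivable0.
    rewrite big1 => [|j _]; first by rewrite evecE eqxx !addr0 mulr1.
    by rewrite big1 // => k _; rewrite derive0 !mxE !(mul0r, mulr0, addr0).
  rewrite (is_derive_val (is_derive_geodesic _)) /=; last first.
    by move=> j k; exact: derivable0.
  rewrite evecE eq_sym (negbTE li) big1 => [|j _].
    by rewrite addr0 mulr0.
  by rewrite big1 // => k _; rewrite derive0 !mxE !(mul0r, mulr0, addr0).
Qed.

Lemma geodesic_eq0 i (p : jet2 R n) : geodesic g i p = 0 <->
  p.2 0 i = - quad p.1.2 (fun j k => Gam i j k p.1.1.2).
Proof.
have -> : geodesic g i p = p.2 0 i + quad p.1.2 (fun j k => Gam i j k p.1.1.2).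
  congr (_ + _); apply: eq_bigr => j _; apply: eq_bigr => k _.
  by move: (Gam i j k _) => c; rewrite -mulrA mulrC.
by split=> [/eqP|->]; [rewrite addr_eq0 => /eqP|rewrite addNr].
Qed.

Lemma eq_swap (a a' b b' c c' d d' e e' f f' : R) :
  a = a' -> b = b' -> c = c' -> d = e' -> e = d' ->
  a + b - c + d + e - f - f' = a' + b' - c' + d' + e' - f' - f.
Proof. by move=> -> -> -> -> ->; ring. Qed.

Lemma quad_defectC i z j k : U z -> quad_defect i z j k = quad_defect i z k j.
Proof.
move=> Uz; apply: eq_swap.
- exact: deriveC oU (seta i 2%N) Uz.
- have -> // : Gam i j k = Gam i k j; apply/funext; exact: Gsym.
- by apply: eq_bigr => l _; rewrite Gsym.
- by apply: eq_bigr => l _; rewrite Gsym.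
- by apply: eq_bigr => l _; rewrite Gsym.
Qed.

Lemma eq_sub (a a' b b' : R) : a = a' -> b = b' -> a - b = a' - b'.
Proof. by move=> -> ->. Qed.

Lemma cubic_defectC z j k : U z -> cubic_defect z j k = cubic_defect z k j.
Proof.
move=> Uz; apply: eq_sub; first exact: deriveC oU (sxi 2%N) Uz.
by apply: eq_bigr => l _; rewrite Gsym.
Qed.

Lemma lin_zero v (L : 'I_n -> R) : (forall j, L j = 0) -> lin v L = 0.
Proof. by move=> L0; rewrite /lin big1 // => j _; rewrite L0 mulr0. Qed.

Lemma quad_zero v (E : 'I_n -> 'I_n -> R) :
  (forall j k, E j k = 0) -> quad v E = 0.
Proof.
by move=> E0; rewrite quad_lin lin_zero // => j; rewrite lin_zero.
Qed.

(** Over a point [z] every [x'] is allowed, with [x''] determined by it, so the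
    prolonged equations hold there exactly when all coefficients of the cubic
    polynomials vanish. *)
Lemma determiningP z : U z ->
  (forall i j k l, derivable (Gam i j k) z.2 (evec l)) ->
  (forall p : jet2 R n, p.1.1 = z -> (forall i, geodesic g i p = 0) ->
     forall i, prolong2 X (geodesic g i) p = 0) <-> determining z.
Proof.
move=> Uz dG; split=> [H|[H0 H1 H2 H3] p pz gp i]; last first.
  rewrite prolong2_geodesic ?pz //; last first.
    by move=> l; have /geodesic_eq0 -> := gp l; rewrite pz.
  rewrite (H0 i) (lin_zero _ (H1 i)) (quad_zero _ (H2 i)) (quad_zero _ H3).
  by rewrite mulr0 subr0 !addr0.
have P v i : 'D_ds ('D_ds (eta X i)) z + lin v (lin_defect i z)
    + quad v (quad_defect i z) - v 0 i * quad v (cubic_defect z) = 0.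
  set a : 'rV[R]_n := \row_l - quad v (fun j k => Gam l j k z.2).
  rewrite -(@prolong2_geodesic i (z, v, a)) //=.
    by apply: H => // l; apply/geodesic_eq0; rewrite mxE.
  by move=> l; rewrite mxE.
have S i := cubic_eq0 (fun v => P v i).
have half (x : R) : x + x = 0 -> x = 0.
  by move=> /eqP; rewrite -mulr2n mulrn_eq0 => /eqP.
split.
- by move=> i; have [] := S i.
- by move=> i; have [] := S i.
- move=> i j k; have [_ _ + _] := S i => /(_ j k).
  by rewrite -quad_defectC // => /half.
- move=> j k; have := @quad_polar _ _ (cubic_defect z) _ j k.
  rewrite -cubic_defectC // => Q; apply: half; apply: Q => v i.
  by have [_ _ _] := S i; exact.
Qed.

End Prolongation.

#[local] Transparent christoffel.

(** * The metric and its Christoffel symbols *)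

Section Index5.

Lemma ord5_ind (P : 'I_5 -> Prop) :
  P it -> P ir -> P ith -> P iphi -> P ipsi -> forall i, P i.
Proof.
move=> P0 P1 P2 P3 P4 [[|[|[|[|[|//]]]]] lt_i5].
- by rewrite (_ : Ordinal _ = it) //; apply: val_inj.
- by rewrite (_ : Ordinal _ = ir) //; apply: val_inj.
- by rewrite (_ : Ordinal _ = ith) //; apply: val_inj.
- by rewrite (_ : Ordinal _ = iphi) //; apply: val_inj.
- by rewrite (_ : Ordinal _ = ipsi) //; apply: val_inj.
Qed.

Lemma sum5 (V : nmodType) (F : 'I_5 -> V) :
  \sum_l F l = F it + F ir + F ith + F iphi + F ipsi.
Proof.
rewrite !big_ord_recr big_ord0 /= add0r.
by congr (_ + _ + _ + _ + _); congr F; apply: val_inj.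
Qed.

End Index5.

Lemma is_derive_pow {R : realType} {V : normedModType R} (f : V -> R) n z v df :
  is_derive z v f df ->
  is_derive z v (fun y => f y ^+ n) (n%:R * f z ^+ n.-1 * df).
Proof.
move=> H; have := is_deriveX n H.
by have -> : (f ^+ n : V -> R) = (fun y => f y ^+ n) by rewrite exprfctE.
Qed.

(* Differentiates by structural rules down to atoms whose derivatives are
   hypotheses. *)
Ltac der :=
  match goal with
  | H : is_derive ?z ?v ?F _ |- is_derive ?z ?v ?F _ => exact H
  | |- is_derive _ _ (fun _ => ?c) _ => exact: is_derive_cstf
  | |- is_derive _ _ (fun y => y) _ => exact: is_derive_id
  | |- is_derive _ _ (fun y => fun_of_matrix y _ _) _ => exact: is_derive_coord
  | |- is_derive _ _ (fun y => @?F y + @?G y) _ =>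
      eapply (@is_derive_add _ _ _ F G); [der | der]
  | |- is_derive _ _ (fun y => @?F y * @?G y) _ =>
      eapply (@is_derive_mul _ _ F G); [der | der]
  | |- is_derive _ _ (fun y => - @?F y) _ =>
      eapply (@is_derive_opp _ _ _ F); der
  | |- is_derive _ _ (fun y => (@?F y)^-1) _ =>
      eapply (@is_derive_inv _ _ F); [try eassumption | der]
  | |- is_derive _ _ (fun y => @?F y ^+ ?n) _ =>
      eapply (@is_derive_pow _ _ F n); der
  | |- is_derive _ _ (fun y => sin (@?F y)) _ =>
      eapply (@is_derive_comp _ _ sin F); [exact: is_derive_sin | der]
  | |- is_derive _ _ (fun y => cos (@?F y)) _ =>
      eapply (@is_derive_comp _ _ cos F); [exact: is_derive_cos | der]
  end.

Section Christoffel.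
Context {R : realType}.
Variables M q rinf : R.
Hypothesis hrinf : 0 < rinf.
Local Notation f := (bh_f M q).
Local Notation k := (bh_k M q rinf).
Local Notation g := (bh_metric M q rinf).

Definition chart (x : 'rV[R]_5) : Prop :=
  [/\ 0 < x 0 ir < rinf, sin (x 0 ith) != 0 & f (x 0 ir) != 0].

Definition bh_entry (r s c : R) (i j : 'I_5) : R :=
  match val i, val j with
  | 0%N, 0%N => - f r
  | 1%N, 1%N => k r ^+ 2 / f r
  | 2%N, 2%N => r ^+ 2 / 4 * k r
  | 3%N, 3%N => r ^+ 2 / 4 * (k r * s ^+ 2 + c ^+ 2)
  | 3%N, 4%N | 4%N, 3%N => r ^+ 2 / 4 * c
  | 4%N, 4%N => r ^+ 2 / 4
  | _, _ => 0
  end.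

Lemma bh_metricE x i j :
  g x i j = bh_entry (x 0 ir) (sin (x 0 ith)) (cos (x 0 ith)) i j.
Proof.
have := cos2sin2 (x 0 ipsi).
rewrite /bh_metric !mxE !big_ord1 !mxE !eqxx /=.
elim/ord5_ind: i; elim/ord5_ind: j => /= H; rewrite /bh_entry /=; ring: H.
Qed.

Definition bh_f' (r : R) : R := 4 * M / r ^+ 3 - 4 * q ^+ 2 / r ^+ 5.
Definition log_k' (r : R) : R := - 4 * r / (r ^+ 2 - rinf ^+ 2).

(** [alpha], [rho], [nu1] and [nu2] are the logarithmic derivatives in [r] of
    the lengths of the vectors along t, along r, along the sphere and along the
    fibre; [accel], [- pi1] and [- pi2] are the r components of the
    accelerations of the coordinate lines of t, theta and psi, and [kap] is the
    squared length of the fibre direction relative to that of the sphere. *)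
Definition alpha (r : R) : R := bh_f' r / (2 * f r).
Definition accel (r : R) : R := bh_f' r * f r / (2 * k r ^+ 2).
Definition rho (r : R) : R := log_k' r - alpha r.
Definition nu1 (r : R) : R := r^-1 + log_k' r / 2.
Definition nu2 (r : R) : R := r^-1.
Definition pi1 (r : R) : R := r ^+ 2 * nu1 r * f r / (4 * k r).
Definition pi2 (r : R) : R := r * f r / (4 * k r ^+ 2).
Definition kap (r : R) : R := (k r)^-1.

(** The Christoffel symbols are linear in the radial functions and in the
    constant [1], which has the slot [one]: their derivative along r is the
    same table at the derivatives of the radial functions, with [one := 0]. *)
Definition gamma_table (al ac rh n1 n2 p1 p2 ka one s c : R) (i j l : 'I_5) : R :=
  match val i, val j, val l with
  | 0%N, 0%N, 1%N | 0%N, 1%N, 0%N => al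
  | 1%N, 0%N, 0%N => ac
  | 1%N, 1%N, 1%N => rh
  | 1%N, 2%N, 2%N => - p1
  | 1%N, 3%N, 3%N => - (p1 * s ^+ 2 + p2 * c ^+ 2)
  | 1%N, 3%N, 4%N | 1%N, 4%N, 3%N => - (p2 * c)
  | 1%N, 4%N, 4%N => - p2
  | 2%N, 1%N, 2%N | 2%N, 2%N, 1%N => n1
  | 2%N, 3%N, 3%N => - ((one - ka) * (s * c))
  | 2%N, 3%N, 4%N | 2%N, 4%N, 3%N => ka * s / 2
  | 3%N, 1%N, 3%N | 3%N, 3%N, 1%N => n1
  | 3%N, 2%N, 3%N | 3%N, 3%N, 2%N => (one - ka / 2) * c / s
  | 3%N, 2%N, 4%N | 3%N, 4%N, 2%N => - (ka / 2 / s)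
  | 4%N, 1%N, 4%N | 4%N, 4%N, 1%N => n2
  | 4%N, 1%N, 3%N | 4%N, 3%N, 1%N => c * (n2 - n1)
  | 4%N, 2%N, 3%N | 4%N, 3%N, 2%N =>
      - (one * s / 2 + (one - ka / 2) * c ^+ 2 / s)
  | 4%N, 2%N, 4%N | 4%N, 4%N, 2%N => ka / 2 * c / s
  | _, _, _ => 0
  end.

(** The derivative of the table along theta, at [one := 1]. *)
Definition dgamma_table (n1 n2 p1 p2 ka s c : R) (i j l : 'I_5) : R :=
  match val i, val j, val l with
  | 1%N, 3%N, 3%N => - ((p1 - p2) * (2 * s * c))
  | 1%N, 3%N, 4%N | 1%N, 4%N, 3%N => p2 * s
  | 2%N, 3%N, 3%N => - ((1 - ka) * (c ^+ 2 - s ^+ 2))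
  | 2%N, 3%N, 4%N | 2%N, 4%N, 3%N => ka * c / 2
  | 3%N, 2%N, 3%N | 3%N, 3%N, 2%N => - ((1 - ka / 2) / s ^+ 2)
  | 3%N, 2%N, 4%N | 3%N, 4%N, 2%N => ka / 2 * c / s ^+ 2
  | 4%N, 1%N, 3%N | 4%N, 3%N, 1%N => - s * (n2 - n1)
  | 4%N, 2%N, 3%N | 4%N, 3%N, 2%N =>
      - (c / 2) + (1 - ka / 2) * (2 * c + c ^+ 3 / s ^+ 2)
  | 4%N, 2%N, 4%N | 4%N, 4%N, 2%N => - (ka / 2 / s ^+ 2)
  | _, _, _ => 0
  end.

Definition bh_inv (x : 'rV[R]_5) (i j : 'I_5) : R :=
  let r := x 0 ir in let s := sin (x 0 ith) in let c := cos (x 0 ith) in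
  match val i, val j with
  | 0%N, 0%N => - (f r)^-1
  | 1%N, 1%N => f r / k r ^+ 2
  | 2%N, 2%N => (r ^+ 2 / 4 * k r)^-1
  | 3%N, 3%N => (r ^+ 2 / 4 * k r * s ^+ 2)^-1
  | 3%N, 4%N | 4%N, 3%N => - c / (r ^+ 2 / 4 * k r * s ^+ 2)
  | 4%N, 4%N => (r ^+ 2 / 4)^-1 + c ^+ 2 / (r ^+ 2 / 4 * k r * s ^+ 2)
  | _, _ => 0
  end.

Hypothesis f_rinf : f rinf != 0.

Lemma chart_facts x : chart x -> [/\ x 0 ir != 0, x 0 ir ^+ 2 - rinf ^+ 2 != 0,
  k (x 0 ir) != 0 , x 0 ir ^+ 2 - rinf ^+ 2 < 0 & 0 < x 0 ir].
Proof.
case=> /andP[r0 rr] s0 f0.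
have r1 : x 0 ir ^+ 2 - rinf ^+ 2 < 0 by rewrite subr_lt0 ltr_pXn2r ?nnegrE ?ltW.
have r2 : x 0 ir ^+ 2 - rinf ^+ 2 != 0 by rewrite lt_eqF.
split=> //; first by rewrite gt_eqF.
by rewrite /bh_k !(mulf_neq0, invr_neq0, expf_neq0) // gt_eqF.
Qed.

Lemma bh_metric_inv x : chart x ->
  invmx (g x) = \matrix_(i, j) bh_inv x i j.
Proof.
move=> cx; have [r0 _ k0 _ _] := chart_facts cx; have [_ s0 f0] := cx.
have gI : g x *m (\matrix_(i, j) bh_inv x i j) = 1%:M.
  apply/matrixP => i j; rewrite !mxE sum5 !bh_metricE !mxE.
  rewrite /bh_entry /bh_inv.
  move: (f (x 0 ir)) (k (x 0 ir)) (sin (x 0 ith)) (cos (x 0 ith)) f0 k0 s0.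
  move: (x 0 ir) r0 => r r0 F K s c f0 k0 s0.
  elim/ord5_ind: i; elim/ord5_ind: j => /=;
    by field; rewrite ?f0 ?k0 ?r0 ?s0.
have [gu _] := mulmx1_unit gI.
by rewrite -[RHS](mulKmx gu) gI mulmx1.
Qed.

Lemma is_derive_f (r : R) : r != 0 -> is_derive r 1 f (bh_f' r).
Proof.
move=> r0; have r2 : r ^+ 2 != 0 by rewrite expf_neq0.
have r4 : r ^+ 4 != 0 by rewrite expf_neq0.
rewrite /bh_f; eapply is_derive_eq; first by der.
by rewrite /bh_f' /=; field.
Qed.

Lemma is_derive_k (r : R) : r ^+ 2 - rinf ^+ 2 != 0 ->
  is_derive r 1 k (log_k' r * k r).
Proof.
move=> r0; have r2 : (r ^+ 2 - rinf ^+ 2) ^+ 2 != 0 by rewrite expf_neq0.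
rewrite /bh_k; eapply is_derive_eq; first by der.
by rewrite /log_k' /=; field.
Qed.

Definition dr_entry (r s c : R) (i j : 'I_5) : R :=
  match val i, val j with
  | 0%N, 0%N => - bh_f' r
  | 1%N, 1%N => 2 * rho r * (k r ^+ 2 / f r)
  | 2%N, 2%N => 2 * nu1 r * (r ^+ 2 / 4 * k r)
  | 3%N, 3%N => 2 * nu1 r * (r ^+ 2 / 4 * k r * s ^+ 2)
      + 2 * nu2 r * (r ^+ 2 / 4 * c ^+ 2)
  | 3%N, 4%N | 4%N, 3%N => 2 * nu2 r * (r ^+ 2 / 4 * c)
  | 4%N, 4%N => 2 * nu2 r * (r ^+ 2 / 4)
  | _, _ => 0
  end.

Definition dth_entry (r s c : R) (i j : 'I_5) : R :=
  match val i, val j with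
  | 3%N, 3%N => r ^+ 2 / 4 * (k r - 1) * (2 * s * c)
  | 3%N, 4%N | 4%N, 3%N => - (r ^+ 2 / 4 * s)
  | _, _ => 0
  end.

Lemma is_derive_metric x w i j : chart x ->
  is_derive x w (fun y => g y i j)
    (w 0 ir * dr_entry (x 0 ir) (sin (x 0 ith)) (cos (x 0 ith)) i j
     + w 0 ith * dth_entry (x 0 ir) (sin (x 0 ith)) (cos (x 0 ith)) i j).
Proof.
move=> cx; have [r0 rr k0 _ _] := chart_facts cx; have [_ s0 f0] := cx.
have Df : is_derive x w (fun y : 'rV_5 => f (y 0 ir)) (bh_f' (x 0 ir) * w 0 ir).
  by apply: is_derive_comp; [exact: is_derive_f|exact: is_derive_coord].
have Dk : is_derive x w (fun y : 'rV_5 => k (y 0 ir))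
    (log_k' (x 0 ir) * k (x 0 ir) * w 0 ir).
  by apply: is_derive_comp; [exact: is_derive_k|exact: is_derive_coord].
have -> : (fun y => g y i j) =
    (fun y => bh_entry (y 0 ir) (sin (y 0 ith)) (cos (y 0 ith)) i j).
  by apply/funext => y; exact: bh_metricE.
rewrite /bh_entry /dr_entry /dth_entry.
elim/ord5_ind: i; elim/ord5_ind: j => /=.
all: eapply is_derive_eq; first by der.
all: rewrite /= /rho /nu1 /nu2 /alpha.
all: by field; rewrite ?f0 ?r0 ?k0.
Qed.

Definition bh_gamma (x : 'rV[R]_5) (i j l : 'I_5) : R :=
  let r := x 0 ir in
  gamma_table (alpha r) (accel r) (rho r) (nu1 r) (nu2 r) (pi1 r) (pi2 r) (kap r) 1
    (sin (x 0 ith)) (cos (x 0 ith)) i j l.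

Lemma christoffelE x i j l : chart x -> christoffel g i j l x = bh_gamma x i j l.
Proof.
move=> cx; have [r0 rr k0 _ _] := chart_facts cx; have [_ s0 f0] := cx.
rewrite /christoffel bh_metric_inv // sum5 !mxE.
rewrite !(is_derive_val (is_derive_metric _ _ _ cx)) !evecE.
rewrite /bh_inv /dr_entry /dth_entry /bh_gamma /gamma_table.
rewrite /pi1 /pi2 /kap /accel /rho.
have -> : bh_f' (x 0 ir) = 2 * alpha (x 0 ir) * f (x 0 ir).
  by rewrite /alpha; field.
move: (alpha (x 0 ir)) (nu1 (x 0 ir)) (log_k' (x 0 ir)) => al n1 lk.
move: (f (x 0 ir)) (k (x 0 ir)) (sin (x 0 ith)) (cos (x 0 ith)) f0 k0 s0.
rewrite /nu2; move: (x 0 ir) r0 => r r0 F K s c f0 k0 s0; clear cx rr.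
elim/ord5_ind: i; elim/ord5_ind: j; elim/ord5_ind: l => /=;
  by field; rewrite ?f0 ?k0 ?r0 ?s0.
Qed.

Lemma derivable_radial (r : R) : r != 0 -> r ^+ 2 - rinf ^+ 2 != 0 ->
  f r != 0 -> k r != 0 ->
  [/\ derivable alpha r 1, derivable accel r 1, derivable rho r 1,
      derivable nu1 r 1 & [/\ derivable nu2 r 1, derivable pi1 r 1,
      derivable pi2 r 1 & derivable kap r 1]].
Proof.
move=> r0 rr f0 k0; have Df := is_derive_f r0; have Dk := is_derive_k rr.
have r3 : r ^+ 3 != 0 by rewrite expf_neq0.
have r5 : r ^+ 5 != 0 by rewrite expf_neq0.
have fk0 : 2 * f r != 0 by rewrite mulf_neq0 // pnatr_eq0.
have k2 : 2 * k r ^+ 2 != 0 by rewrite mulf_neq0 ?expf_neq0 // pnatr_eq0.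
have k4 : 4 * k r != 0 by rewrite mulf_neq0 // pnatr_eq0.
have k42 : 4 * k r ^+ 2 != 0 by rewrite mulf_neq0 ?expf_neq0 // pnatr_eq0.
have ex (h : R -> R) : (exists d, is_derive r 1 h d) -> derivable h r 1.
  by move=> [d []].
have exf' : exists d, is_derive r 1 (fun y => bh_f' y) d.
  by rewrite /bh_f'; eexists; der.
have exl : exists d, is_derive r 1 (fun y => log_k' y) d.
  by rewrite /log_k'; eexists; der.
have [df' Df'] := exf'; have [dl Dl] := exl.
have exa : exists d, is_derive r 1 (fun y => alpha y) d.
  by rewrite /alpha; eexists; der.
have [da Da] := exa.
have exn : exists d, is_derive r 1 (fun y => nu1 y) d.
  by rewrite /nu1; eexists; der.
have [dn Dn] := exn.
do !split; apply: ex.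
- by exists da.
- by rewrite /accel; eexists; der.
- by rewrite /rho; eexists; der.
- by exists dn.
- by rewrite /nu2; eexists; der.
- by rewrite /pi1; eexists; der.
- by rewrite /pi2; eexists; der.
- by rewrite /kap; eexists; der.
Qed.

Lemma is_derive_gamma x w i j l : chart x ->
  is_derive x w (fun y => bh_gamma y i j l)
   (w 0 ir * (let r := x 0 ir in
      gamma_table ('D_1 alpha r) ('D_1 accel r) ('D_1 rho r) ('D_1 nu1 r)
       ('D_1 nu2 r) ('D_1 pi1 r) ('D_1 pi2 r) ('D_1 kap r) 0
       (sin (x 0 ith)) (cos (x 0 ith)) i j l)
    + w 0 ith * (let r := x 0 ir in
      dgamma_table (nu1 r) (nu2 r) (pi1 r) (pi2 r) (kap r)
       (sin (x 0 ith)) (cos (x 0 ith)) i j l)).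
Proof.
move=> cx; have [r0 rr k0 _ _] := chart_facts cx; have [_ s0 f0] := cx.
have [d1 d2 d3 d4 [d5 d6 d7 d8]] := derivable_radial r0 rr f0 k0.
have D (h : R -> R) : derivable h (x 0 ir) 1 ->
    is_derive x w (fun y : 'rV_5 => h (y 0 ir)) ('D_1 h (x 0 ir) * w 0 ir).
  move=> dh; eapply (@is_derive_comp _ _ h); last exact: is_derive_coord.
  exact: derivableP.
have D1 := D _ d1; have D2 := D _ d2; have D3 := D _ d3; have D4 := D _ d4.
have D5 := D _ d5; have D6 := D _ d6; have D7 := D _ d7; have D8 := D _ d8.
have sc : cos (x 0 ith) ^+ 2 = 1 - sin (x 0 ith) ^+ 2 by exact: cos2sin2.
rewrite /bh_gamma /gamma_table /dgamma_table; clear d1 d2 d3 d4 d5 d6 d7 d8 D cx.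
elim/ord5_ind: i; elim/ord5_ind: j; elim/ord5_ind: l => /=.
all: eapply is_derive_eq; first by der.
all: rewrite /=.
all: try by ring.
all: try by field: sc.
Qed.

End Christoffel.

(** * The chart of the metric *)

Lemma christoffel_sym {R : realType} {n} (g : 'rV[R]_n -> 'M[R]_n) :
  (forall x i j, g x i j = g x j i) ->
  forall i j k x, christoffel g i j k x = christoffel g i k j x.
Proof.
move=> gC i j k x; rewrite /christoffel; congr (_ * _).
apply: eq_bigr => l _; congr (_ * (_ - _)); first by rewrite addrC.
by have -> : (fun y => g y j k) = (fun y => g y k j) by apply/funext => y.
Qed.

Section Chart.
Context {R : realType}.
Variables M q rinf : R.
Hypothesis hrinf : 0 < rinf.
Local Notation f := (bh_f M q).
Local Notation k := (bh_k M q rinf).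
Local Notation g := (bh_metric M q rinf).
Local Notation chart := (chart M q rinf).

Lemma bh_metric_sym x i j : g x i j = g x j i.
Proof.
by rewrite !bh_metricE /bh_entry; elim/ord5_ind: i; elim/ord5_ind: j.
Qed.

Lemma continuous_f (r : R) : r != 0 -> {for r, continuous f}.
Proof.
move=> r0; have [df _] := is_derive_f M q r0.
by apply: differentiable_continuous; apply/derivable1_diffP.
Qed.

Lemma open_chart : open [set x | chart x].
Proof.
rewrite openE => x [/andP[r0 r1] s0 f0].
have cc i : (fun y : 'rV[R]_5 => y 0 i) @ x --> x 0 i by exact: coord_continuous.
have n1 : \forall y \near x, 0 < (y : 'rV_5) 0 ir.
  exact: (cvgr_gt (x 0 ir) (cc ir) 0 r0).
have n2 : \forall y \near x, (y : 'rV_5) 0 ir < rinf.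
  exact: (cvgr_lt (x 0 ir) (cc ir) rinf r1).
have n3 : \forall y \near x, sin ((y : 'rV_5) 0 ith) != 0.
  have c : (fun y : 'rV[R]_5 => sin (y 0 ith)) @ x --> sin (x 0 ith).
    apply: (@continuous_cvg _ _ _ (nbhs x) _ (fun y : 'rV[R]_5 => y 0 ith) (@sin R)).
      exact: continuous_sin.
    exact: cc.
  exact: (cvgr_neq0 _ c s0).
have n4 : \forall y \near x, f ((y : 'rV_5) 0 ir) != 0.
  have c : (fun y : 'rV[R]_5 => f (y 0 ir)) @ x --> f (x 0 ir).
    apply: (@continuous_cvg _ _ _ (nbhs x) _ (fun y : 'rV[R]_5 => y 0 ir) f); last first.
      exact: cc.
    by apply: continuous_f; rewrite gt_eqF.
  exact: (cvgr_neq0 _ c f0).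
apply: filterS (filterI (filterI n1 n2) (filterI n3 n4)).
by move=> y [[y1 y2] [y3 y4]]; split=> //; rewrite y1.
Qed.

(** Nondegeneracy of the metric excludes [k r = 0], where [e_r] is in its
    kernel, and [sin theta = 0], where [e_phi - cos theta e_psi] is; moreover
    [k] would vanish identically if [f rinf] did. *)
Lemma region_chart x : bh_region M q rinf x -> chart x /\ f rinf != 0.
Proof.
case=> /andP[r0 rr] /andP[th0 thpi] f0 gu.
have ker (v : 'cV[R]_5) : g x *m v = 0 -> v = 0.
  by move=> gv; rewrite -(mulKmx gu v) gv mulmx0.
have k0 : k (x 0 ir) != 0.
  apply/eqP => kE; have : (delta_mx ir 0 : 'cV[R]_5) = 0.
    apply: ker; apply/matrixP => i j; rewrite !mxE sum5 !bh_metricE !mxE.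
    rewrite /bh_entry; elim/ord5_ind: i; rewrite /= ?kE ?expr0n /=; ring.
  by move/matrixP/(_ ir 0); rewrite !mxE !eqxx => /eqP; rewrite oner_eq0.
have s0 : sin (x 0 ith) != 0.
  apply/eqP => sE; have : (delta_mx iphi 0
      - cos (x 0 ith) *: delta_mx ipsi 0 : 'cV[R]_5) = 0.
    apply: ker; apply/matrixP => i j; rewrite !mxE sum5 !bh_metricE !mxE.
    rewrite /bh_entry ord1; elim/ord5_ind: i; rewrite /= ?sE ?expr0n /=; ring.
  move/matrixP/(_ iphi 0); rewrite !mxE !eqxx /= mulr0 subr0 => /eqP.
  by rewrite oner_eq0.
split; first by split=> //; rewrite r0.
by apply: contraNneq k0 => E; rewrite /bh_k E !mul0r.
Qed.

Hypothesis f_rinf : f rinf != 0.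

Lemma near_christoffel x i j l : chart x ->
  \forall y \near x, bh_gamma M q rinf y i j l = christoffel g i j l y.
Proof.
move=> cx; have : open_nbhs x [set y | chart y].
  by split=> //; exact: open_chart.
move=> /open_nbhs_nbhs; apply: filterS => y cy.
by rewrite (christoffelE hrinf f_rinf).
Qed.

Lemma derivable_christoffel x w i j l : chart x ->
  derivable (christoffel g i j l) x w.
Proof.
move=> cx; have [d _] := is_derive_gamma hrinf f_rinf w i j l cx.
exact: near_eq_derivable (near_christoffel i j l cx) d.
Qed.

Lemma derive_christoffel x w i j l : chart x ->
  'D_w (christoffel g i j l) x =
    w 0 ir * (let r := x 0 ir in
      gamma_table ('D_1 (alpha M q) r) ('D_1 (accel M q rinf) r)
       ('D_1 (rho M q rinf) r) ('D_1 (nu1 rinf) r)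
       ('D_1 nu2 r) ('D_1 (pi1 M q rinf) r) ('D_1 (pi2 M q rinf) r)
       ('D_1 (kap M q rinf) r) 0 (sin (x 0 ith)) (cos (x 0 ith)) i j l)
    + w 0 ith * (let r := x 0 ir in
      dgamma_table (nu1 rinf r) (nu2 r) (pi1 M q rinf r) (pi2 M q rinf r)
       (kap M q rinf r) (sin (x 0 ith)) (cos (x 0 ith)) i j l).
Proof.
move=> cx; rewrite -(near_eq_derive w (near_christoffel i j l cx)).
exact: is_derive_val (is_derive_gamma hrinf f_rinf w i j l cx).
Qed.

End Chart.

(** * Components of a vector field *)

Section FieldComponents.
Context {R : realType} {n : nat}.
Implicit Types (X Y : vfield R n) (U : set (R * 'rV[R]_n)).

Definition coord (i : 'I_n) (w : R * 'rV[R]_n) : R := w.2 0 i.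

Lemma coord_is_linear i : linear (coord i).
Proof. by move=> a u v; rewrite /coord !mxE. Qed.

HB.instance Definition _ i :=
  GRing.isLinear.Build R (R * 'rV[R]_n)%type R _ (coord i) (coord_is_linear i).

Lemma coord_is_continuous i : continuous (coord i).
Proof.
move=> w; apply: (@continuous_cvg _ _ _ (nbhs w) _ snd (fun y : 'rV[R]_n => y 0 i)).
  exact: coord_continuous.
exact: cvg_snd.
Qed.

Lemma fst_is_continuous : continuous (@fst R 'rV[R]_n).
Proof. by move=> w; exact: cvg_fst. Qed.

Lemma smooth_xi X U : open U -> smooth U X -> smooth U (xi X).
Proof. by move=> oU sX m; exact: (Cm_linear oU fst_is_continuous (sX m)). Qed.

Lemma smooth_eta X U i : open U -> smooth U X -> smooth U (eta X i).
Proof.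
by move=> oU sX m; exact: (Cm_linear oU (@coord_is_continuous i) (sX m)).
Qed.

Lemma vfieldE X z : X z = xi X z *: ((1, 0) : R * 'rV[R]_n)
  + \sum_i eta X i z *: ((0, evec i) : R * 'rV[R]_n).
Proof.
rewrite /xi /eta; case: (X z) => a w /=.
have scaleP (b u : R) (v : 'rV[R]_n) : b *: (u, v) = (b * u, b *: v) by [].
have addP (u u' : R) (v v' : 'rV[R]_n) : (u, v) + (u', v') = (u + u', v + v').
  by [].
have -> : \sum_i w 0 i *: ((0, evec i) : R * 'rV[R]_n) = (0, w).
  rewrite [in RHS](row_sum_delta w).
  elim/big_rec2: _ => // i y1 _ _ ->.
  by rewrite scaleP addP mulr0 addr0.
by rewrite scaleP addP mulr1 scaler0 addr0 add0r.
Qed.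

Lemma smooth_vfield X U : open U -> smooth U (xi X) ->
  (forall i, smooth U (eta X i)) -> smooth U X.
Proof.
move=> oU sx se m; rewrite (_ : X = fun z => xi X z *: ((1, 0) : R * 'rV[R]_n)
  + \sum_i eta X i z *: ((0, evec i) : R * 'rV[R]_n)); last first.
  by apply/funext => z; exact: vfieldE.
apply: Cm_add => //; first exact: Cm_scal oU (sx m).
by apply: Cm_sum => // i; exact: Cm_scal oU (se i m).
Qed.

Lemma derive_xi X z v : derivable X z v -> ('D_v X z).1 = 'D_v (xi X) z.
Proof.
move=> dX; apply/esym.
exact: is_derive_val (is_derive_linear fst_is_continuous (derivableP dX)).
Qed.

Lemma derive_eta X i z v : derivable X z v -> ('D_v X z).2 0 i = 'D_v (eta X i) z.
Proof.
move=> dX; apply/esym.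
exact: is_derive_val (is_derive_linear (@coord_is_continuous i) (derivableP dX)).
Qed.

(** The determining equations are local: they see a field only through its
    derivatives. *)
Lemma determining_eq_on g U X Y z : open U -> U z ->
  (forall y, U y -> X y = Y y) -> determining g X z -> determining g Y z.
Proof.
move=> oU Uz XY.
have Exi y : U y -> xi X y = xi Y y by move=> Uy; rewrite /xi XY.
have Eeta i y : U y -> eta X i y = eta Y i y by move=> Uy; rewrite /eta XY.
have E1 (F G : R * 'rV[R]_n -> R) : (forall y, U y -> F y = G y) ->
    forall v y, U y -> 'D_v F y = 'D_v G y.
  by move=> FG v y Uy; exact: derive_eq_on oU Uy FG.
have Dxi v := E1 _ _ Exi v; have Deta i v := E1 _ _ (Eeta i) v.
have DDxi v w := E1 _ _ (Dxi v) w; have DDeta i v w := E1 _ _ (Deta i v) w.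
have eqM (a a' b : R) : a = a' -> a * b = a' * b by move=> ->.
have eqM' (a b b' : R) : b = b' -> a * b = a * b' by move=> ->.
have eqB (a a' b b' : R) : a = a' -> b = b' -> a - b = a' - b'.
  by move=> -> ->.
have eqD (a a' b b' : R) : a = a' -> b = b' -> a + b = a' + b'.
  by move=> -> ->.
case=> H0 H1 H2 H3; split.
- by move=> i; apply: etrans (H0 i); exact/esym/DDeta.
- move=> i j; apply: etrans (H1 i j); apply/esym/eqB.
    apply: (eqM'); apply: (eqD); first exact: DDeta.
    by apply: eq_bigr => l _; apply: (eqM); exact: Deta.
  by apply: (eqM'); exact: DDxi.
- move=> i j k; apply: etrans (H2 i j k); apply/esym.
  apply: (eqB); last by apply: (eqM'); exact: DDxi.
  apply: (eqB); last by apply: (eqM'); exact: DDxi.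
  apply: (eqD); last by apply: eq_bigr => l _; apply: (eqM'); exact: Deta.
  apply: (eqD); last by apply: eq_bigr => l _; apply: (eqM'); exact: Deta.
  apply: (eqB); last by apply: eq_bigr => l _; apply: (eqM); exact: Deta.
  apply: (eqD); first exact: DDeta.
  by apply: eq_bigr => l _; apply: (eqM); exact: Eeta.
- move=> j k; apply: etrans (H3 j k); apply/esym/eqB; first exact: DDxi.
  by apply: eq_bigr => l _; apply: (eqM); exact: Dxi.
Qed.

Lemma smooth_eq_on U X Y : open U -> (forall y, U y -> X y = Y y) ->
  smooth U X -> smooth U Y.
Proof. by move=> oU XY sX m; exact: eq_Cm oU XY (sX m). Qed.

End FieldComponents.

(** * The general combination of the generators *)

Section Generators.
Context {R : realType}.
Variables a1 a2 a3 a4 a5 a6 a7 : R.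

(** The theta component of a rotation field of the sphere, as a function of
    phi, and its derivative. *)
Definition rot (p : R) : R := a6 * sin p + a7 * cos p.
Definition rot' (p : R) : R := a6 * cos p - a7 * sin p.

Definition gen_eta (x : 'rV[R]_5) (i : 'I_5) : R :=
  let s := sin (x 0 ith) in let c := cos (x 0 ith) in let p := x 0 iphi in
  match val i with
  | 0%N => a3
  | 1%N => 0
  | 2%N => rot p
  | 3%N => a4 + c / s * rot' p
  | _ => a5 - rot' p / s
  end.

(** The combination of the seven generators with coefficients [a1], ..., [a7];
    all computations with generators are made once, for these symbols. *)
Definition gen : vfield R 5 := fun z => (a1 + a2 * z.1, \row_i gen_eta z.2 i).

(** First and second derivatives of [gen_eta], with [t] for [rot] and [t'] for
    [rot']. *)
Definition gen_eta1 (s c t t' : R) (i j : 'I_5) : R :=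
  match val i, val j with
  | 2%N, 3%N => t'
  | 3%N, 2%N => - (t' / s ^+ 2)
  | 3%N, 3%N => - (c / s * t)
  | 4%N, 2%N => c / s ^+ 2 * t'
  | 4%N, 3%N => t / s
  | _, _ => 0
  end.

Definition gen_eta2 (s c t t' : R) (i j l : 'I_5) : R :=
  match val i, val j, val l with
  | 2%N, 3%N, 3%N => - t
  | 3%N, 2%N, 2%N => 2 * c / s ^+ 3 * t'
  | 3%N, 2%N, 3%N | 3%N, 3%N, 2%N => t / s ^+ 2
  | 3%N, 3%N, 3%N => - (c / s * t')
  | 4%N, 2%N, 2%N => - ((s ^+ 2 + 2 * c ^+ 2) / s ^+ 3 * t')
  | 4%N, 2%N, 3%N | 4%N, 3%N, 2%N => - (c / s ^+ 2 * t)
  | 4%N, 3%N, 3%N => t' / s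
  | _, _, _ => 0
  end.

Lemma is_derive_gen_xi (z w : R * 'rV[R]_5) : is_derive z w (xi gen) (a2 * w.1).
Proof.
have H : is_derive z w (fun y : R * 'rV[R]_5 => y.1) w.1.
  by apply: (@is_derive_fst _ _ _ _ id); exact: is_derive_id.
eapply is_derive_eq; first by rewrite /xi /=; der.
by ring.
Qed.

Lemma is_derive_coord2 (i : 'I_5) (z w : R * 'rV[R]_5) :
  is_derive z w (fun y => y.2 0 i) (w.2 0 i).
Proof.
by apply: (@is_derive_snd _ _ _ _ (fun y : 'rV_5 => y 0 i)); exact: is_derive_coord.
Qed.

Lemma is_derive_gen_eta i (z w : R * 'rV[R]_5) : sin (z.2 0 ith) != 0 ->
  is_derive z w (eta gen i)
   (let G := gen_eta1 (sin (z.2 0 ith)) (cos (z.2 0 ith))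
      (rot (z.2 0 iphi)) (rot' (z.2 0 iphi)) in
    w.2 0 ith * G i ith + w.2 0 iphi * G i iphi).
Proof.
move=> s0; have Hth := is_derive_coord2 ith z w.
have Hph := is_derive_coord2 iphi z w.
have sc : cos (z.2 0 ith) ^+ 2 = 1 - sin (z.2 0 ith) ^+ 2 by exact: cos2sin2.
have -> : eta gen i = (fun y => gen_eta y.2 i).
  by apply/funext => y; rewrite /eta mxE.
rewrite /gen_eta /gen_eta1 /rot /rot'.
elim/ord5_ind: i => /=; eapply is_derive_eq; try by der.
all: rewrite /=.
all: try by ring.
all: by field: sc.
Qed.

Lemma is_derive_gen_eta1 i j (z w : R * 'rV[R]_5) : sin (z.2 0 ith) != 0 ->
  is_derive z w (fun y => gen_eta1 (sin (y.2 0 ith)) (cos (y.2 0 ith))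
      (rot (y.2 0 iphi)) (rot' (y.2 0 iphi)) i j)
   (let G := gen_eta2 (sin (z.2 0 ith)) (cos (z.2 0 ith))
      (rot (z.2 0 iphi)) (rot' (z.2 0 iphi)) in
    w.2 0 ith * G i j ith + w.2 0 iphi * G i j iphi).
Proof.
move=> s0; have Hth := is_derive_coord2 ith z w.
have Hph := is_derive_coord2 iphi z w.
have s2 : sin (z.2 0 ith) ^+ 2 != 0 by rewrite expf_neq0.
have sc : cos (z.2 0 ith) ^+ 2 = 1 - sin (z.2 0 ith) ^+ 2 by exact: cos2sin2.
rewrite /gen_eta1 /gen_eta2 /rot /rot'.
elim/ord5_ind: i => /=; elim/ord5_ind: j => /=; eapply is_derive_eq; try by der.
all: rewrite /=.
all: try by ring.
all: by field: sc.
Qed.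

Lemma open_sin_neq0 : open [set z : R * 'rV[R]_5 | sin (z.2 0 ith) != 0].
Proof.
rewrite openE => z s0.
have c : (fun y : R * 'rV[R]_5 => sin (y.2 0 ith)) @ z --> sin (z.2 0 ith).
  apply: (@continuous_cvg _ _ _ (nbhs z) _
    (fun y : R * 'rV[R]_5 => y.2 0 ith) (@sin R)).
    exact: continuous_sin.
  exact: coord_is_continuous.
exact: (cvgr_neq0 _ c s0).
Qed.

Section SmoothCoordinates.
Variable U : set (R * 'rV[R]_5).
Hypothesis oU : open U.

Lemma Cm_id m : Cm m U (@id (R * 'rV[R]_5)).
Proof.
elim: m => [|m IH]; split=> //; try by move=> z _; exact: cvg_id.
move=> v; split; first by move=> z _; exact: derivable_id.
apply: (eq_Cm oU _ (Cm_cst m v oU)) => z _.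
by rewrite (is_derive_val (is_derive_id z v)).
Qed.

Lemma Cm_coord m (i : 'I_5) : Cm m U (fun z : R * 'rV[R]_5 => z.2 0 i).
Proof. exact: Cm_linear oU (@coord_is_continuous _ _ i) (Cm_id m). Qed.

Lemma Cm_time m : Cm m U (fun z : R * 'rV[R]_5 => z.1).
Proof. exact: Cm_linear oU (@fst_is_continuous _ _) (Cm_id m). Qed.

Lemma Cm_sin_coord m (i : 'I_5) : Cm m U (fun z : R * 'rV[R]_5 => sin (z.2 0 i)).
Proof. by have [] := Cm_sin_cos oU (Cm_coord m i). Qed.

Lemma Cm_cos_coord m (i : 'I_5) : Cm m U (fun z : R * 'rV[R]_5 => cos (z.2 0 i)).
Proof. by have [] := Cm_sin_cos oU (Cm_coord m i). Qed.

Hypothesis s0 : forall z, U z -> sin (z.2 0 ith) != 0.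

Lemma Cm_csc m : Cm m U (fun z : R * 'rV[R]_5 => (sin (z.2 0 ith))^-1).
Proof. by apply: Cm_inv => //; exact: Cm_sin_coord. Qed.

Lemma smooth_gen : smooth U gen.
Proof.
have Ccst m (b : R) : Cm m U (fun=> b) by exact: Cm_cst.
have Crot m : Cm m U (fun z : R * 'rV[R]_5 => rot (z.2 0 iphi)).
  have S := Cm_sin_coord m iphi; have C := Cm_cos_coord m iphi.
  exact: Cm_add oU (Cm_mul oU (Ccst m a6) S) (Cm_mul oU (Ccst m a7) C).
have Crot' m : Cm m U (fun z : R * 'rV[R]_5 => rot' (z.2 0 iphi)).
  have S := Cm_sin_coord m iphi; have C := Cm_cos_coord m iphi.
  exact: Cm_add oU (Cm_mul oU (Ccst m a6) C) (Cm_opp oU (Cm_mul oU (Ccst m a7) S)).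
apply: smooth_vfield => //.
  move=> m; apply: (Cm_add oU (Ccst m a1)); apply: (Cm_mul oU (Ccst m a2)).
  exact: Cm_time.
move=> i m; apply: (@eq_Cm _ _ _ m U (fun z : R * 'rV[R]_5 => gen_eta z.2 i)) => //.
  by move=> z _; rewrite /eta mxE.
have C := Cm_cos_coord m ith.
rewrite /gen_eta; elim/ord5_ind: i => /=; try exact: Ccst.
- exact: Crot.
- exact: Cm_add oU (Ccst m a4) (Cm_mul oU (Cm_mul oU C (Cm_csc m)) (Crot' m)).
- exact: Cm_add oU (Ccst m a5) (Cm_opp oU (Cm_mul oU (Crot' m) (Cm_csc m))).
Qed.

End SmoothCoordinates.

End Generators.

(** * The generators are symmetries *)

Section DefectValues.
Context {R : realType} {n : nat}.
Local Notation ds := ((1, 0) : R * 'rV[R]_n).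
Local Notation dx i := ((0, evec i) : R * 'rV[R]_n).
Variables (g : 'rV[R]_n -> 'M[R]_n) (X : vfield R n) (z : R * 'rV[R]_n).

(** Replaces every ingredient of a defect by its computed value in one step;
    the sums stay folded until then. *)
Lemma quad_defectE i j k (e2 x1 x2 : R) (e dG d1 d2 d3 G1 G2 G3 : 'I_n -> R) :
  'D_(dx j) ('D_(dx k) (eta X i)) z = e2 ->
  (forall l, eta X l z = e l) ->
  (forall l, 'D_(evec l) (christoffel g i j k) z.2 = dG l) ->
  (forall l, 'D_(dx l) (eta X i) z = d1 l) ->
  (forall l, christoffel g l j k z.2 = G1 l) ->
  (forall l, christoffel g i l k z.2 = G2 l) ->
  (forall l, 'D_(dx j) (eta X l) z = d2 l) ->
  (forall l, christoffel g i j l z.2 = G3 l) ->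
  (forall l, 'D_(dx k) (eta X l) z = d3 l) ->
  'D_(dx k) ('D_ds (xi X)) z = x1 -> 'D_(dx j) ('D_ds (xi X)) z = x2 ->
  quad_defect g X i z j k = e2 + \sum_l e l * dG l - \sum_l d1 l * G1 l
    + \sum_l G2 l * d2 l + \sum_l G3 l * d3 l
    - (i == j)%:R * x1 - (i == k)%:R * x2.
Proof.
move=> <- He HG H1 K1 K2 H2 K3 H3 <- <-.
have S (a a' b b' : 'I_n -> R) : a =1 a' -> b =1 b' ->
    \sum_l a l * b l = \sum_l a' l * b' l.
  by move=> E E'; apply: eq_bigr => l _; rewrite E E'.
by rewrite -(S _ _ _ _ He HG) -(S _ _ _ _ H1 K1) -(S _ _ _ _ K2 H2)
  -(S _ _ _ _ K3 H3).
Qed.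

End DefectValues.

Section GeneratorsAreSymmetries.
Context {R : realType}.
Variables M q rinf : R.
Hypothesis hrinf : 0 < rinf.
Hypothesis f_rinf : bh_f M q rinf != 0.
Variables a1 a2 a3 a4 a5 a6 a7 : R.
Local Notation ds := ((1, 0) : R * 'rV[R]_5).
Local Notation dx i := ((0, evec i) : R * 'rV[R]_5).
Local Notation K := (gen a1 a2 a3 a4 a5 a6 a7).
Local Notation W := [set z : R * 'rV[R]_5 | sin (z.2 0 ith) != 0].
Local Notation g := (bh_metric M q rinf).

Lemma D_gen_eta i j (z : R * 'rV[R]_5) : W z -> 'D_(dx j) (eta K i) z =
  gen_eta1 (sin (z.2 0 ith)) (cos (z.2 0 ith)) (rot a6 a7 (z.2 0 iphi))
    (rot' a6 a7 (z.2 0 iphi)) i j.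
Proof.
move=> Wz; rewrite (is_derive_val (is_derive_gen_eta a1 a2 a3 a4 a5 a6 a7 i _ Wz)).
rewrite /= !evecE /gen_eta1.
elim/ord5_ind: i; elim/ord5_ind: j => /=; ring.
Qed.

Lemma Ds_gen_eta i (z : R * 'rV[R]_5) : W z -> 'D_ds (eta K i) z = 0.
Proof.
move=> Wz; rewrite (is_derive_val (is_derive_gen_eta a1 a2 a3 a4 a5 a6 a7 i _ Wz)).
by rewrite /= !mxE !mul0r addr0.
Qed.

Lemma DD_gen_eta i j k (z : R * 'rV[R]_5) : W z ->
  'D_(dx j) ('D_(dx k) (eta K i)) z =
  gen_eta2 (sin (z.2 0 ith)) (cos (z.2 0 ith)) (rot a6 a7 (z.2 0 iphi))
    (rot' a6 a7 (z.2 0 iphi)) i k j.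
Proof.
move=> Wz; rewrite (derive_eq_on _ open_sin_neq0 Wz (fun y Wy => D_gen_eta i k Wy)).
rewrite (is_derive_val (is_derive_gen_eta1 a6 a7 i k _ Wz)).
rewrite /= !evecE /gen_eta2.
elim/ord5_ind: i; elim/ord5_ind: j; elim/ord5_ind: k => /=; ring.
Qed.

Lemma DDs_gen_eta i v (z : R * 'rV[R]_5) : W z -> 'D_v ('D_ds (eta K i)) z = 0.
Proof.
move=> Wz; rewrite (derive_eq_on _ open_sin_neq0 Wz (fun y Wy => Ds_gen_eta i Wy)).
exact: is_derive_val (is_derive_cstf _ _ _).
Qed.

Lemma DD_gen_xi v w (z : R * 'rV[R]_5) : 'D_v ('D_w (xi K)) z = 0.
Proof.
have -> : 'D_w (xi K) = fun=> a2 * w.1.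
  apply/funext => y.
  exact: is_derive_val (is_derive_gen_xi a1 a2 a3 a4 a5 a6 a7 y w).
exact: is_derive_val (is_derive_cstf _ _ _).
Qed.

(** The rotations and the translations of t and psi are isometries, and [xi] is
    affine in [s]. Once the radial functions and their derivatives are
    abstracted, this is an identity of rational functions in the sine and
    cosine of theta: it holds for arbitrary radial functions. *)
Lemma determining_gen (z : R * 'rV[R]_5) : chart M q rinf z.2 ->
  determining g K z.
Proof.
move=> cz; have [_ s0 _] := cz.
have Wz : W z by [].
split.
- by move=> i; rewrite DDs_gen_eta.
- move=> i j; rewrite /lin_defect DDs_gen_eta // DD_gen_xi mulr0 subr0 add0r.
  by rewrite big1 ?mulr0 // => l _; rewrite Ds_gen_eta ?mul0r.
- move=> i j k.
  rewrite (quad_defectE (DD_gen_eta i j k Wz) (fun l => erefl)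
    (fun l => derive_christoffel hrinf f_rinf (evec l) i j k cz)
    (fun l => D_gen_eta i l Wz)
    (fun l => christoffelE hrinf f_rinf l j k cz)
    (fun l => christoffelE hrinf f_rinf i l k cz)
    (fun l => D_gen_eta l j Wz)
    (fun l => christoffelE hrinf f_rinf i j l cz)
    (fun l => D_gen_eta l k Wz)
    (DD_gen_xi _ _ z) (DD_gen_xi _ _ z)).
  have E l : eta K l z = gen_eta a3 a4 a5 a6 a7 z.2 l by rewrite /eta mxE.
  rewrite !sum5 !E !evecE /bh_gamma /gen_eta.
  have sc : cos (z.2 0 ith) ^+ 2 = 1 - sin (z.2 0 ith) ^+ 2 by exact: cos2sin2.
  have : sin (z.2 0 ith) != 0 by [].
  move: sc; rewrite /=.
  move: ('D_1 (alpha M q) _) ('D_1 (accel M q rinf) _) ('D_1 (rho M q rinf) _).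
  move: ('D_1 (nu1 rinf) _) ('D_1 nu2 _) ('D_1 (pi1 M q rinf) _).
  move: ('D_1 (pi2 M q rinf) _) ('D_1 (kap M q rinf) _).
  move: (alpha _ _ _) (accel _ _ _ _) (rho _ _ _ _) (nu1 _ _) (nu2 _).
  move: (pi1 _ _ _ _) (pi2 _ _ _ _) (kap _ _ _ _).
  move: (rot _ _ _) (rot' _ _ _) (sin _) (cos _).
  clear E Wz s0 cz z => T T' s c.
  move=> p1 p2 ka al ac rh n1 n2 dp2 dka dn1 dn2 dp1 dal dac drh sc s0.
  rewrite /gamma_table /dgamma_table /gen_eta1 /gen_eta2.
  elim/ord5_ind: i; elim/ord5_ind: j; elim/ord5_ind: k => /=;
    first [ring | by field: sc].
- move=> j k; rewrite /cubic_defect DD_gen_xi sub0r big1 ?oppr0 // => l _.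
  by rewrite (is_derive_val (is_derive_gen_xi a1 a2 a3 a4 a5 a6 a7 z _))
     mulr0 mul0r.
Qed.

End GeneratorsAreSymmetries.

(** * Commutators of the generators *)

Section GeneratorAlgebra.
Context {R : realType}.
Implicit Types (z : R * 'rV[R]_5).

Definition o7 (k : nat) (lt_k7 : (k < 7)%N) : 'I_7 := Ordinal lt_k7.

Lemma ord7_ind (P : 'I_7 -> Prop) :
  P (@o7 0 isT) -> P (@o7 1 isT) -> P (@o7 2 isT) -> P (@o7 3 isT) ->
  P (@o7 4 isT) -> P (@o7 5 isT) -> P (@o7 6 isT) -> forall i, P i.
Proof.
move=> P0 P1 P2 P3 P4 P5 P6 [[|[|[|[|[|[|[|//]]]]]]] lt_i7].
- by rewrite (_ : Ordinal _ = @o7 0 isT) //; apply: val_inj.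
- by rewrite (_ : Ordinal _ = @o7 1 isT) //; apply: val_inj.
- by rewrite (_ : Ordinal _ = @o7 2 isT) //; apply: val_inj.
- by rewrite (_ : Ordinal _ = @o7 3 isT) //; apply: val_inj.
- by rewrite (_ : Ordinal _ = @o7 4 isT) //; apply: val_inj.
- by rewrite (_ : Ordinal _ = @o7 5 isT) //; apply: val_inj.
- by rewrite (_ : Ordinal _ = @o7 6 isT) //; apply: val_inj.
Qed.

Lemma sum7 (W : nmodType) (F : 'I_7 -> W) :
  \sum_l F l = F (@o7 0 isT) + F (@o7 1 isT) + F (@o7 2 isT) + F (@o7 3 isT)
    + F (@o7 4 isT) + F (@o7 5 isT) + F (@o7 6 isT).
Proof.
rewrite !big_ord_recr big_ord0 /= add0r.
by congr (_ + _ + _ + _ + _ + _ + _); congr F; apply: val_inj.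
Qed.

Definition gen_of (c : 'I_7 -> R) : vfield R 5 :=
  gen (c (@o7 0 isT)) (c (@o7 1 isT)) (c (@o7 2 isT)) (c (@o7 3 isT))
    (c (@o7 4 isT)) (c (@o7 5 isT)) (c (@o7 6 isT)).

Lemma gen_ofE (c : 'I_7 -> R) z : \sum_i c i *: bh_basis i z = gen_of c z.
Proof.
rewrite sum7; set lhs := (X in X = _).
have E : lhs = c (@o7 0 isT) *: X1 z + c (@o7 1 isT) *: X2 z
  + c (@o7 2 isT) *: X3 z + c (@o7 3 isT) *: X4 z
  + c (@o7 4 isT) *: X5 z + c (@o7 5 isT) *: X6 z + c (@o7 6 isT) *: X7 z by [].
rewrite E /gen_of; move: (c _) (c _) (c _) (c _) (c _) (c _) (c _).
move=> a7 a6 a5 a4 a3 a2 a1; clear lhs E; apply: injective_projections.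
  change (a1 * 1 + a2 * z.1 + a3 * 0 + a4 * 0 + a5 * 0 + a6 * 0 + a7 * 0
    = a1 + a2 * z.1); ring.
apply/rowP => i; rewrite [RHS]mxE /gen_eta /=.
rewrite !mxE /rot /rot' /cot /csc.
by elim/ord5_ind: i => /=; ring.
Qed.

Lemma gen_of_eq (c c' : 'I_7 -> R) : c =1 c' -> gen_of c = gen_of c'.
Proof. by move=> E; rewrite /gen_of !E. Qed.

Lemma basis_gen i z : bh_basis i z = gen_of (fun j => (j == i)%:R) z.
Proof.
rewrite -gen_ofE (bigD1 i) //= eqxx scale1r big1 ?addr0 // => j /negbTE ->.
by rewrite scale0r.
Qed.

Lemma bracket_comp (X Y : vfield R 5) z :
  (forall v, derivable X z v) -> (forall v, derivable Y z v) ->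
  (bracket X Y z).1 = xi X z * 'D_((1, 0) : R * 'rV[R]_5) (xi Y) z
      + \sum_i eta X i z * 'D_((0, evec i) : R * 'rV[R]_5) (xi Y) z
    - (xi Y z * 'D_((1, 0) : R * 'rV[R]_5) (xi X) z
      + \sum_i eta Y i z * 'D_((0, evec i) : R * 'rV[R]_5) (xi X) z) /\
  forall j, (bracket X Y z).2 0 j =
    xi X z * 'D_((1, 0) : R * 'rV[R]_5) (eta Y j) z
      + \sum_i eta X i z * 'D_((0, evec i) : R * 'rV[R]_5) (eta Y j) z
    - (xi Y z * 'D_((1, 0) : R * 'rV[R]_5) (eta X j) z
      + \sum_i eta Y i z * 'D_((0, evec i) : R * 'rV[R]_5) (eta X j) z).
Proof.
move=> dX dY; have A (L : {linear (R * 'rV[R]_5)%type -> R}) (Z Z' : vfield R 5)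
    (l : vfield R 5 -> R * 'rV[R]_5 -> R) :
    (forall v, L ('D_v Z z) = 'D_v (l Z) z) ->
    L (vf_act Z' Z z) = xi Z' z * 'D_((1, 0) : R * 'rV[R]_5) (l Z) z
      + \sum_i eta Z' i z * 'D_((0, evec i) : R * 'rV[R]_5) (l Z) z.
  move=> H; rewrite /vf_act linearD linearZ linear_sum /= H; congr (_ + _).
  by apply: eq_bigr => i _; rewrite linearZ H.
split=> [|j].
  apply: etrans (linearB (@fst R 'rV[R]_5) _ _) _.
  apply: eq_sub; apply: (A (@fst R 'rV[R]_5) _ _ (fun Z => xi Z)) => v;
    exact: derive_xi.
apply: etrans (linearB (coord j) _ _) _.
apply: eq_sub; apply: (A (coord j) _ _ (fun Z => eta Z j)) => v;
  exact: derive_eta.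
Qed.

(** The whole commutator table, and the closure of the span under commutators,
    from a single computation with undetermined coefficients. *)
Lemma bracket_gen a1 a2 a3 a4 a5 a6 a7 b1 b2 b3 b4 b5 b6 b7 z :
  sin (z.2 0 ith) != 0 ->
  bracket (gen a1 a2 a3 a4 a5 a6 a7) (gen b1 b2 b3 b4 b5 b6 b7) z
  = gen (a1 * b2 - b1 * a2) 0 0 (a6 * b7 - b6 * a7) 0
      (b4 * a7 - a4 * b7) (a4 * b6 - b4 * a6) z.
Proof.
move=> s0; have dg c1 c2 c3 c4 c5 c6 c7 v :
    derivable (gen c1 c2 c3 c4 c5 c6 c7) z v.
  have smg := smooth_gen c1 c2 c3 c4 c5 c6 c7 (@open_sin_neq0 R) (fun y Wy => Wy).
  by have [] := smooth_is_derive v smg s0.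
have [Ex Ee] := bracket_comp (dg a1 a2 a3 a4 a5 a6 a7) (dg b1 b2 b3 b4 b5 b6 b7).
have Dx c1 c2 c3 c4 c5 c6 c7 (v : R * 'rV[R]_5) :
    'D_v (xi (gen c1 c2 c3 c4 c5 c6 c7)) z = c2 * v.1.
  exact: is_derive_val (is_derive_gen_xi _ _ _ _ _ _ _ _ _).
apply: injective_projections.
  rewrite Ex !sum5 !Dx /=; rewrite /xi /=.
  move: (eta _ _ _) (eta _ _ _) (eta _ _ _) (eta _ _ _) (eta _ _ _).
  move: (eta _ _ _) (eta _ _ _) (eta _ _ _) (eta _ _ _) (eta _ _ _).
  by move=> *; ring.
apply/rowP => j; rewrite Ee !Ds_gen_eta // !sum5 !D_gen_eta //.
rewrite /eta !mxE /gen_eta1 /gen_eta /rot /rot'.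
have := cos2sin2 (z.2 0 iphi); have := cos2sin2 (z.2 0 ith).
move: (xi _ _) (xi _ _) (cos _) (sin _) (cos (z.2 0 iphi)) (sin (z.2 0 iphi)) s0.
move=> x y c s c' s' s0 E E'.
elim/ord5_ind: j => /=; first [ring | by field: E E'].
Qed.

End GeneratorAlgebra.

(** * Partial derivatives *)

Section PartialDerivatives.
Context {R : realType} {n : nat}.
Implicit Types (h : R * 'rV[R]_n -> R) (z : R * 'rV[R]_n).

Definition pd (i : 'I_n) h : R * 'rV[R]_n -> R :=
  'D_((0, evec i) : R * 'rV[R]_n) h.
Definition pds h : R * 'rV[R]_n -> R := 'D_((1, 0) : R * 'rV[R]_n) h.

Variable V : set (R * 'rV[R]_n).
Hypothesis oV : open V.

Lemma smooth_pd i h : smooth V h -> smooth V (pd i h).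
Proof. exact: smooth_derive. Qed.

Lemma smooth_pds h : smooth V h -> smooth V (pds h).
Proof. exact: smooth_derive. Qed.

Lemma is_derive_pd i h z : smooth V h -> V z ->
  is_derive z ((0, evec i) : R * 'rV[R]_n) h (pd i h z).
Proof. exact: smooth_is_derive. Qed.

Lemma is_derive_pds h z : smooth V h -> V z ->
  is_derive z ((1, 0) : R * 'rV[R]_n) h (pds h z).
Proof. exact: smooth_is_derive. Qed.

Lemma pdC i j h z : smooth V h -> V z -> pd i (pd j h) z = pd j (pd i h) z.
Proof. by move=> sh Vz; exact: deriveC oV (sh 2%N) Vz. Qed.

Lemma pdsC i h z : smooth V h -> V z -> pd i (pds h) z = pds (pd i h) z.
Proof. by move=> sh Vz; exact: deriveC oV (sh 2%N) Vz. Qed.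

Lemma pd_val i h z d :
  is_derive z ((0, evec i) : R * 'rV[R]_n) h d -> pd i h z = d.
Proof. exact: is_derive_val. Qed.

Lemma pds_val h z d :
  is_derive z ((1, 0) : R * 'rV[R]_n) h d -> pds h z = d.
Proof. exact: is_derive_val. Qed.

Lemma eq_pd i h h' z : V z -> (forall y, V y -> h y = h' y) ->
  pd i h z = pd i h' z.
Proof. by move=> Vz E; exact: derive_eq_on oV Vz E. Qed.

Lemma eq_pds h h' z : V z -> (forall y, V y -> h y = h' y) ->
  pds h z = pds h' z.
Proof. by move=> Vz E; exact: derive_eq_on oV Vz E. Qed.

Lemma pd_eq0 i h z : V z -> (forall y, V y -> h y = 0) -> pd i h z = 0.
Proof.
move=> Vz h0; rewrite (eq_pd i Vz h0).
exact: is_derive_val (is_derive_cstf _ _ _).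
Qed.

Lemma pds_eq0 h z : V z -> (forall y, V y -> h y = 0) -> pds h z = 0.
Proof.
move=> Vz h0; rewrite (eq_pds Vz h0).
exact: is_derive_val (is_derive_cstf _ _ _).
Qed.

End PartialDerivatives.

(** * Solving the determining equations where f' does not vanish *)

Section Solve.
Context {R : realType}.
Variables M q rinf : R.
Hypothesis hrinf : 0 < rinf.
Hypothesis f_rinf : bh_f M q rinf != 0.
Variable V : set (R * 'rV[R]_5).
Hypothesis oV : open V.
Hypothesis V_chart : forall z, V z -> chart M q rinf z.2.
Hypothesis V_f' : forall z, V z -> bh_f' M q (z.2 0 ir) != 0.
Variable X : vfield R 5.
Hypothesis sX : smooth V X.
Hypothesis detX : forall z, V z -> determining (bh_metric M q rinf) X z.

Local Notation e i := (eta X i).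
Local Notation x := (xi X).
Local Notation r z := (z.2 0 ir).
Local Notation s z := (sin (z.2 0 ith)).
Local Notation c z := (cos (z.2 0 ith)).
Local Notation al z := (alpha M q (z.2 0 ir)).
Local Notation ac z := (accel M q rinf (z.2 0 ir)).
Local Notation n1 z := (nu1 rinf (z.2 0 ir)).
Local Notation n2 z := (nu2 (z.2 0 ir)).
Local Notation p1 z := (pi1 M q rinf (z.2 0 ir)).
Local Notation p2 z := (pi2 M q rinf (z.2 0 ir)).
Local Notation ka z := (kap M q rinf (z.2 0 ir)).
Local Notation Gam := (bh_gamma M q rinf).

Let sx : smooth V x. Proof. exact: smooth_xi. Qed.
Let se i : smooth V (e i). Proof. exact: smooth_eta. Qed.

Definition angular (y : 'I_5) : bool := (1 < y)%N.

Lemma angular_ind (P : 'I_5 -> Prop) :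
  P ith -> P iphi -> P ipsi -> forall y, angular y -> P y.
Proof. by move=> P2 P3 P4; elim/ord5_ind. Qed.

Lemma cubic_eq i j z : V z -> pd i (pd j x) z =
  pd it x z * Gam z.2 it i j + pd ir x z * Gam z.2 ir i j
  + pd ith x z * Gam z.2 ith i j + pd iphi x z * Gam z.2 iphi i j
  + pd ipsi x z * Gam z.2 ipsi i j.
Proof.
move=> Vz; have [_ _ _ /(_ i j)/eqP H] := detX Vz; move: H.
rewrite /cubic_defect subr_eq0 sum5 => /eqP H; apply: etrans H _.
by rewrite !(christoffelE hrinf f_rinf _ _ _ (V_chart Vz)).
Qed.

Lemma lin_eq i j z : V z ->
  2 * (pd j (pds (e i)) z + (pds (e it) z * Gam z.2 i j it
    + pds (e ir) z * Gam z.2 i j ir + pds (e ith) z * Gam z.2 i j ith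
    + pds (e iphi) z * Gam z.2 i j iphi + pds (e ipsi) z * Gam z.2 i j ipsi))
  = (i == j)%:R * pds (pds x) z.
Proof.
move=> Vz; have [_ /(_ i j)/eqP H _ _] := detX Vz; move: H.
rewrite /lin_defect subr_eq0 sum5 => /eqP H; apply: etrans H.
by rewrite !(christoffelE hrinf f_rinf _ _ _ (V_chart Vz)).
Qed.

Lemma sub2_eq0 (a u v : R) : a - u - v = 0 -> a = u + v.
Proof. by move=> /eqP; rewrite -addrA -opprD subr_eq0 => /eqP. Qed.

Lemma sum_dG (u : 'I_5 -> R) (a b : R) :
  \sum_l u l * (evec l 0 ir * a + evec l 0 ith * b) = u ir * a + u ith * b.
Proof. by rewrite sum5 !evecE /=; ring. Qed.

Lemma quad_eq i j k z : V z ->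
  pd j (pd k (e i)) z
  + (e ir z * gamma_table ('D_1 (alpha M q) (r z)) ('D_1 (accel M q rinf) (r z))
       ('D_1 (rho M q rinf) (r z)) ('D_1 (nu1 rinf) (r z))
       ('D_1 nu2 (r z)) ('D_1 (pi1 M q rinf) (r z)) ('D_1 (pi2 M q rinf) (r z))
       ('D_1 (kap M q rinf) (r z)) 0 (s z) (c z) i j k
     + e ith z * dgamma_table (n1 z) (n2 z) (p1 z) (p2 z) (ka z) (s z) (c z) i j k)
  - (pd it (e i) z * Gam z.2 it j k + pd ir (e i) z * Gam z.2 ir j k
     + pd ith (e i) z * Gam z.2 ith j k + pd iphi (e i) z * Gam z.2 iphi j k
     + pd ipsi (e i) z * Gam z.2 ipsi j k)
  + (Gam z.2 i it k * pd j (e it) z + Gam z.2 i ir k * pd j (e ir) z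
     + Gam z.2 i ith k * pd j (e ith) z + Gam z.2 i iphi k * pd j (e iphi) z
     + Gam z.2 i ipsi k * pd j (e ipsi) z)
  + (Gam z.2 i j it * pd k (e it) z + Gam z.2 i j ir * pd k (e ir) z
     + Gam z.2 i j ith * pd k (e ith) z + Gam z.2 i j iphi * pd k (e iphi) z
     + Gam z.2 i j ipsi * pd k (e ipsi) z)
  = (i == j)%:R * pd k (pds x) z + (i == k)%:R * pd j (pds x) z.
Proof.
move=> Vz; have [_ _ /(_ i j k) H _] := detX Vz.
move: H; rewrite (quad_defectE erefl (fun l => erefl)
    (fun l => derive_christoffel hrinf f_rinf (evec l) i j k (V_chart Vz))
    (fun l => erefl)
    (fun l => christoffelE hrinf f_rinf l j k (V_chart Vz))
    (fun l => christoffelE hrinf f_rinf i l k (V_chart Vz))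
    (fun l => erefl)
    (fun l => christoffelE hrinf f_rinf i j l (V_chart Vz))
    (fun l => erefl) erefl erefl).
rewrite (sum_dG (fun l => e l z)) !sum5 => H.
exact: sub2_eq0 H.
Qed.

(* Keeps second derivatives from being unfolded into limits. *)
#[local] Opaque pd pds.

Lemma mulr_eq0l (a u : R) : a != 0 -> a * u = 0 -> u = 0.
Proof. by move=> a0 /eqP; rewrite mulf_eq0 (negbTE a0) => /eqP. Qed.

Lemma comb_eq0 (a b u v : R) : u = 0 -> v = 0 -> a * u + b * v = 0.
Proof. by move=> -> ->; rewrite !mulr0 addr0. Qed.

(** The second fundamental form of the orbits, restricted to phi and psi, is
    nondegenerate. *)
Lemma form_kernel (P1 P2 S C u v : R) : P1 != 0 -> P2 != 0 -> S != 0 ->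
  (P1 * S ^+ 2 + P2 * C ^+ 2) * u + P2 * C * v = 0 ->
  P2 * C * u + P2 * v = 0 -> u = 0 /\ v = 0.
Proof.
move=> P10 P20 S0 H1 H2; have u0 : u = 0.
  apply: (@mulr_eq0l (P1 * S ^+ 2)); first by rewrite mulf_neq0 ?expf_neq0.
  rewrite -[RHS]subr0 -{1}H1 -(mulr0 C) -H2; ring.
by split=> //; apply: (mulr_eq0l P20); rewrite -H2 u0; ring.
Qed.

(** What makes the metric rigid: where [f'] does not vanish, the lines of t are
    accelerated. Everywhere, the second fundamental form of the orbits of the
    sphere rotations and of the fibre is nondegenerate, the eigenvalues [nu1]
    and [nu2] of its shape operator are distinct, and both their quotient and
    the shape [kap] of the orbits vary with r. *)
Lemma radial_facts z : V z ->
  [/\ al z != 0, ac z != 0, p1 z != 0, p2 z != 0 &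
   [/\ n1 z != 0, n2 z != 0, n1 z - n2 z != 0, s z != 0 &
    'D_1 (kap M q rinf) (r z) != 0 /\
    'D_1 (nu1 rinf) (r z) * n2 z - n1 z * 'D_1 nu2 (r z) != 0]].
Proof.
move=> Vz; have cz := V_chart Vz; have f'0 := V_f' Vz.
have [r0 d0 k0 dneg rpos] := chart_facts hrinf f_rinf cz.
have [_ s0 f0] := cz.
have four : (4 : R) != 0 by rewrite pnatr_eq0.
have two : (2 : R) != 0 by rewrite pnatr_eq0.
have sum0 : r z ^+ 2 + rinf ^+ 2 != 0.
  by rewrite gt_eqF // addr_gt0 // exprn_gt0.
have R0 : rinf != 0 by rewrite gt_eqF.
have n1E : n1 z = - (r z ^+ 2 + rinf ^+ 2) / (r z * (r z ^+ 2 - rinf ^+ 2)).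
  by rewrite /nu1 /log_k'; field; rewrite d0 r0.
have n10 : n1 z != 0.
  by rewrite n1E mulf_neq0 ?oppr_eq0 ?invr_neq0 ?mulf_neq0.
have n20 : n2 z != 0 by rewrite /nu2 invr_neq0.
have Dn2 : 'D_1 nu2 (r z) = - (r z ^+ 2)^-1.
  rewrite /nu2; apply: is_derive_val.
  by eapply is_derive_eq; [der | rewrite /=; field].
have Dn1 : 'D_1 (nu1 rinf) (r z) = - (r z ^+ 2)^-1
    + 2 * (r z ^+ 2 + rinf ^+ 2) / (r z ^+ 2 - rinf ^+ 2) ^+ 2.
  rewrite /nu1 /log_k'; apply: is_derive_val.
  by eapply is_derive_eq; [der | rewrite /=; field; rewrite d0 r0].
have Dk := is_derive_k M q d0.
have Dka : 'D_1 (kap M q rinf) (r z)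
    = 4 * r z / ((r z ^+ 2 - rinf ^+ 2) * bh_k M q rinf (r z)).
  rewrite /kap; apply: is_derive_val.
  by eapply is_derive_eq; [der | rewrite /log_k' /=; field; rewrite d0 k0].
split; first by rewrite /alpha mulf_neq0 ?invr_neq0 ?mulf_neq0.
- by rewrite /accel !(mulf_neq0, invr_neq0, expf_neq0).
- by rewrite /pi1 !(mulf_neq0, invr_neq0, expf_neq0).
- by rewrite /pi2 !(mulf_neq0, invr_neq0, expf_neq0).
split=> //; last split.
- rewrite /nu1 /nu2 addrAC subrr add0r /log_k'.
  by rewrite !(mulf_neq0, invr_neq0) // oppr_eq0.
- by rewrite Dka !(mulf_neq0, invr_neq0).
- have -> : 'D_1 (nu1 rinf) (r z) * n2 z - n1 z * 'D_1 nu2 (r z)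
      = 4 * rinf ^+ 2 / (r z * (r z ^+ 2 - rinf ^+ 2) ^+ 2).
    by rewrite Dn1 Dn2 n1E /nu2; field; rewrite d0 r0.
  by rewrite !(mulf_neq0, invr_neq0, expf_neq0).
Qed.

Lemma pd_comb i (phi1 phi2 : R * 'rV[R]_5 -> R) h1 h2 z :
  is_derive z ((0, evec i) : R * 'rV[R]_5) phi1 0 ->
  is_derive z ((0, evec i) : R * 'rV[R]_5) phi2 0 ->
  smooth V h1 -> smooth V h2 -> V z ->
  pd i (fun y => phi1 y * h1 y + phi2 y * h2 y) z
  = phi1 z * pd i h1 z + phi2 z * pd i h2 z.
Proof.
move=> H1 H2 s1 s2 Vz; apply: pd_val.
apply: is_derive_eq (is_derive_add
  (is_derive_mul H1 (is_derive_pd i s1 Vz))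
  (is_derive_mul H2 (is_derive_pd i s2 Vz))) _.
by rewrite !mul0r !add0r.
Qed.

Lemma is_derive_coef (phi : R -> R -> R) i z : i != ir -> i != ith ->
  is_derive z ((0, evec i) : R * 'rV[R]_5)
    (fun y => phi (y.2 0 ir) (y.2 0 ith)) 0.
Proof.
move=> nr nth; apply/is_derive_line0.
have -> : (fun t : R => (fun y : R * 'rV[R]_5 => phi (y.2 0 ir) (y.2 0 ith))
    (t *: ((0, evec i) : R * 'rV[R]_5) + z)) = fun=> phi (r z) (z.2 0 ith).
  apply/funext => t /=; rewrite !mxE eqxx /= ![_ == i]eq_sym.
  by rewrite (negbTE nr) (negbTE nth) mulr0 !add0r.
exact: is_derive_cstf.
Qed.

Lemma pd_radial (phi : R -> R) i h z : i != ir -> smooth V h -> V z ->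
  pd i (fun y => phi (y.2 0 ir) * h y) z = phi (r z) * pd i h z.
Proof.
move=> ni sh Vz.
have H : is_derive z ((0, evec i) : R * 'rV[R]_5)
    (fun y => phi (y.2 0 ir)) 0.
  apply/is_derive_line0.
  have -> : (fun t : R => phi ((t *: ((0, evec i) : R * 'rV[R]_5) + z).2 0 ir))
      = fun=> phi (r z).
    apply/funext => t /=; rewrite !mxE eqxx /= eq_sym (negbTE ni).
    by rewrite mulr0 add0r.
  exact: is_derive_cstf.
apply: etrans (is_derive_val (is_derive_mul H (is_derive_pd i sh Vz))) _.
by rewrite mul0r add0r.
Qed.

Lemma angular_neq_r y : angular y -> y != ir.
Proof. by move: y; apply: angular_ind. Qed.

(* Abstracts the derivatives in a goal, which leaves a polynomial identity. *)
Ltac atoms :=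
  rewrite /bh_gamma /gamma_table /dgamma_table /=;
  repeat match goal with
  | |- context [pd ?i ?h ?z] => move: (pd i h z) => ?
  | |- context [pds ?h ?z] => move: (pds h z) => ?
  end.

(** A function with vanishing Hessian has a parallel differential, which the
    curvature annihilates. Concretely, Christoffel symbols with one lower index
    t and one angular lower index vanish, so differentiating the t-t equation
    [xi_tt = accel xi_r] along the orbits gives [xi_ry = 0]; then the r-y
    equations give [xi_y = 0], the theta-theta equation gives [xi_r = 0], and
    the t-r equation gives [xi_t = 0]. *)
Lemma pd_xi_eq0 i z : V z -> pd i x z = 0.
Proof.
have sp j : smooth V (pd j x) by exact/smooth_pd/sx.
have tx y z' : angular y -> V z' -> pd y (pd it x) z' = 0.
  move=> + Vz; move: y; apply: angular_ind; rewrite (cubic_eq _ _ Vz);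
    by atoms; ring.
have xr y z' : angular y -> V z' -> pd y (pd ir x) z' = 0.
  move=> Ay Vz; have [_ ac0 _ _ _] := radial_facts Vz.
  apply: (mulr_eq0l ac0).
  rewrite -(pd_radial (accel M q rinf) (angular_neq_r Ay) (sp ir) Vz).
  have -> : pd y (fun y => accel M q rinf (y.2 0 ir) * pd ir x y) z'
      = pd y (pd it (pd it x)) z'.
    apply: (eq_pd oV _ Vz) => y' Vy; rewrite (cubic_eq _ _ Vy).
    by atoms; ring.
  rewrite (pdC oV _ _ (sp it) Vz); apply: (pd_eq0 oV _ Vz) => y' Vy.
  exact: tx.
have ang y z' : angular y -> V z' -> pd y x z' = 0.
  move=> + Vz; have [_ _ _ _ [n10 n20 _ _ _]] := radial_facts Vz.
  have Hth : pd ith x z' = 0.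
    apply: (mulr_eq0l n10); rewrite -(@xr ith z' isT Vz) (cubic_eq _ _ Vz).
    by atoms; ring.
  have Hpsi : pd ipsi x z' = 0.
    apply: (mulr_eq0l n20); rewrite -(@xr ipsi z' isT Vz) (cubic_eq _ _ Vz).
    by atoms; ring.
  move: y; apply: angular_ind; [exact: Hth| |exact: Hpsi].
  apply: (mulr_eq0l n10); rewrite -(@xr iphi z' isT Vz) (cubic_eq _ _ Vz) Hpsi.
  by atoms; ring.
have rad z' : V z' -> pd ir x z' = 0.
  move=> Vz; have [_ _ p10 _ _] := radial_facts Vz.
  apply: (mulr_eq0l p10); have : pd ith (pd ith x) z' = 0.
    by apply: (pd_eq0 oV _ Vz) => y Vy; exact: ang.
  rewrite (cubic_eq _ _ Vz); atoms => H.
  by rewrite -[RHS]oppr0 -[in RHS]H; ring.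
have tim z' : V z' -> pd it x z' = 0.
  move=> Vz; have [al0 _ _ _ _] := radial_facts Vz.
  apply: (mulr_eq0l al0); have : pd it (pd ir x) z' = 0.
    by apply: (pd_eq0 oV _ Vz) => y Vy; exact: rad.
  by rewrite (cubic_eq _ _ Vz); atoms => H; rewrite -[RHS]H; ring.
by move=> Vz; elim/ord5_ind: i; [exact: tim | exact: rad | exact: ang ..].
Qed.

Lemma pd_pds_xi_eq0 i z : V z -> pd i (pds x) z = 0.
Proof.
move=> Vz; rewrite (pdsC oV _ sx Vz).
by apply: (pds_eq0 oV Vz) => y; exact: pd_xi_eq0.
Qed.

Let sw i : smooth V (pds (e i)). Proof. exact/smooth_pds/se. Qed.

(** The field [w = eta_s] satisfies [nabla w = c id], where [2 c = xi_ss] is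
    constant in x. Differentiating the t-t equation along the orbits makes
    [w^r] constant on them, and the r-y equations with the nondegenerate second
    fundamental form give [w^y = 0]. The theta-theta and psi-psi equations
    become [nu1 w^r = c = nu2 w^r], whence [w^r = c = 0], and the r-t equation
    gives [w^t = 0]. *)
Lemma pds_eq0_all z : V z ->
  (forall i, pds (e i) z = 0) /\ pds (pds x) z = 0.
Proof.
have tang y z' : angular y -> V z' -> pd y (pds (e it)) z' = 0.
  move=> + Vz; move: y; apply: angular_ind.
  - by have := lin_eq it ith Vz; atoms=> *; lra.
  - by have := lin_eq it iphi Vz; atoms=> *; lra.
  - by have := lin_eq it ipsi Vz; atoms=> *; lra.
have rang y z' : angular y -> V z' -> pd y (pds (e ir)) z' = 0.
  move=> Ay Vz; have [al0 _ _ _ _] := radial_facts Vz.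
  apply: (mulr_eq0l al0).
  rewrite -(pd_radial (alpha M q) (angular_neq_r Ay) (sw ir) Vz).
  have E y' : V y' -> alpha M q (y'.2 0 ir) * pds (e ir) y'
      = 2^-1 * pds (pds x) y' + (-1) * pd it (pds (e it)) y'.
    by move=> Vy; have := lin_eq it it Vy; atoms=> *; lra.
  apply: etrans (eq_pd oV _ Vz E) _.
  apply: etrans (pd_comb (is_derive_cstf _ _ _) (is_derive_cstf _ _ _)
    (smooth_pds (smooth_pds sx)) (smooth_pd it (sw it)) Vz) _.
  have Z1 : pd y (pds (pds x)) z' = 0.
    apply: etrans (pdsC oV _ (smooth_pds sx) Vz) _.
    by apply: (pds_eq0 oV Vz) => y' Vy; exact: pd_pds_xi_eq0.
  have Z2 : pd y (pd it (pds (e it))) z' = 0.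
    apply: etrans (pdC oV _ _ (sw it) Vz) _.
    by apply: (pd_eq0 oV _ Vz) => y' Vy; exact: tang.
  exact: comb_eq0 Z1 Z2.
have ang y z' : angular y -> V z' -> pds (e y) z' = 0.
  move=> + Vz; have [_ _ p10 p20 [_ _ _ s0 _]] := radial_facts Vz.
  have Hth : pds (e ith) z' = 0.
    apply: (mulr_eq0l p10); have := lin_eq ir ith Vz.
    by rewrite (@rang ith z' isT Vz); atoms=> *; lra.
  have [Hphi Hpsi] : pds (e iphi) z' = 0 /\ pds (e ipsi) z' = 0.
    apply: (@form_kernel (p1 z') (p2 z') (s z') (c z')) => //.
    - have := lin_eq ir iphi Vz.
      by rewrite (@rang iphi z' isT Vz); atoms=> *; lra.
    - have := lin_eq ir ipsi Vz.
      by rewrite (@rang ipsi z' isT Vz); atoms=> *; lra.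
  by move: y; apply: angular_ind; [exact: Hth|exact: Hphi|exact: Hpsi].
have rad z' : V z' -> pds (e ir) z' = 0 /\ pds (pds x) z' = 0.
  move=> Vz; have [_ _ _ _ [_ _ n120 _ _]] := radial_facts Vz.
  have H0 y : angular y -> pd y (pds (e y)) z' = 0.
    by move=> Ay; apply: (pd_eq0 oV _ Vz) => y' Vy; exact: ang.
  have := lin_eq ith ith Vz; have := lin_eq ipsi ipsi Vz.
  rewrite (H0 ith isT) (H0 ipsi isT) (@ang ith z' isT Vz).
  rewrite (@ang iphi z' isT Vz) (@ang ipsi z' isT Vz) => H1 H2.
  have Hr : pds (e ir) z' = 0.
    apply: (mulr_eq0l n120); move: H1 H2; atoms=> *; lra.
  by split=> //; move: H1; rewrite Hr; atoms=> *; lra.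
move=> Vz; split; last by have [] := rad z Vz.
elim/ord5_ind; [|by have [] := rad z Vz|exact: ang ..].
have [_ ac0 _ _ _] := radial_facts Vz.
apply: (mulr_eq0l ac0); have := lin_eq ir it Vz.
rewrite (@ang ith z isT Vz) (@ang iphi z isT Vz) (@ang ipsi z isT Vz).
have [-> _] := rad z Vz.
rewrite (pd_eq0 oV _ Vz) => [|y' Vy]; last by have [] := rad y' Vy.
by atoms=> *; lra.
Qed.

Lemma quad_eq0 i j k z : V z ->
  pd j (pd k (e i)) z
  + (e ir z * gamma_table ('D_1 (alpha M q) (r z)) ('D_1 (accel M q rinf) (r z))
       ('D_1 (rho M q rinf) (r z)) ('D_1 (nu1 rinf) (r z))
       ('D_1 nu2 (r z)) ('D_1 (pi1 M q rinf) (r z)) ('D_1 (pi2 M q rinf) (r z))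
       ('D_1 (kap M q rinf) (r z)) 0 (s z) (c z) i j k
     + e ith z * dgamma_table (n1 z) (n2 z) (p1 z) (p2 z) (ka z) (s z) (c z) i j k)
  - (pd it (e i) z * Gam z.2 it j k + pd ir (e i) z * Gam z.2 ir j k
     + pd ith (e i) z * Gam z.2 ith j k + pd iphi (e i) z * Gam z.2 iphi j k
     + pd ipsi (e i) z * Gam z.2 ipsi j k)
  + (Gam z.2 i it k * pd j (e it) z + Gam z.2 i ir k * pd j (e ir) z
     + Gam z.2 i ith k * pd j (e ith) z + Gam z.2 i iphi k * pd j (e iphi) z
     + Gam z.2 i ipsi k * pd j (e ipsi) z)
  + (Gam z.2 i j it * pd k (e it) z + Gam z.2 i j ir * pd k (e ir) z
     + Gam z.2 i j ith * pd k (e ith) z + Gam z.2 i j iphi * pd k (e iphi) z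
     + Gam z.2 i j ipsi * pd k (e ipsi) z) = 0.
Proof.
move=> Vz; apply: etrans (quad_eq i j k Vz) _.
exact: comb_eq0 (pd_pds_xi_eq0 k Vz) (pd_pds_xi_eq0 j Vz).
Qed.

(* Abstracts the components of the field and the radial derivatives as well. *)
Ltac atoms0 :=
  atoms;
  repeat match goal with
  | |- context [eta ?Y ?i ?z] => move: (eta Y i z) => ?
  | |- context ['D_?v ?F ?z] => move: ('D_v F z) => ?
  end;
  repeat match goal with H : _ = _ :> _ |- _ => clear H end.

Let spd i j : smooth V (pd i (e j)). Proof. exact/smooth_pd/se. Qed.

(** The next lemmas say that the affine field [eta] preserves the curvature
    operator [R(., d_t) d_t], which on the orbits is [accel] times the matrix
    [Gam^y_rx] with eigenvalues [nu1], [nu1] and [nu2]: its Lie derivative is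
    the integrability condition of the t-t equation [eta^y_tt = accel eta^y_r]
    with the t-x equations. *)
Lemma tt_eq y z : angular y -> V z ->
  pd it (pd it (e y)) z = ac z * pd ir (e y) z.
Proof.
move=> + Vz; move: y; apply: angular_ind.
- by have := quad_eq0 ith it it Vz; atoms0=> *; lra.
- by have := quad_eq0 iphi it it Vz; atoms0=> *; lra.
- by have := quad_eq0 ipsi it it Vz; atoms0=> *; lra.
Qed.

Lemma ttx_eq y y' z : angular y -> angular y' -> V z ->
  pd it (pd it (pd y (e y'))) z = ac z * pd y (pd ir (e y')) z.
Proof.
move=> Ay Ay' Vz.
apply: etrans (eq_pd oV it Vz (fun w Vw => pdC oV it y (se y') Vw)) _.
apply: etrans (pdC oV it y (spd it y') Vz) _.
apply: etrans (eq_pd oV y Vz (fun w Vw => tt_eq Ay' Vw)) _.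
exact: pd_radial (angular_neq_r Ay) (spd ir y') Vz.
Qed.

Lemma pd_t_coef (phi1 phi2 : R -> R -> R) h1 h2 z :
  smooth V h1 -> smooth V h2 -> V z ->
  pd it (fun y => phi1 (y.2 0 ir) (y.2 0 ith) * h1 y
                + phi2 (y.2 0 ir) (y.2 0 ith) * h2 y) z
  = phi1 (r z) (z.2 0 ith) * pd it h1 z + phi2 (r z) (z.2 0 ith) * pd it h2 z.
Proof.
move=> s1 s2 Vz; apply: (@pd_comb it (fun y => phi1 (y.2 0 ir) (y.2 0 ith))
  (fun y => phi2 (y.2 0 ir) (y.2 0 ith))) => //.
- exact: is_derive_coef.
- exact: is_derive_coef.
Qed.

(** The off-diagonal phi-psi component of this invariance: it is multiplied by
    the difference of the eigenvalues. *)
Lemma lie_N_phi_psi z : V z -> pd ipsi (e iphi) z = 0.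
Proof.
move=> Vz; have [_ ac0 _ _ [_ _ n120 s0 _]] := radial_facts Vz.
have E w : V w -> pd it (pd ipsi (e iphi)) w =
    kap M q rinf (w.2 0 ir) / 2 / sin (w.2 0 ith) * pd it (e ith) w
    + 0 * pd it (e ith) w.
  by move=> Vw; have := quad_eq0 iphi it ipsi Vw; atoms0=> *; lra.
have := eq_pd oV it Vz E.
rewrite (pd_t_coef (fun a b => kap M q rinf a / 2 / sin b) (fun=> fun=> 0)
  (spd it ith) (spd it ith) Vz).
rewrite (@ttx_eq ipsi iphi) // (@tt_eq ith) // => E1.
have {}E1 : pd ipsi (pd ir (e iphi)) z = ka z / 2 / s z * pd ir (e ith) z.
  by apply: (mulfI ac0); rewrite E1; ring.
apply: (mulr_eq0l n120); have := quad_eq0 iphi ipsi ir Vz; rewrite E1.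
by atoms0=> *; lra.
Qed.

(** The diagonal components of this invariance: along [eta] the eigenvalues
    [accel nu1] and [accel nu2] change at the same rate [- 2 eta^t_t]. *)
Lemma lie_N_diag z : V z ->
  ac z * 'D_1 (nu1 rinf) (r z) * e ir z + n1 z *
    ('D_1 (accel M q rinf) (r z) * e ir z + 2 * ac z * pd it (e it) z) = 0 /\
  ac z * 'D_1 nu2 (r z) * e ir z + n2 z *
    ('D_1 (accel M q rinf) (r z) * e ir z + 2 * ac z * pd it (e it) z) = 0.
Proof.
move=> Vz; have tr : pd it (pd it (e ir)) z =
    - 'D_1 (accel M q rinf) (r z) * e ir z + ac z * pd ir (e ir) z
    - 2 * ac z * pd it (e it) z.
  by have := quad_eq0 ir it it Vz; atoms0=> *; lra.
split.
- have E w : V w -> pd it (pd ith (e ith)) w =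
      - nu1 rinf (w.2 0 ir) * pd it (e ir) w + 0 * pd it (e ir) w.
    by move=> Vw; have := quad_eq0 ith it ith Vw; atoms0=> *; lra.
  have := eq_pd oV it Vz E.
  rewrite (pd_t_coef (fun a _ => - nu1 rinf a) (fun=> fun=> 0)
    (spd it ir) (spd it ir) Vz).
  rewrite (@ttx_eq ith ith) // tr.
  have -> : pd ith (pd ir (e ith)) z = - 'D_1 (nu1 rinf) (r z) * e ir z
      - n1 z * pd ir (e ir) z.
    by have := quad_eq0 ith ith ir Vz; atoms0=> *; lra.
  by atoms0=> *; lra.
- have E w : V w -> pd it (pd ipsi (e ipsi)) w =
      - nu2 (w.2 0 ir) * pd it (e ir) w
      + - (kap M q rinf (w.2 0 ir) / 2 * cos (w.2 0 ith) / sin (w.2 0 ith))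
        * pd it (e ith) w.
    by move=> Vw; have := quad_eq0 ipsi it ipsi Vw; atoms0=> *; lra.
  have := eq_pd oV it Vz E.
  rewrite (pd_t_coef (fun a _ => - nu2 a)
    (fun a b => - (kap M q rinf a / 2 * cos b / sin b))
    (spd it ir) (spd it ith) Vz).
  rewrite (@ttx_eq ipsi ipsi) // tr (@tt_eq ith) //.
  have -> : pd ipsi (pd ir (e ipsi)) z = - 'D_1 nu2 (r z) * e ir z
      - n2 z * pd ir (e ir) z
      - ka z / 2 * c z / s z * pd ir (e ith) z.
    have := quad_eq0 ipsi ipsi ir Vz; rewrite (lie_N_phi_psi Vz).
    by atoms0=> *; lra.
  by atoms0=> *; lra.
Qed.

(** The quotient of the two eigenvalues is preserved by [eta], and it has no
    critical point. *)
Lemma eta_r_eq0 z : V z -> e ir z = 0.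
Proof.
move=> Vz; have [_ ac0 _ _ [_ _ _ _ [_ wr0]]] := radial_facts Vz.
have [H1 H2] := lie_N_diag Vz.
apply: (@mulr_eq0l (ac z * ('D_1 (nu1 rinf) (r z) * n2 z
                     - n1 z * 'D_1 nu2 (r z)))); first by rewrite mulf_neq0.
by apply: etrans (comb_eq0 (n2 z) (- n1 z) H1 H2); ring.
Qed.

Lemma pd_eta_r z i : V z -> pd i (e ir) z = 0.
Proof. by move=> Vz; apply: (pd_eq0 oV _ Vz); exact: eta_r_eq0. Qed.

Lemma pdpd_eta_r z i j : V z -> pd i (pd j (e ir)) z = 0.
Proof. by move=> Vz; apply: (pd_eq0 oV _ Vz) => y; exact: pd_eta_r. Qed.

Lemma pd_t_eta_t z : V z -> pd it (e it) z = 0.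
Proof.
move=> Vz; have [_ ac0 _ _ [_ n20 _ _ _]] := radial_facts Vz.
have [_] := lie_N_diag Vz; rewrite (eta_r_eq0 Vz) => H.
apply: (@mulr_eq0l (n2 z * (2 * ac z))); last by rewrite -H; ring.
by apply: mulf_neq0 => //; apply: mulf_neq0 => //; rewrite pnatr_eq0.
Qed.

Lemma pd_r_eta_t z : V z -> pd ir (e it) z = 0.
Proof.
move=> Vz; have [_ ac0 _ _ _] := radial_facts Vz; apply: (mulr_eq0l ac0).
have := quad_eq0 ir it ir Vz.
rewrite (eta_r_eq0 Vz) (pdpd_eta_r _ _ Vz) !(pd_eta_r _ Vz).
by atoms0=> *; lra.
Qed.

Lemma pd_r_eta y z : angular y -> V z -> pd ir (e y) z = 0.
Proof.
move=> Ay Vz; have [_ _ p10 p20 [_ _ _ s0 _]] := radial_facts Vz.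
have Q k := quad_eq0 ir ir k Vz.
have [H1 H2] : pd ir (e iphi) z = 0 /\ pd ir (e ipsi) z = 0.
  apply: (@form_kernel (p1 z) (p2 z) (s z) (c z)) => //.
  - have := Q iphi; rewrite (eta_r_eq0 Vz) (pdpd_eta_r _ _ Vz) !(pd_eta_r _ Vz).
    by atoms0=> *; lra.
  - have := Q ipsi; rewrite (eta_r_eq0 Vz) (pdpd_eta_r _ _ Vz) !(pd_eta_r _ Vz).
    by atoms0=> *; lra.
move: y Ay; apply: angular_ind; [|exact: H1|exact: H2].
apply: (mulr_eq0l p10); have := Q ith.
rewrite (eta_r_eq0 Vz) (pdpd_eta_r _ _ Vz) !(pd_eta_r _ Vz).
by atoms0=> *; lra.
Qed.

(** Only [kap] depends on r in this equation, so differentiating it along r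
    leaves [kap' w = 0]. *)
Lemma kap_separates (phi : R -> R) u w z : smooth V w -> V z ->
  phi (z.2 0 ith) != 0 ->
  (forall y, V y -> pd ir u y = 0) -> (forall y, V y -> pd ir w y = 0) ->
  (forall y, V y -> u y = phi (y.2 0 ith) * (ka y * w y)) -> w z = 0.
Proof.
move=> smw Vz phi0 u0 w0 E; have [r0 d0 k0 _ _] := chart_facts hrinf f_rinf (V_chart Vz).
have [_ _ _ _ [_ _ _ _ [dk0 _]]] := radial_facts Vz.
have [_ _ f0] := V_chart Vz.
have [_ _ _ _ [_ _ _ dka]] := derivable_radial r0 d0 f0 k0.
have Hphi : is_derive z ((0, evec ir) : R * 'rV[R]_5)
    (fun y => phi (y.2 0 ith)) 0.
  apply/is_derive_line0.
  have -> : (fun t : R => phi ((t *: ((0, evec ir) : R * 'rV[R]_5) + z).2 0 ith))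
      = fun=> phi (z.2 0 ith).
    by apply/funext => t /=; rewrite !mxE /= mulr0 add0r.
  exact: is_derive_cstf.
have Hk : is_derive z ((0, evec ir) : R * 'rV[R]_5) (fun y => ka y)
    ('D_1 (kap M q rinf) (r z)).
  apply: is_derive_eq (is_derive_comp (derivableP dka) (is_derive_coord2 ir z _)) _.
  by rewrite /= evecE eqxx mulr1.
have := eq_pd oV ir Vz E; rewrite (u0 z Vz).
rewrite (pd_val (is_derive_mul Hphi (is_derive_mul Hk (is_derive_pd ir smw Vz)))).
rewrite (w0 z Vz) mulr0 addr0 mul0r add0r => /esym/(mulr_eq0l phi0).
exact: mulr_eq0l.
Qed.

(** The t-x equations say that the tangent field [eta_t] of the orbits is
    parallel for the connections of all their metrics, which change with
    [kap]. *)
Lemma pd_t_eta y z : angular y -> V z -> pd it (e y) z = 0.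
Proof.
have rw y' z' : angular y' -> V z' -> pd ir (pd it (e y')) z' = 0.
  move=> Ay Vz; apply: etrans (pdC oV _ _ (se y') Vz) _.
  by apply: (pd_eq0 oV _ Vz) => w; exact: pd_r_eta.
have ru y1 y' z' : angular y' -> V z' -> pd ir (pd it (pd y1 (e y'))) z' = 0.
  move=> Ay Vz; apply: etrans (pdC oV _ _ (spd y1 y') Vz) _.
  apply: (pd_eq0 oV _ Vz) => w Vw; apply: etrans (pdC oV _ _ (se y') Vw) _.
  by apply: (pd_eq0 oV _ Vw) => w'; exact: pd_r_eta.
have Hphi z' : V z' -> pd it (e iphi) z' = 0.
  move=> Vz; have [_ _ _ _ [_ _ _ s0 _]] := radial_facts Vz.
  apply: (@kap_separates (fun b => - (sin b / 2)) (pd it (pd ipsi (e ith))) _ _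
    (spd _ _) Vz) => [|w Vw|w Vw|w Vw].
  - by rewrite oppr_eq0 mulf_neq0 // invr_neq0 // pnatr_eq0.
  - exact: ru.
  - exact: rw.
  - have := quad_eq0 ith it ipsi Vw; rewrite (eta_r_eq0 Vw) !(pd_eta_r _ Vw).
    by atoms0=> *; lra.
have Hpsi z' : V z' -> pd it (e ipsi) z' = 0.
  move=> Vz; have [_ _ _ _ [_ _ _ s0 _]] := radial_facts Vz.
  apply: (@kap_separates (fun b => - (sin b / 2)) (pd it (pd iphi (e ith))) _ _
    (spd _ _) Vz) => [|w Vw|w Vw|w Vw].
  - by rewrite oppr_eq0 mulf_neq0 // invr_neq0 // pnatr_eq0.
  - exact: ru.
  - exact: rw.
  - have := quad_eq0 ith it iphi Vw; rewrite (eta_r_eq0 Vw) !(pd_eta_r _ Vw).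
    by rewrite (Hphi w Vw); atoms0=> *; lra.
move=> + Vz; move: y; apply: angular_ind; [|exact: Hphi|exact: Hpsi].
have [_ _ _ _ [_ _ _ s0 _]] := radial_facts Vz.
apply: (@kap_separates (fun b => 1 / 2 / sin b) (pd it (pd ipsi (e iphi))) _ _
  (spd _ _) Vz) => [|w Vw|w Vw|w Vw].
- by rewrite !(mulf_neq0, invr_neq0) ?oner_eq0 // pnatr_eq0.
- exact: ru.
- exact: rw.
- have := quad_eq0 iphi it ipsi Vw; rewrite (eta_r_eq0 Vw) !(pd_eta_r _ Vw).
  by atoms0=> *; lra.
Qed.

Lemma pd_eta_t i z : V z -> pd i (e it) z = 0.
Proof.
move=> Vz; elim/ord5_ind: i; [exact: pd_t_eta_t|exact: pd_r_eta_t|..].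
all: have [_ ac0 _ _ _] := radial_facts Vz; apply: (mulr_eq0l ac0).
all: have Q k := quad_eq0 ir it k Vz.
all: have T y (Ay : angular y) := pd_t_eta Ay Vz.
- have := Q ith; rewrite (eta_r_eq0 Vz) (pdpd_eta_r _ _ Vz) !(pd_eta_r _ Vz).
  by rewrite (T ith isT) (T iphi isT) (T ipsi isT); atoms0=> *; lra.
- have := Q iphi; rewrite (eta_r_eq0 Vz) (pdpd_eta_r _ _ Vz) !(pd_eta_r _ Vz).
  by rewrite (T ith isT) (T iphi isT) (T ipsi isT); atoms0=> *; lra.
- have := Q ipsi; rewrite (eta_r_eq0 Vz) (pdpd_eta_r _ _ Vz) !(pd_eta_r _ Vz).
  by rewrite (T ith isT) (T iphi isT) (T ipsi isT); atoms0=> *; lra.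
Qed.

(** By now [eta] is tangent to the orbits and independent of t and r. It
    preserves their second fundamental form and their shape operator
    [Gam^y_rx], which has distinct eigenvalues, hence the round metric of the
    sphere and the square of the connection form [dpsi + cos theta dphi]
    separately: these are the Killing equations of the sphere, and what they
    imply for the psi component. *)
Lemma orbit_eqs z : V z ->
  [/\ pd ith (e ith) z = 0, pd ipsi (e ith) z = 0,
     pd iphi (pd iphi (e ith)) z = - e ith z &
   [/\ pd ith (e iphi) z = - (pd iphi (e ith) z / s z ^+ 2),
     pd iphi (e iphi) z = - (c z / s z * e ith z) , pd ipsi (e iphi) z = 0 &
   [/\ pd ith (e ipsi) z = c z / s z ^+ 2 * pd iphi (e ith) z,
     pd iphi (e ipsi) z = e ith z / s z & pd ipsi (e ipsi) z = 0]]].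
Proof.
move=> Vz; have [_ _ p10 p20 [_ _ n120 s0 _]] := radial_facts Vz.
have sc : c z ^+ 2 = 1 - s z ^+ 2 by exact: cos2sin2.
have Phpsi := lie_N_phi_psi Vz.
have T y (Ay : angular y) := pd_r_eta Ay Vz.
have Thth : pd ith (e ith) z = 0.
  apply: (mulr_eq0l p10); have := quad_eq0 ir ith ith Vz.
  rewrite (eta_r_eq0 Vz) (pdpd_eta_r _ _ Vz) !(pd_eta_r _ Vz).
  by atoms0=> *; lra.
have Thpsi : pd ipsi (e ith) z = 0.
  apply: (mulr_eq0l n120); have := quad_eq0 ith ipsi ir Vz.
  rewrite (eta_r_eq0 Vz) !(pd_eta_r _ Vz) (pd_r_eta_t Vz).
  rewrite (T ith isT) (T iphi isT) (T ipsi isT).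
  rewrite (pd_eq0 oV ipsi Vz (fun y => @pd_r_eta ith y isT)).
  by atoms0=> *; lra.
have Psth : pd ith (e ipsi) z = - (c z * pd ith (e iphi) z).
  apply: (mulfI p20); have := quad_eq0 ir ith ipsi Vz.
  rewrite (eta_r_eq0 Vz) (pdpd_eta_r _ _ Vz) !(pd_eta_r _ Vz) Thpsi.
  by atoms0=> *; lra.
have Pspsi : pd ipsi (e ipsi) z = 0.
  apply: (mulr_eq0l p20); have := quad_eq0 ir ipsi ipsi Vz.
  rewrite (eta_r_eq0 Vz) (pdpd_eta_r _ _ Vz) !(pd_eta_r _ Vz) Phpsi.
  by atoms0=> *; lra.
have Psph : pd iphi (e ipsi) z = s z * e ith z - c z * pd iphi (e iphi) z.
  apply: (mulfI p20); have := quad_eq0 ir iphi ipsi Vz.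
  rewrite (eta_r_eq0 Vz) (pdpd_eta_r _ _ Vz) !(pd_eta_r _ Vz) Phpsi Pspsi.
  by atoms0=> *; lra.
have Phth : pd ith (e iphi) z = - (pd iphi (e ith) z / s z ^+ 2).
  apply: (mulfI p10); apply: (mulIf (expf_neq0 2 s0)).
  transitivity (- (p1 z * pd iphi (e ith) z)); last by field.
  have := quad_eq0 ir ith iphi Vz.
  rewrite (eta_r_eq0 Vz) (pdpd_eta_r _ _ Vz) !(pd_eta_r _ Vz) Psth.
  by atoms0=> *; lra.
have Phph : pd iphi (e iphi) z = - (c z / s z * e ith z).
  apply: (mulfI p10); apply: (mulIf (expf_neq0 2 s0)).
  transitivity (- (p1 z * c z * s z * e ith z)); last by field.
  have := quad_eq0 ir iphi iphi Vz.
  rewrite (eta_r_eq0 Vz) (pdpd_eta_r _ _ Vz) !(pd_eta_r _ Vz) Psph.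
  by atoms0=> *; lra.
have {}Psph : pd iphi (e ipsi) z = e ith z / s z.
  rewrite Psph Phph; move: (e ith z) (s z) (c z) s0 sc => T0 S C S0 SC.
  by field: SC.
have {}Psth : pd ith (e ipsi) z = c z / s z ^+ 2 * pd iphi (e ith) z.
  rewrite Psth Phth; move: (pd iphi (e ith) z) (s z) (c z) s0 => T0 S C S0.
  by field.
split=> //.
have := quad_eq0 ith iphi iphi Vz.
rewrite (eta_r_eq0 Vz) !(pd_eta_r _ Vz) (T ith isT) Thth Thpsi Psph Phph.
rewrite /bh_gamma /gamma_table /dgamma_table /= => H.
apply/eqP; rewrite -addr_eq0; apply/eqP; apply: etrans H.
move: (pd iphi (pd iphi (e ith)) z) (pd iphi (e ith) z) (pd it _ z).
move: (e ith z) (s z) (c z) (ka z) s0 sc => T0 S C K S0 SC u v w.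
by field: SC.
Qed.

End Solve.

#[local] Transparent pd pds.

(** * First integrals and the classification of the symmetries *)

Section FirstIntegrals.
Context {R : realType}.
Implicit Types (z w : R * 'rV[R]_5) (T S P : R * 'rV[R]_5 -> R).

(** The coefficients of a solution as functions of its components and their
    derivatives, with [T] for the theta component, [S] for its phi derivative
    and [P] for the phi or psi component. *)
Definition int_xi T : R * 'rV[R]_5 -> R := fun y => T y - y.1 * pds T y.
Definition int_sin T S : R * 'rV[R]_5 -> R := fun y =>
  sin (y.2 0 iphi) * T y + cos (y.2 0 iphi) * S y.
Definition int_cos T S : R * 'rV[R]_5 -> R := fun y =>
  cos (y.2 0 iphi) * T y - sin (y.2 0 iphi) * S y.
Definition int_phi S P : R * 'rV[R]_5 -> R := fun y =>
  P y - cos (y.2 0 ith) / sin (y.2 0 ith) * S y.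
Definition int_psi S P : R * 'rV[R]_5 -> R := fun y =>
  P y + S y / sin (y.2 0 ith).

Lemma is_derive_int_sin T S z w dT dS :
  is_derive z w T dT -> is_derive z w S dS ->
  is_derive z w (int_sin T S)
    (w.2 0 iphi * int_cos T S z + sin (z.2 0 iphi) * dT + cos (z.2 0 iphi) * dS).
Proof.
move=> H H'; have Hp := is_derive_coord2 iphi z w.
by rewrite /int_sin; eapply is_derive_eq; [der | rewrite /int_cos /=; ring].
Qed.

Lemma is_derive_int_cos T S z w dT dS :
  is_derive z w T dT -> is_derive z w S dS ->
  is_derive z w (int_cos T S)
    (- w.2 0 iphi * int_sin T S z + cos (z.2 0 iphi) * dT - sin (z.2 0 iphi) * dS).
Proof.
move=> H H'; have Hp := is_derive_coord2 iphi z w.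
by rewrite /int_cos; eapply is_derive_eq; [der | rewrite /int_sin /=; ring].
Qed.

Lemma is_derive_int_phi S P z w dS dP : sin (z.2 0 ith) != 0 ->
  is_derive z w S dS -> is_derive z w P dP ->
  is_derive z w (int_phi S P)
    (dP + w.2 0 ith * S z / sin (z.2 0 ith) ^+ 2
     - cos (z.2 0 ith) / sin (z.2 0 ith) * dS).
Proof.
move=> s0 H H'; have Hp := is_derive_coord2 ith z w.
have sc : cos (z.2 0 ith) ^+ 2 = 1 - sin (z.2 0 ith) ^+ 2 by exact: cos2sin2.
by rewrite /int_phi; eapply is_derive_eq; [der | rewrite /=; field: sc].
Qed.

Lemma is_derive_int_psi S P z w dS dP : sin (z.2 0 ith) != 0 ->
  is_derive z w S dS -> is_derive z w P dP ->
  is_derive z w (int_psi S P)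
    (dP + dS / sin (z.2 0 ith)
     - w.2 0 ith * S z * cos (z.2 0 ith) / sin (z.2 0 ith) ^+ 2).
Proof.
move=> s0 H H'; have Hp := is_derive_coord2 ith z w.
by rewrite /int_psi; eapply is_derive_eq; [der | rewrite /=; field].
Qed.

Lemma is_derive_int_xi T z w dT dS :
  is_derive z w T dT -> is_derive z w (pds T) dS ->
  is_derive z w (int_xi T) (dT - w.1 * pds T z - z.1 * dS).
Proof.
move=> H H'; have Hp : is_derive z w (fun y : R * 'rV[R]_5 => y.1) w.1.
  by apply: (@is_derive_fst _ _ _ _ id); exact: is_derive_id.
by rewrite /int_xi; eapply is_derive_eq; [der | rewrite /=; ring].
Qed.

End FirstIntegrals.

Section Gradient.
Context {R : realType} {n : nat}.
Variable U : set (R * 'rV[R]_n).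
Hypothesis oU : open U.
Hypothesis cU : connected U.

Lemma is_derive_scalv (h : R * 'rV[R]_n -> R) z v (a : R) :
  is_derive z v h 0 -> is_derive z (a *: v) h 0.
Proof.
move=> H; apply/is_derive_line0.
have Hl : is_derive (0 : R) 1 (fun t : R => h (t *: v + z)) 0.
  exact: (proj1 (is_derive_line0 h z v 0)).
have Ht : is_derive (0 : R) 1 (fun t : R => t * a) a.
  apply: is_derive_eq (is_derive_mul (is_derive_id _ _) (is_derive_cstf a _ _)) _.
  by rewrite mul1r mulr0 addr0.
have Hl' : is_derive (0 * a : R) 1 (fun t : R => h (t *: v + z)) 0.
  by rewrite mul0r.
have := @is_derive_comp R R (fun t : R => h (t *: v + z)) (fun t : R => t * a)
  (0 : R) (1 : R) 0 a Hl' Ht.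
rewrite mul0r.
set F := (X in is_derive _ _ X _); set G := (X in _ -> is_derive _ _ X _).
suff -> : F = G by [].
by apply/funext => t; rewrite /F /G scalerA.
Qed.

Lemma gradient0_constant (h : R * 'rV[R]_n -> R) : U !=set0 -> smooth U h ->
  (forall z, U z -> pds h z = 0) -> (forall i z, U z -> pd i h z = 0) ->
  exists a, forall z, U z -> h z = a.
Proof.
move=> [z0 Uz0] sh h0 hi; exists (h z0) => z Uz.
apply: (derive0_constant oU cU _ Uz Uz0) => {Uz}z v Uz.
suff D0 : 'D_v h z = 0 by rewrite -D0; exact: smooth_is_derive sh Uz.
have add u w : 'D_u h z = 0 -> 'D_w h z = 0 -> 'D_(u + w) h z = 0.
  by move=> Du Dw; rewrite (derive_addv _ _ oU (sh 1%N) Uz) Du Dw addr0.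
have scal a w : 'D_w h z = 0 -> 'D_(a *: w) h z = 0.
  move=> Dw; apply: is_derive_val; apply: is_derive_scalv.
  by rewrite -Dw; exact: smooth_is_derive sh Uz.
rewrite (@vfieldE R n (fun=> v) z); apply: (add); first exact/scal/h0.
elim/big_rec: _ => [|i w _ IH]; first exact: derive0.
by apply: (add) => //; apply/scal/hi.
Qed.

End Gradient.

Section Classification.
Context {R : realType}.
Variables M q rinf : R.
Hypothesis hq : q != 0.
Hypothesis hrinf : 0 < rinf.
Hypothesis f_rinf : bh_f M q rinf != 0.
Variable U : set (R * 'rV[R]_5).
Hypothesis oU : open U.
Hypothesis cU : connected U.
Hypothesis U0 : U !=set0.
Hypothesis U_chart : forall z, U z -> chart M q rinf z.2.

(** The points where [f'] does not vanish, see [bh_f'E]. *)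
Definition generic : set (R * 'rV[R]_5) :=
  [set z | U z /\ M * z.2 0 ir ^+ 2 - q ^+ 2 != 0].
Local Notation V := generic.

Lemma bh_f'E (r : R) : r != 0 ->
  bh_f' M q r = 4 * (M * r ^+ 2 - q ^+ 2) / r ^+ 5.
Proof. by move=> r0; rewrite /bh_f'; field. Qed.

Lemma generic_f' z : V z -> bh_f' M q (z.2 0 ir) != 0.
Proof.
move=> [Uz r0]; have [rn0 _ _ _ _] := chart_facts hrinf f_rinf (U_chart Uz).
by rewrite bh_f'E // !(mulf_neq0, invr_neq0, expf_neq0) // pnatr_eq0.
Qed.

Lemma open_generic : open V.
Proof.
rewrite openE => z [Uz r0].
have Cs : Cm 0 U (fun y : R * 'rV[R]_5 => M * y.2 0 ir ^+ 2 + - q ^+ 2).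
  have Cr := Cm_coord oU 0 ir.
  have C1 : Cm 0 U (fun y : R * 'rV[R]_5 => M : R) by exact: Cm_cst.
  have C2 : Cm 0 U (fun y : R * 'rV[R]_5 => - q ^+ 2 : R) by exact: Cm_cst.
  exact: Cm_add oU (Cm_mul oU C1 (Cm_mul oU Cr Cr)) C2.
have c : {for z, continuous (fun y : R * 'rV[R]_5 => M * y.2 0 ir ^+ 2 + - q ^+ 2)}.
  by have [+ _] := Cs; exact.
have N1 : nbhs z U by apply: open_nbhs_nbhs.
exact: filterI N1 (cvgr_neq0 _ c r0).
Qed.

(** [f'] vanishes exactly where [M r^2 = q^2], and since [q <> 0] any
    displacement along r leaves this hypersurface. *)
Lemma generic_dense (F : R * 'rV[R]_5 -> R) : smooth U F ->
  (forall z, V z -> F z = 0) -> forall z, U z -> F z = 0.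
Proof.
move=> sF F0 z Uz; have [E|r0] := eqVneq (M * z.2 0 ir ^+ 2) (q ^+ 2); last first.
  by apply: F0; split=> //; rewrite subr_eq0.
have [_ _ _ _ rpos] := chart_facts hrinf f_rinf (U_chart Uz).
have q2 : 0 < q ^+ 2 by rewrite exprn_even_gt0.
have M0 : 0 < M by move: q2; rewrite -E pmulr_lgt0 // exprn_gt0.
apply/eqP/negP => /negP Fz.
have N1 : nbhs z (U `&` [set y | F y != 0]).
  apply: filterI; first by apply: open_nbhs_nbhs.
  exact: cvgr_neq0 (smooth_continuous sF Uz) Fz.
have [d d0 Hd] := small_parallelogram ((0, evec ir) : R * 'rV[R]_5) 0 N1.
have dd : 0 <= d <= d by rewrite ltW /=.
have [] := Hd d d dd dd; rewrite scaler0 add0r; set y := _ + z => Uy /=.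
rewrite F0 ?eqxx //; split=> //.
have -> : y.2 0 ir = z.2 0 ir + d by rewrite /y /= !mxE /= mulr1 addrC.
rewrite subr_eq0 -E gt_eqF // ltr_pM2l //.
by rewrite ltr_pXn2r ?nnegrE ?ltW ?addr_gt0 // ltrDl.
Qed.

Variable X : vfield R 5.
Hypothesis sX : smooth U X.
Hypothesis detX : forall z, U z -> determining (bh_metric M q rinf) X z.

(** This passes over the hypersurface [f' = 0], whose complement in [U] may be
    disconnected: the gradient vanishes on [U] by density, and [U] is
    connected. *)
Lemma constant_of_generic (h : R * 'rV[R]_5 -> R) : smooth U h ->
  (forall z, V z -> pds h z = 0) -> (forall i z, V z -> pd i h z = 0) ->
  exists a, forall z, U z -> h z = a.
Proof.
move=> sh h0 hi; apply: (gradient0_constant oU cU U0 sh).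
  exact: generic_dense (smooth_pds sh) h0.
by move=> i; exact: generic_dense (smooth_pd i sh) (hi i).
Qed.

Let VU : V `<=` U. Proof. by move=> z []. Qed.
Let smV (W : normedModType R) (F : R * 'rV[R]_5 -> W) : smooth U F -> smooth V F.
Proof. by move=> sF m; exact: Cm_subset VU (sF m). Qed.
Let V_chart z : V z -> chart M q rinf z.2. Proof. by move=> /VU /U_chart. Qed.
Let V_det z : V z -> determining (bh_metric M q rinf) X z.
Proof. by move=> /VU /detX. Qed.

Let pdsE := pds_eq0_all hrinf f_rinf open_generic V_chart generic_f' (smV sX) V_det.
Let pd_x := pd_xi_eq0 hrinf f_rinf open_generic V_chart generic_f' (smV sX) V_det.

Let pd_pds_x :=
  pd_pds_xi_eq0 hrinf f_rinf open_generic V_chart generic_f' (smV sX) V_det.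
Let er0 := eta_r_eq0 hrinf f_rinf open_generic V_chart generic_f' (smV sX) V_det.
Let pd_et := pd_eta_t hrinf f_rinf open_generic V_chart generic_f' (smV sX) V_det.
Let pt_e := pd_t_eta hrinf f_rinf open_generic V_chart generic_f' (smV sX) V_det.
Let pr_e := pd_r_eta hrinf f_rinf open_generic V_chart generic_f' (smV sX) V_det.
Let orb := orbit_eqs hrinf f_rinf open_generic V_chart generic_f' (smV sX) V_det.

Local Notation Th := (eta X ith).
Local Notation Th' := (pd iphi (eta X ith)).
Let s_e i : smooth U (eta X i). Proof. exact: smooth_eta. Qed.
Let s_x : smooth U (xi X). Proof. exact: smooth_xi. Qed.
Let s_Th' : smooth U Th'. Proof. exact/smooth_pd/s_e. Qed.

Lemma pd_Th i z : V z -> pd i Th z = (iphi == i)%:R * Th' z.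
Proof.
move=> Vz; have [H1 H2 _ _] := orb Vz.
elim/ord5_ind: i; rewrite /= ?mul0r ?mul1r.
- exact: pt_e.
- exact: pr_e.
- exact: H1.
- exact: erefl.
- exact: H2.
Qed.

Lemma pd_Th' i z : V z -> pd i Th' z = - ((iphi == i)%:R * Th z).
Proof.
move=> Vz; have [_ _ H _] := orb Vz.
have comm j : j != iphi -> pd j Th' z = 0.
  move=> nj; apply: etrans (pdC open_generic _ _ (smV (s_e ith)) Vz) _.
  apply: (pd_eq0 open_generic _ Vz) => y Vy.
  by rewrite (pd_Th _ Vy) eq_sym (negbTE nj) mul0r.
elim/ord5_ind: i; rewrite /= ?mul0r ?oppr0 ?mul1r; by [exact: comm|exact: H].
Qed.

Lemma pds_e i z : V z -> pds (eta X i) z = 0.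
Proof. by move=> /pdsE[]. Qed.

Lemma pds_Th' z : V z -> pds Th' z = 0.
Proof.
move=> Vz; apply: etrans (esym (pdsC open_generic _ (smV (s_e ith)) Vz)) _.
by apply: (pd_eq0 open_generic _ Vz) => y; exact: pds_e.
Qed.

Let isd i (h : R * 'rV[R]_5 -> R) z : smooth U h -> V z ->
  is_derive z ((0, evec i) : R * 'rV[R]_5) h (pd i h z).
Proof. by move=> sh Vz; exact: is_derive_pd sh (VU Vz). Qed.
Let isds (h : R * 'rV[R]_5 -> R) z : smooth U h -> V z ->
  is_derive z ((1, 0) : R * 'rV[R]_5) h (pds h z).
Proof. by move=> sh Vz; exact: is_derive_pds sh (VU Vz). Qed.

Let s0 z : U z -> sin (z.2 0 ith) != 0. Proof. by case/U_chart. Qed.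

Lemma const_sin : exists a, forall z, U z -> int_sin Th Th' z = a.
Proof.
apply: constant_of_generic.
- move=> m; exact: Cm_add oU (Cm_mul oU (Cm_sin_coord oU m iphi) (s_e ith m))
    (Cm_mul oU (Cm_cos_coord oU m iphi) (s_Th' m)).
- move=> z Vz; rewrite (pds_val (is_derive_int_sin (isds (s_e ith) Vz) (isds s_Th' Vz))).
  by rewrite (pds_e ith Vz) (pds_Th' Vz) !mxE; ring.
- move=> i z Vz; rewrite (pd_val (is_derive_int_sin (isd i (s_e ith) Vz) (isd i s_Th' Vz))).
  by rewrite (pd_Th i Vz) (pd_Th' i Vz) /= evecE /int_cos; ring.
Qed.

Lemma const_cos : exists a, forall z, U z -> int_cos Th Th' z = a.
Proof.
apply: constant_of_generic.
- move=> m; exact: Cm_add oU (Cm_mul oU (Cm_cos_coord oU m iphi) (s_e ith m))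
    (Cm_opp oU (Cm_mul oU (Cm_sin_coord oU m iphi) (s_Th' m))).
- move=> z Vz; rewrite (pds_val (is_derive_int_cos (isds (s_e ith) Vz) (isds s_Th' Vz))).
  by rewrite (pds_e ith Vz) (pds_Th' Vz) !mxE; ring.
- move=> i z Vz; rewrite (pd_val (is_derive_int_cos (isd i (s_e ith) Vz) (isd i s_Th' Vz))).
  by rewrite (pd_Th i Vz) (pd_Th' i Vz) /= evecE /int_sin; ring.
Qed.

Lemma const_phi : exists a, forall z, U z -> int_phi Th' (eta X iphi) z = a.
Proof.
apply: constant_of_generic.
- move=> m; exact: Cm_add oU (s_e iphi m) (Cm_opp oU (Cm_mul oU
    (Cm_mul oU (Cm_cos_coord oU m ith) (Cm_csc oU s0 m)) (s_Th' m))).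
- move=> z Vz; rewrite (pds_val (is_derive_int_phi (s0 (VU Vz)) (isds s_Th' Vz)
    (isds (s_e iphi) Vz))).
  by rewrite (pds_e iphi Vz) (pds_Th' Vz) !mxE; ring.
- move=> i z Vz; rewrite (pd_val (is_derive_int_phi (s0 (VU Vz)) (isd i s_Th' Vz)
    (isd i (s_e iphi) Vz))).
  have [_ _ _ [H1 H2 H3 _]] := orb Vz.
  rewrite (pd_Th' i Vz) /= evecE; have S0 := s0 (VU Vz).
  elim/ord5_ind: i => /=; rewrite ?H1 ?H2 ?H3 ?(pt_e (y := iphi) isT Vz)
    ?(pr_e (y := iphi) isT Vz); ring.
Qed.

Lemma const_psi : exists a, forall z, U z -> int_psi Th' (eta X ipsi) z = a.
Proof.
apply: constant_of_generic.
- move=> m; exact: Cm_add oU (s_e ipsi m) (Cm_mul oU (s_Th' m) (Cm_csc oU s0 m)).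
- move=> z Vz; rewrite (pds_val (is_derive_int_psi (s0 (VU Vz)) (isds s_Th' Vz)
    (isds (s_e ipsi) Vz))).
  by rewrite (pds_e ipsi Vz) (pds_Th' Vz) !mxE; ring.
- move=> i z Vz; rewrite (pd_val (is_derive_int_psi (s0 (VU Vz)) (isd i s_Th' Vz)
    (isd i (s_e ipsi) Vz))).
  have [_ _ _ [_ _ _ [H1 H2 H3]]] := orb Vz.
  rewrite (pd_Th' i Vz) /= evecE; have S0 := s0 (VU Vz).
  elim/ord5_ind: i => /=; rewrite ?H1 ?H2 ?H3 ?(pt_e (y := ipsi) isT Vz)
    ?(pr_e (y := ipsi) isT Vz); ring.
Qed.

Lemma const_eta_t : exists a, forall z, U z -> eta X it z = a.
Proof.
apply: constant_of_generic (s_e it) _ _; first by move=> z; exact: pds_e.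
by move=> i z; exact: pd_et.
Qed.

Lemma const_pds_xi : exists a, forall z, U z -> pds (xi X) z = a.
Proof.
apply: constant_of_generic (smooth_pds s_x) _ _; first by move=> z /pdsE[].
by move=> i z; exact: pd_pds_x.
Qed.

Lemma const_xi : exists a, forall z, U z -> int_xi (xi X) z = a.
Proof.
apply: constant_of_generic.
- move=> m; exact: Cm_add oU (s_x m)
    (Cm_opp oU (Cm_mul oU (Cm_time oU m) (smooth_pds s_x m))).
- move=> z Vz.
  rewrite (pds_val (is_derive_int_xi (isds s_x Vz) (isds (smooth_pds s_x) Vz))).
  by have [_ ->] := pdsE Vz; rewrite /= mul1r subrr mulr0 subr0.
- move=> i z Vz.
  rewrite (pd_val (is_derive_int_xi (isd i s_x Vz) (isd i (smooth_pds s_x) Vz))).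
  by rewrite (pd_x i Vz) (pd_pds_x i Vz) /= mul0r mulr0 !subr0.
Qed.

(** Solving the seven constants for the components of the field recovers the
    general combination of generators. *)
Lemma classification : exists c : 'I_7 -> R, forall z, U z -> X z = gen_of c z.
Proof.
have [a1 H1] := const_xi; have [a2 H2] := const_pds_xi.
have [a3 H3] := const_eta_t; have [a4 H4] := const_phi.
have [a5 H5] := const_psi; have [a6 H6] := const_sin.
have [a7 H7] := const_cos.
exists (tnth [tuple a1; a2; a3; a4; a5; a6; a7]) => z Uz.
rewrite -[gen_of _]/(gen a1 a2 a3 a4 a5 a6 a7).
apply: injective_projections.
  by rewrite /= -(H1 z Uz) -(H2 z Uz) /int_xi mulrC subrK.
apply/rowP => i; rewrite [RHS]mxE -[LHS]/(eta X i z) /gen_eta /rot /rot'.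
rewrite -(H3 z Uz) -(H4 z Uz) -(H5 z Uz) -(H6 z Uz) -(H7 z Uz).
rewrite /int_phi /int_psi /int_sin /int_cos.
have sc : cos (z.2 0 iphi) ^+ 2 = 1 - sin (z.2 0 iphi) ^+ 2 by exact: cos2sin2.
have S0 := s0 Uz; elim/ord5_ind: i => /=.
- by [].
- exact: generic_dense (s_e ir) (fun y => @er0 y) z Uz.
- by ring: sc.
- by field: sc.
- by field: sc.
Qed.

End Classification.

(** * The symmetry algebra *)

Section SymmetryAlgebra.
Context {R : realType}.
Variables M q rinf : R.
Hypothesis hq : q != 0.
Hypothesis hrinf : 0 < rinf.
Hypothesis f_rinf : bh_f M q rinf != 0.
Variable U : set (R * 'rV[R]_5).
Hypothesis oU : open U.
Hypothesis cU : connected U.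
Hypothesis U0 : U !=set0.
Hypothesis U_chart : forall z, U z -> chart M q rinf z.2.
Local Notation L := (lie_symmetry (bh_metric M q rinf) U).

Lemma lie_symmetryP X : L X <->
  smooth U X /\ forall z, U z -> determining (bh_metric M q rinf) X z.
Proof.
have Gsym := christoffel_sym (bh_metric_sym M q rinf).
have dG z : U z -> forall i j k l,
    derivable (christoffel (bh_metric M q rinf) i j k) z.2 (evec l).
  by move=> /U_chart cz i j k l; exact: derivable_christoffel.
split=> -[sX H]; split=> //.
  move=> z Uz; apply/(determiningP Gsym oU (smooth_xi oU sX)
    (fun i => smooth_eta i oU sX) Uz (dG z Uz)) => p pz.
  by apply: H; rewrite pz.
move=> p Up gp i.
have [_ P] := determiningP Gsym oU (smooth_xi oU sX)
  (fun i => smooth_eta i oU sX) Up (dG _ Up).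
exact: P (H _ Up) p erefl gp i.
Qed.

Lemma lie_symmetry_gen c : L (gen_of c).
Proof.
apply/lie_symmetryP; split.
  by apply: smooth_gen => // z /U_chart[].
by move=> z /U_chart; exact: determining_gen.
Qed.

(** The classification in one direction; in the other one the generators
    satisfy the determining equations, which depend on the values on [U]
    only. *)
Lemma lie_symmetryE X : L X <-> exists c, forall z, U z -> X z = gen_of c z.
Proof.
split=> [/lie_symmetryP[sX dX]|[c Xc]].
  exact (classification hq hrinf f_rinf oU cU U0 U_chart sX dX).
have /lie_symmetryP[sc dc] := lie_symmetry_gen c.
apply/lie_symmetryP; split.
  by apply: smooth_eq_on oU _ sc => z Uz; rewrite Xc.
by move=> z Uz; apply: determining_eq_on oU Uz _ (dc z Uz) => y /Xc ->.
Qed.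

Definition bracket_coef (c d : 'I_7 -> R) : 'I_7 -> R :=
  let c' k lt := c (@o7 k lt) in let d' k lt := d (@o7 k lt) in
  tnth [tuple c' 0%N isT * d' 1%N isT - d' 0%N isT * c' 1%N isT; 0; 0;
    c' 5%N isT * d' 6%N isT - d' 5%N isT * c' 6%N isT; 0;
    d' 3%N isT * c' 6%N isT - c' 3%N isT * d' 6%N isT;
    c' 3%N isT * d' 5%N isT - d' 3%N isT * c' 5%N isT].

Lemma bracket_gen_of c d z : U z ->
  bracket (gen_of c) (gen_of d) z = gen_of (bracket_coef c d) z.
Proof. by move=> /U_chart[_ s0 _]; exact: bracket_gen. Qed.

Lemma bracket_eq_on (X X' Y Y' : vfield R 5) z : U z ->
  (forall y, U y -> X y = X' y) -> (forall y, U y -> Y y = Y' y) ->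
  bracket X Y z = bracket X' Y' z.
Proof.
move=> Uz EX EY; have A (Z Z' T T' : vfield R 5) :
    (forall y, U y -> Z y = Z' y) -> (forall y, U y -> T y = T' y) ->
    vf_act Z T z = vf_act Z' T' z.
  move=> EZ ET; rewrite /vf_act /xi /eta (EZ z Uz).
  have D v : 'D_v T z = 'D_v T' z by exact: derive_eq_on oU Uz ET.
  apply: (congr2 (fun a b => a + b)).
    exact (congr1 (fun a => (Z' z).1 *: a) (D _)).
  apply: eq_bigr => i _.
  exact (congr1 (fun a => (Z' z).2 0 i *: a) (D _)).
exact (congr2 (fun a b => a - b) (A _ _ _ _ EX EY) (A _ _ _ _ EY EX)).
Qed.

Lemma lie_algebra_symmetries : lie_algebra L.
Proof.
split.
- apply/lie_symmetryE; exists (fun=> 0) => z _.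
  apply: etrans (gen_ofE _ z); apply/esym; apply: big1 => i _.
  exact: scale0r.
- move=> a X Y /lie_symmetryE[c Xc] /lie_symmetryE[d Yd].
  apply/lie_symmetryE; exists (fun i => a * c i + d i) => z Uz.
  rewrite (Xc z Uz) (Yd z Uz) -!gen_ofE scaler_sumr -big_split.
  by apply: eq_bigr => i _; rewrite /= scalerDl scalerA.
- move=> X Y /lie_symmetryE[c Xc] /lie_symmetryE[d Yd].
  apply/lie_symmetryE; exists (bracket_coef c d) => z Uz.
  by rewrite (bracket_eq_on Uz Xc Yd) bracket_gen_of.
Qed.

(** The coefficients of a combination are recovered from its components and
    their derivatives; for the last two, ([rot'], [rot]) is the rotation of
    their vector by the angle phi. *)
Lemma gen_of_free c : (forall z, U z -> gen_of c z = 0) -> forall i, c i = 0.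
Proof.
move=> H; have s0 z : U z -> sin (z.2 0 ith) != 0 by case/U_chart.
have [z Uz] := U0.
have Hx y : U y -> xi (gen_of c) y = 0 by move=> Uy; rewrite /xi H.
have He i y : U y -> eta (gen_of c) i y = 0 by move=> Uy; rewrite /eta H // mxE.
have c1 : c (@o7 1 isT) = 0.
  have := derive_eq_on ((1, 0) : R * 'rV[R]_5) oU Uz Hx.
  rewrite (is_derive_val (is_derive_gen_xi _ _ _ _ _ _ _ _ _)) /= mulr1 => ->.
  exact: is_derive_val (is_derive_cstf _ _ _).
have c0 : c (@o7 0 isT) = 0.
  by have := Hx z Uz; rewrite /xi /= c1 mul0r addr0.
have c2 : c (@o7 2 isT) = 0 by have := He it z Uz; rewrite /eta mxE.
have rot0 : rot (c (@o7 5 isT)) (c (@o7 6 isT)) (z.2 0 iphi) = 0.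
  by have := He ith z Uz; rewrite /eta mxE.
have rot'0 : rot' (c (@o7 5 isT)) (c (@o7 6 isT)) (z.2 0 iphi) = 0.
  have := derive_eq_on ((0, evec iphi) : R * 'rV[R]_5) oU Uz (He ith).
  rewrite D_gen_eta; last exact: s0.
  rewrite /gen_eta1 /= => ->.
  exact: is_derive_val (is_derive_cstf _ _ _).
have sc := cos2sin2 (z.2 0 iphi).
have c5 : c (@o7 5 isT) = 0.
  transitivity (sin (z.2 0 iphi) * rot (c (@o7 5 isT)) (c (@o7 6 isT)) (z.2 0 iphi)
    + cos (z.2 0 iphi) * rot' (c (@o7 5 isT)) (c (@o7 6 isT)) (z.2 0 iphi)).
    by rewrite /rot /rot'; ring: sc.
  by rewrite rot0 rot'0 !mulr0 addr0.
have c6 : c (@o7 6 isT) = 0.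
  transitivity (cos (z.2 0 iphi) * rot (c (@o7 5 isT)) (c (@o7 6 isT)) (z.2 0 iphi)
    - sin (z.2 0 iphi) * rot' (c (@o7 5 isT)) (c (@o7 6 isT)) (z.2 0 iphi)).
    by rewrite /rot /rot'; ring: sc.
  by rewrite rot0 rot'0 !mulr0 subr0.
have c3 : c (@o7 3 isT) = 0.
  by have := He iphi z Uz; rewrite /eta mxE /gen_eta /= rot'0 mulr0 addr0.
have c4 : c (@o7 4 isT) = 0.
  by have := He ipsi z Uz; rewrite /eta mxE /gen_eta /= rot'0 mul0r subr0.
by elim/ord7_ind.
Qed.

Lemma basis_symmetries : basis_on U L bh_basis.
Proof.
split.
- move=> i; apply/lie_symmetryE; exists (fun j => (j == i)%:R) => z _.
  exact: basis_gen.
- by move=> c H; apply: gen_of_free => z Uz; rewrite -gen_ofE H.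
- move=> X /lie_symmetryE[c Xc]; exists c => z Uz.
  by rewrite Xc // gen_ofE.
Qed.

Lemma bracket_basis i j z : U z -> bracket (bh_basis i) (bh_basis j) z =
  gen_of (bracket_coef (fun l => (l == i)%:R) (fun l => (l == j)%:R)) z.
Proof.
move=> Uz; apply: etrans (bracket_gen_of _ _ Uz).
exact: bracket_eq_on Uz (fun y _ => basis_gen i y) (fun y _ => basis_gen j y).
Qed.

Lemma bracket_table z : U z ->
  [/\ bracket X1 X2 z = X1 z, bracket X4 X6 z = X7 z,
      bracket X4 X7 z = - X6 z & bracket X6 X7 z = X4 z].
Proof.
move=> Uz.
have B i j (k : 'I_7) (a : R) :
    (forall l, bracket_coef (fun l => (l == i)%:R) (fun l => (l == j)%:R) l
       = a * (l == k)%:R) ->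
    bracket (bh_basis i) (bh_basis j) z = a *: bh_basis k z.
  move=> E; apply: etrans (bracket_basis i j Uz) _.
  rewrite (gen_of_eq E) basis_gen -!gen_ofE scaler_sumr.
  by apply: eq_bigr => l _; rewrite scalerA.
split.
- rewrite -[RHS]scale1r; apply: (B (@o7 0 isT) (@o7 1 isT) (@o7 0 isT)).
  by elim/ord7_ind; rewrite /bracket_coef /tnth /=; ring.
- rewrite -[RHS]scale1r; apply: (B (@o7 3 isT) (@o7 5 isT) (@o7 6 isT)).
  by elim/ord7_ind; rewrite /bracket_coef /tnth /=; ring.
- rewrite -scaleN1r; apply: (B (@o7 3 isT) (@o7 6 isT) (@o7 5 isT)).
  by elim/ord7_ind; rewrite /bracket_coef /tnth /=; ring.
- rewrite -[RHS]scale1r; apply: (B (@o7 5 isT) (@o7 6 isT) (@o7 3 isT)).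
  by elim/ord7_ind; rewrite /bracket_coef /tnth /=; ring.
Qed.

Lemma bracket_basis_eq0 (i j : 'I_7) : (i < j)%N ->
  ((i.+1, j.+1) \notin [:: (1, 2); (4, 6); (4, 7); (6, 7)])%N ->
  forall z, U z -> bracket (bh_basis i) (bh_basis j) z = 0.
Proof.
move=> ij nij z Uz; apply: etrans (bracket_basis i j Uz) _.
apply: etrans (esym (gen_ofE _ z)) _; apply: big1 => l _.
suff -> : bracket_coef (fun l => (l == i)%:R) (fun l => (l == j)%:R) l = 0.
  by rewrite scale0r.
move: ij nij; elim/ord7_ind: i; elim/ord7_ind: j => //= _; rewrite ?inE //= => _;
  by elim/ord7_ind: l; rewrite /bracket_coef /tnth /=; ring.
Qed.

End SymmetryAlgebra.

Theorem theorem1 (R : realType) (M q rinf : R) (U : set (R * 'rV[R]_5))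
    (hq : q != 0) (hrinf : 0 < rinf)
    (Uopen : open U) (Uconn : connected U) (Une : U !=set0)
    (Usub : forall z, U z -> bh_region M q rinf z.2) :
  let g := lie_symmetry (bh_metric M q rinf) U in
  [/\ lie_algebra g,
      basis_on U g bh_basis,
      forall z, U z ->
        [/\ bracket X1 X2 z = X1 z, bracket X4 X6 z = X7 z,
            bracket X4 X7 z = - X6 z & bracket X6 X7 z = X4 z] &
      forall i j : 'I_7, (i < j)%N ->
        ((i.+1, j.+1) \notin [:: (1, 2); (4, 6); (4, 7); (6, 7)])%N ->
        forall z, U z -> bracket (bh_basis i) (bh_basis j) z = 0].
Proof.
have U_chart z : U z -> chart M q rinf z.2 by move=> /Usub/region_chart[].
have f_rinf : bh_f M q rinf != 0 by have [z /Usub/region_chart[]] := Une.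
move=> g; split.
- exact (lie_algebra_symmetries hq hrinf f_rinf Uopen Uconn Une U_chart).
- exact (basis_symmetries hq hrinf f_rinf Uopen Uconn Une U_chart).
- by move=> z Uz; exact (bracket_table Uopen U_chart Uz).
- move=> i j ij nij z Uz.
  exact (bracket_basis_eq0 Uopen U_chart ij nij Uz).
Qed.
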